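(* Let $(V,\sigma)$ be a braided vector space. Then the quintuple $(\mathcal{P}(V),*_\sigma,\Delta'_{AT},\varepsilon'_{AT},\sigma_{AT})$ is a braided Hopf algebra. Moreover, the coproduct $\Delta'_{AT}$ on $\mathcal{P}(V)$ is given by the recursive formula $\Delta'_{AT}(|)=|\otimes|$ and $$\Delta'_{AT}(T)=T\otimes|+( *_\sigma^{(k)}\otimes\vee_k)\,\sigma^{(k)}_{\mathcal{P}(V)}\big(\Delta'_{AT}(T_0)\otimes v_1\otimes\Delta'_{AT}(T_1)\otimes v_2\otimes\cdots\otimes v_k\otimes\Delta'_{AT}(T_k)\big)$$ for every decorated tree $T=T_0\vee_{v_1}\cdots\vee_{v_k}T_k$ with $k\ge1$ and $v_1,\dots,v_k\in V$.
   Context: Ground field $\mathbf{k}$ of characteristic $0$; all vector spaces, algebras and tensor products are over $\mathbf{k}$. Braidings. A braiding on a vector space $V$ is a linear map $\sigma\in\mathrm{End}(V\otimes V)$ with $(\sigma\otimes \mathrm{id})(\mathrm{id}\otimes\sigma)(\sigma\otimes \mathrm{id})=(\mathrm{id}\otimes\sigma)(\sigma\otimes \mathrm{id})(\mathrm{id}\otimes\sigma)$ on $V^{\otimes3}$ (invertibility is not required); $(V,\sigma)$ is then a braided vector space. For an operator on two adjacent tensor factors, the subscript $i$ (as in $\sigma_i$) means it acts on the $i$-th and $(i+1)$-th factors. For $w\in\mathfrak{S}_n$ with reduced expression $w=s_{i_1}\cdots s_{i_l}$ put $T^\sigma_w=\sigma_{i_1}\cdots\sigma_{i_l}$ on $V^{\otimes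 n}$; when $\sigma$ is the flip, $T_w(v_1\otimes\cdots\otimes v_n)=v_{w^{-1}(1)}\otimes\cdots\otimes v_{w^{-1}(n)}$. For $i,j\ge1$ let $\beta_{ij}=T^\sigma_{\chi_{ij}}:V^{\otimes i}\otimes V^{\otimes j}\to V^{\otimes j}\otimes V^{\otimes i}$, where $\chi_{ij}\in\mathfrak{S}_{i+j}$ sends $a\mapsto j+a$ for $1\le a\le i$ and $i+b\mapsto b$ for $1\le b\le j$; $\beta_{0i}=\beta_{i0}=\mathrm{id}$. Braided Hopf algebras. A braided algebra $(A,\mu,\sigma)$ is an associative algebra with a braiding satisfying $(\mu\otimes\mathrm{id})\sigma_2\sigma_1=\sigma(\mathrm{id}\otimes\mu)$ and $(\mathrm{id}\otimes\mu)\sigma_1\sigma_2=\sigma(\mu\otimes\mathrm{id})$. A braided coalgebra $(C,\Delta,\varepsilon,\sigma)$ is a coalgebra with a braiding satisfying $\sigma_1\sigma_2(\Delta\otimes\mathrm{id})=(\mathrm{id}\otimes\Delta)\sigma$, $\sigma_2\sigma_1(\mathrm{id}\otimes\Delta)=(\Delta\otimes\mathrm{id})\sigma$, $(\varepsilon\otimes\mathrm{id})\sigma=\mathrm{id}\otimes\varepsilon$, $(\mathrm{id}\otimes\varepsilon)\sigma=\varepsilon\otimes\mathrm{id}$. A braided bialgebra $(H,\mu,\Delta,\varepsilon,\sigma)$ is a braided algebra and braided coalgebra with $\Delta\mu=(\mu\otimes\mu)\sigma_2(\Delta\otimes\Delta)$. It is a braided Hopf algebra if it has a unit $1_H$ and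 an antipode, i.e. a linear $S:H\to H$ with $\mu(S\otimes\mathrm{id})\Delta=\varepsilon 1_H=\mu(\mathrm{id}\otimes S)\Delta$. Braided tridendriform algebras. A tridendriform algebra $(R,\prec,\succ,\cdot)$ is a vector space with three bilinear operations satisfying, with $*:=\prec+\succ+\cdot$: $(x\prec y)\prec z=x\prec(y*z)$; $(x\succ y)\prec z=x\succ(y\prec z)$; $x\succ(y\succ z)=(x*y)\succ z$; $(x\cdot y)\prec z=x\cdot(y\prec z)$; $(x\prec y)\cdot z=x\cdot(y\succ z)$; $(x\succ y)\cdot z=x\succ(y\cdot z)$; $(x\cdot y)\cdot z=x\cdot(y\cdot z)$. It is braided, with braiding $\sigma$ on $R$, if for each $\odot\in\{\prec,\succ,\cdot\}$, $\sigma(\mathrm{id}\otimes\odot)=(\odot\otimes\mathrm{id})\sigma_2\sigma_1$ and $\sigma(\odot\otimes\mathrm{id})=(\mathrm{id}\otimes\odot)\sigma_1\sigma_2$. Homomorphisms preserve the operations and the braidings. The augmentation is $R^+=\mathbf{k}\oplus R$ with $1\prec x=0$, $x\prec1=x$, $1\succ x=x$, $x\succ1=0$, $1\cdot x=x\cdot1=0$ for $x\in R$, $*$ extended with unit $1$, and $\sigma(1\otimes x)=x\otimes1$, $\sigma(x\otimes1)=1\otimes x$. For a braided tridendriform algebra $R$, the space $R\boxtimes R:=(R\otimes\mathbf{k})\oplus(\mathbf{k}\otimes R)\oplus(R\otimes R)\subset R^+\otimes R^+$ is a braided tridendriform algebra with operations (for $\odot\in\{\prec,\succ,\cdot\}$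 and $\boxdot$ the corresponding operation on $R\boxtimes R$) $(x\otimes y)\boxdot(x'\otimes y')=( *\otimes\odot)\sigma_2(x\otimes y\otimes x'\otimes y')$ if $y\in R$ or $y'\in R$, and $(x\odot x')\otimes yy'$ if $y,y'\in\mathbf{k}$, and with braiding $\beta=\sigma_2\sigma_1\sigma_3\sigma_2$; its augmentation is identified with $R^+\otimes R^+$. Angularly decorated trees. $\mathcal{D}_n$ is the set of planar rooted trees with $n+1$ leaves in which every internal vertex has at least two branches; $\mathcal{D}_0=\{|\}$. A tree in $\mathcal{D}_n$ has exactly $n$ angles (between adjacent branches at internal vertices), the $i$-th being the one located between the $i$-th and $(i+1)$-th leaves. Set $\mathcal{P}(V)=\bigoplus_{n\ge0}\mathbf{k}\mathcal{D}_n\otimes V^{\otimes n}$, $\overline{\mathcal{P}(V)}=\bigoplus_{n\ge1}\mathbf{k}\mathcal{D}_n\otimes V^{\otimes n}$; $T\otimes(v_1\otimes\cdots\otimes v_n)$ is identified with the tree $(T;v_1,\dots,v_n)$ whose $i$-th angle is decorated by $v_i$. Each decorated tree $T\ne|$ is uniquely $T_0\vee_{v_1}\cdots\vee_{v_k}T_k$ ($k\ge1$): the root vertex has branches $T_0,\dots,T_k$ from left to right with the angles at the root vertex decorated by $v_1,\dots,v_k$; $\vee_k:(\mathcal{P}(V)\otimes V)^{\otimes k}\otimes\mathcal{P}(V)\to\mathcal{P}(V)$ is the corresponding linear grafting map. Write $T[v]=|\vee_v|$. For $T=T_0\vee_{v_1}\cdots\vee_{v_k}T_k$, $T'=T'_0\vee_{v_{k+1}}\cdots\vee_{v_{k+l}}T'_l$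 ($k,l\ge1$), recursively, $$T\prec_\sigma T'=T_0\vee_{v_1}\cdots\vee_{v_k}(T_k*_\sigma T'),\quad T\succ_\sigma T'=(T*_\sigma T'_0)\vee_{v_{k+1}}\cdots\vee_{v_{k+l}}T'_l,$$ $$T\cdot_\sigma T'=T_0\vee_{v_1}\cdots\vee_{v_k}(T_k*_\sigma T'_0)\vee_{v_{k+1}}\cdots\vee_{v_{k+l}}T'_l,$$ where $*_\sigma=\prec_\sigma+\succ_\sigma+\cdot_\sigma$ on $\overline{\mathcal{P}(V)}$, extended to $\mathcal{P}(V)=\overline{\mathcal{P}(V)}^+$ with unit $|$. The braiding is $\sigma_{AT}((T;v_1,\dots,v_m)\otimes(T';v_{m+1},\dots,v_{m+n}))=(T'\otimes T)\beta_{mn}(v_1\otimes\cdots\otimes v_{m+n})$, and $\sigma_{V,\mathcal{P}(V)}:V\otimes\mathcal{P}(V)\to\mathcal{P}(V)\otimes V$ is $v\otimes(T;v_1,\dots,v_m)\mapsto(T\otimes\mathrm{id}_V)\beta_{1,m}(v\otimes v_1\otimes\cdots\otimes v_m)$. With these, $\overline{\mathcal{P}(V)}$ is the free braided tridendriform algebra on $(V,\sigma)$ via $v\mapsto T[v]$. Coproduct. $\Delta'_{AT}:\mathcal{P}(V)\to\mathcal{P}(V)\otimes\mathcal{P}(V)$ is the unique linear map with $\Delta'_{AT}(|)=|\otimes|$ whose restriction $\overline{\mathcal{P}(V)}\to\overline{\mathcal{P}(V)}\boxtimes\overline{\mathcal{P}(V)}$ is the homomorphism of braided tridendriform algebras with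 $\Delta'_{AT}(T[v])=T[v]\otimes|+|\otimes T[v]$ for $v\in V$. The counit is $\varepsilon'_{AT}(T)=\delta_{T,|}$. Notation in the formula. $*_\sigma^{(k)}:\mathcal{P}(V)^{\otimes(k+1)}\to\mathcal{P}(V)$ is the iterated product $*_\sigma( *_\sigma\otimes\mathrm{id})\cdots( *_\sigma\otimes\mathrm{id}^{\otimes(k-1)})$, and $\sigma^{(k)}_{\mathcal{P}(V)}=\Sigma_k\Sigma_{k-1}\cdots\Sigma_1$ (composition, $\Sigma_1$ applied first), where $\Sigma_i=(\sigma_{AT})_{i+1}(\sigma_{V,\mathcal{P}(V)})_{i+2}(\sigma_{AT})_{i+3}(\sigma_{V,\mathcal{P}(V)})_{i+4}\cdots(\sigma_{AT})_{3i-1}(\sigma_{V,\mathcal{P}(V)})_{3i}$. *)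

(* Defs.v *)
From HB Require Import structures.
From mathcomp Require Import all_boot all_order all_algebra.
From mathcomp Require Import boolp zify.

Set Implicit Arguments.
Unset Strict Implicit.
Unset Printing Implicit Defensive.

Import GRing.Theory.
Local Open Scope ring_scope.
Local Open Scope quotient_scope.

Section Linear.
Variable k : fieldType.
Implicit Types U V W X Y : lmodType k.

Definition mklin U W (f : U -> W) (h : linear f) : {linear U -> W} :=
  HB.pack f (GRing.isLinear.Build k U W *:%R f h).

Lemma linear_ext U W (f g : {linear U -> W}) : f =1 g -> f = g.
Proof.
case: f g => [f [[mf] [sf]]] [g [[mg] [sg]]] /= /funext E; subst g.
by rewrite (Prop_irrelevance mf mg) (Prop_irrelevance sf sg).
Qed.

Definition lcomp U V W (g : {linear V -> W}) (f : {linear U -> V}) :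
  {linear U -> W} := g \o f.

Definition lid U : {linear U -> U} := idfun.

Lemma lcompE U V W (g : {linear V -> W}) (f : {linear U -> V}) x :
  lcomp g f x = g (f x).
Proof. by []. Qed.
End Linear.

Arguments lid {k} U.
Infix "∘" := lcomp (at level 40, left associativity).

Section Hom.
Variables (k : fieldType) (U W : lmodType k).

HB.instance Definition _ := gen_eqMixin {linear U -> W}.
HB.instance Definition _ := gen_choiceMixin {linear U -> W}.

Let hzero_lin : linear (fun _ : U => 0 : W).
Proof. by move=> a x y; rewrite scaler0 addr0. Qed.
Let hopp_lin (f : {linear U -> W}) : linear (fun x => - f x).
Proof. by move=> a x y; rewrite linearP opprD scalerN. Qed.
Let hadd_lin (f g : {linear U -> W}) : linear (fun x => f x + g x).
Proof. by move=> a x y; rewrite !linearP scalerDr addrACA. Qed.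
Let hscale_lin (c : k) (f : {linear U -> W}) : linear (fun x => c *: f x).
Proof. by move=> a x y; rewrite linearP scalerDr !scalerA mulrC. Qed.

Let hzero := mklin hzero_lin.
Let hopp f := mklin (hopp_lin f).
Let hadd f g := mklin (hadd_lin f g).
Let hscale c f := mklin (hscale_lin c f).

Let haddA : associative hadd.
Proof. by move=> f g h; apply: linear_ext => x /=; rewrite addrA. Qed.
Let haddC : commutative hadd.
Proof. by move=> f g; apply: linear_ext => x /=; rewrite addrC. Qed.
Let hadd0 : left_id hzero hadd.
Proof. by move=> f; apply: linear_ext => x /=; rewrite add0r. Qed.
Let haddN : left_inverse hzero hopp hadd.
Proof. by move=> f; apply: linear_ext => x /=; rewrite addNr. Qed.

HB.instance Definition _ :=
  GRing.isZmodule.Build {linear U -> W} haddA haddC hadd0 haddN.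

Let hscaleA a b f : hscale a (hscale b f) = hscale (a * b) f.
Proof. by apply: linear_ext => x /=; rewrite scalerA. Qed.
Let hscale1 : left_id 1 hscale.
Proof. by move=> f; apply: linear_ext => x /=; rewrite scale1r. Qed.
Let hscaleDr : right_distributive hscale +%R.
Proof. by move=> a f g; apply: linear_ext => x /=; rewrite scalerDr. Qed.
Let hscaleDl f : {morph hscale^~ f : a b / a + b}.
Proof. by move=> a b; apply: linear_ext => x /=; rewrite scalerDl. Qed.

HB.instance Definition _ :=
  GRing.Zmodule_isLmodule.Build k {linear U -> W}
    hscaleA hscale1 hscaleDr hscaleDl.

Lemma hom0E x : (0 : {linear U -> W}) x = 0.
Proof. by []. Qed.
Lemma homDE (f g : {linear U -> W}) x : (f + g) x = f x + g x.
Proof. by []. Qed.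
Lemma homZE c (f : {linear U -> W}) x : (c *: f) x = c *: f x.
Proof. by []. Qed.
End Hom.

(** Vector spaces given by a universal property.  [gen] is a set of
    generators and [adm] selects the maps out of it through which the universal
    property is expressed; [pmod] consists of formal sums of generators, two
    sums being identified when no admissible map separates them. *)
Section Presentation.
Variable k : fieldType.

Record presentation := Presentation {
  gen : choiceType;
  adm : forall W : lmodType k, (gen -> W) -> Prop;
  gscale : k -> gen -> gen;
  adm_scale : forall (W : lmodType k) (f : gen -> W), adm f ->
    forall a g, f (gscale a g) = a *: f g }.

Variable p : presentation.
Implicit Types s t : seq (gen p).

Definition sum_eq s t : bool :=
  `[< forall (W : lmodType k) (f : gen p -> W), adm f ->
        \sum_(g <- s) f g = \sum_(g <- t) f g >].

Let sum_eq_equiv : equiv_class_of sum_eq.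
Proof.
split=> [s|s t|t s u].
- exact/asboolP.
- by apply/asboolP/asboolP => h W f hf; rewrite h.
- by move=> /asboolP h /asboolP h'; apply/asboolP => W f hf; rewrite h // h'.
Qed.
Canonical sum_eq_equivRel := EquivRelPack sum_eq_equiv.

Definition pmod : Type := {eq_quot sum_eq_equivRel}.
HB.instance Definition _ := Choice.on pmod.
HB.instance Definition _ := EqQuotient.on pmod.

Definition pclass (s : seq (gen p)) : pmod := \pi_pmod s.
Definition prepr (x : pmod) : seq (gen p) := repr x.

Lemma preprK x : pclass (prepr x) = x.
Proof. exact: reprK. Qed.

Lemma pmod_pi s t : (forall (W : lmodType k) (f : gen p -> W), adm f ->
    \sum_(g <- s) f g = \sum_(g <- t) f g) -> pclass s = pclass t.
Proof. by move=> h; apply/eqmodP/asboolP. Qed.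

Lemma pmod_repr s (W : lmodType k) (f : gen p -> W) : adm f ->
  \sum_(g <- prepr (pclass s)) f g = \sum_(g <- s) f g.
Proof.
move=> hf; have : pclass (prepr (pclass s)) = pclass s by rewrite preprK.
by move=> /eqmodP /asboolP; apply.
Qed.

Let pzero : pmod := pclass [::].
Let padd (x y : pmod) : pmod := pclass (prepr x ++ prepr y).
Let pscale (a : k) (x : pmod) : pmod := pclass (map (gscale a) (prepr x)).

Let sum_scale a s (W : lmodType k) (f : gen p -> W) : adm f ->
  \sum_(g <- map (gscale a) s) f g = a *: \sum_(g <- s) f g.
Proof.
move=> hf; rewrite big_map scaler_sumr.
by apply: eq_bigr => g _; rewrite adm_scale.
Qed.

Let pind (x : pmod) : x = pclass (prepr x). Proof. by rewrite preprK. Qed.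

Let paddA : associative padd.
Proof.
by move=> x y z; apply: pmod_pi => W f hf; rewrite !big_cat !pmod_repr ?big_cat //= addrA.
Qed.
Let paddC : commutative padd.
Proof. by move=> x y; apply: pmod_pi => W f hf; rewrite !big_cat /= addrC. Qed.
Let padd0 : left_id pzero padd.
Proof.
move=> x; rewrite [RHS]pind; apply: pmod_pi => W f hf.
by rewrite big_cat /= pmod_repr // big_nil add0r.
Qed.
Let paddN : left_inverse pzero (pscale (-1)) padd.
Proof.
move=> x; apply: pmod_pi => W f hf.
by rewrite big_cat /= pmod_repr // sum_scale // scaleN1r addNr big_nil.
Qed.
HB.instance Definition _ := GRing.isZmodule.Build pmod paddA paddC padd0 paddN.

Let pscaleA a b x : pscale a (pscale b x) = pscale (a * b) x.
Proof.
apply: pmod_pi => W f hf.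
by rewrite !sum_scale // pmod_repr // sum_scale // scalerA.
Qed.
Let pscale1 : left_id 1 pscale.
Proof.
by move=> x; rewrite [RHS]pind; apply: pmod_pi => W f hf; rewrite sum_scale // scale1r.
Qed.
Let pscaleDr : right_distributive pscale +%R.
Proof.
move=> a x y; apply: pmod_pi => W f hf.
by rewrite sum_scale // !pmod_repr // !big_cat /= !pmod_repr // !sum_scale // scalerDr.
Qed.
Let pscaleDl x : {morph pscale^~ x : a b / a + b}.
Proof.
move=> a b; apply: pmod_pi => W f hf.
by rewrite big_cat /= !pmod_repr // !sum_scale // scalerDl.
Qed.
HB.instance Definition _ :=
  GRing.Zmodule_isLmodule.Build k pmod pscaleA pscale1 pscaleDr pscaleDl.

Definition pin (g : gen p) : pmod := pclass [:: g].

Let psum (W : lmodType k) (f : gen p -> W) (x : pmod) : W :=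
  \sum_(g <- prepr x) f g.
Let psum_lin (W : lmodType k) (f : gen p -> W) : adm f -> linear (psum f).
Proof.
move=> hf a x y; rewrite /psum /GRing.add /= /padd pmod_repr // big_cat /=.
by rewrite /GRing.scale /= pmod_repr // sum_scale.
Qed.

Definition plift (W : lmodType k) (f : gen p -> W) (hf : adm f) :
  {linear pmod -> W} := mklin (psum_lin hf).

Lemma plift_pin (W : lmodType k) (f : gen p -> W) (hf : adm f) g :
  plift hf (pin g) = f g.
Proof. by rewrite /= /psum pmod_repr // big_seq1. Qed.

Lemma pmod_eqP (x y : pmod) :
  (forall (W : lmodType k) (f : gen p -> W) (hf : adm f),
     plift hf x = plift hf y) -> x = y.
Proof.
move=> h; rewrite (pind x) (pind y); apply: pmod_pi => W f hf; exact: h hf.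
Qed.

Lemma pmodE (x : pmod) : x = \sum_(g <- prepr x) pin g.
Proof.
rewrite {1}[x]pind; elim: (prepr x) => [|g s IH]; first by rewrite big_nil.
rewrite big_cons -IH /GRing.add /= /padd; apply: pmod_pi => W f hf.
by rewrite big_cat /= !pmod_repr // big_cons big_seq1.
Qed.

Lemma pmod_ext (W : lmodType k) (f f' : {linear pmod -> W}) :
  (forall g, f (pin g) = f' (pin g)) -> f =1 f'.
Proof.
by move=> h x; rewrite (pmodE x) !linear_sum; apply: eq_bigr => g _; apply: h.
Qed.
End Presentation.

(** Tensor products, as opaque objects with the universal property *)
Section Tensor.
Variable k : fieldType.
Implicit Types U V W : lmodType k.

Definition bilinear2 U V W (b : U -> V -> W) : Prop :=
  (forall v, linear (b^~ v)) /\ (forall u, linear (b u)).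

Record tensor_product U V := TensorProduct {
  tp_sort : lmodType k;
  tp_pure : U -> V -> tp_sort;
  tp_bilinear : bilinear2 tp_pure;
  tp_lift : forall W (b : U -> V -> W), bilinear2 b -> {linear tp_sort -> W};
  tp_liftE : forall W (b : U -> V -> W) (hb : bilinear2 b) u v,
    tp_lift hb (tp_pure u v) = b u v;
  tp_ext : forall W (f g : {linear tp_sort -> W}),
    (forall u v, f (tp_pure u v) = g (tp_pure u v)) -> f =1 g }.

Lemma tensor_product_exists U V : tensor_product U V.
Proof.
pose tadm W (f : U * V -> W) := bilinear2 (fun u v => f (u, v)).
pose tscale (a : k) (p : U * V) := (a *: p.1, p.2).
have tadm_scale W (f : U * V -> W) : tadm W f ->
    forall a p, f (tscale a p) = a *: f p.
  move=> [hl _] a [u v].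
  by rewrite -[LHS]/(mklin (hl v) (a *: u)) linearZ.
pose q : presentation k := Presentation tadm_scale.
have bil : bilinear2 (fun u v => pin (p := q) (u, v)).
  split=> [v|u] a x y; apply: pmod_eqP => W f hf; rewrite linearP !plift_pin.
    exact: hf.1.
  exact: hf.2.
apply: (TensorProduct (tp_sort := pmod q) bil
  (tp_lift := fun W b hb => plift (p := q) (f := fun x => b x.1 x.2) hb)).
- by move=> W b hb u v; rewrite plift_pin.
- by move=> W f g h; apply: pmod_ext => -[u v]; apply: h.
Qed.

Section Def.
Variables U V : lmodType k.

Definition tens : lmodType k := tp_sort (tensor_product_exists U V).
Definition pure (u : U) (v : V) : tens := tp_pure _ u v.

Lemma pure_bilinear : bilinear2 pure.
Proof. exact: tp_bilinear. Qed.

Definition tlift W (b : U -> V -> W) (hb : bilinear2 b) : {linear tens -> W} :=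
  tp_lift _ hb.

Lemma tlift_pure W (b : U -> V -> W) (hb : bilinear2 b) u v :
  tlift hb (pure u v) = b u v.
Proof. exact: tp_liftE. Qed.

Lemma tens_ext W (f g : {linear tens -> W}) :
  (forall u v, f (pure u v) = g (pure u v)) -> f =1 g.
Proof. exact: tp_ext. Qed.
End Def.
End Tensor.

Notation "U ⊗ V" := (tens U V) (at level 38, right associativity) : type_scope.
Notation "u \ox v" := (pure u v)
  (at level 38, right associativity) : ring_scope.

Section TensorMaps.
Variable k : fieldType.
Implicit Types A B C D U V W X Y : lmodType k.

Let tcurry_lin U V W (f : {linear U ⊗ V -> W}) u : linear (fun v => f (u \ox v)).
Proof. by move=> a x y; rewrite (pure_bilinear U V).2 linearP. Qed.
Let tcurry_lin2 U V W (f : {linear U ⊗ V -> W}) :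
  linear (fun u => mklin (tcurry_lin f u)).
Proof.
by move=> a x y; apply: linear_ext => v /=; rewrite (pure_bilinear U V).1 linearP.
Qed.
Definition tcurry U V W (f : {linear U ⊗ V -> W}) :
  {linear U -> {linear V -> W}} := mklin (tcurry_lin2 f).

Let tuncurry_bil U V W (f : {linear U -> {linear V -> W}}) :
  bilinear2 (fun u v => f u v).
Proof. by split=> [v|u] a x y /=; rewrite linearP. Qed.
Definition tuncurry U V W (f : {linear U -> {linear V -> W}}) :
  {linear U ⊗ V -> W} := tlift (tuncurry_bil f).

Let lflip_lin U V W (f : {linear U -> {linear V -> W}}) v :
  linear (fun u => f u v).
Proof. by move=> a x y; rewrite linearP. Qed.
Let lflip_lin2 U V W (f : {linear U -> {linear V -> W}}) :
  linear (fun v => mklin (lflip_lin f v)).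
Proof. by move=> a x y; apply: linear_ext => u /=; rewrite linearP. Qed.
Definition lflip U V W (f : {linear U -> {linear V -> W}}) :
  {linear V -> {linear U -> W}} := mklin (lflip_lin2 f).

Let tmap_bil A B C D (f : {linear A -> C}) (g : {linear B -> D}) :
  bilinear2 (fun a b => f a \ox g b).
Proof.
split=> [v|u] a x y; rewrite linearP.
  by rewrite (pure_bilinear C D).1.
by rewrite (pure_bilinear C D).2.
Qed.
Definition tmap A B C D (f : {linear A -> C}) (g : {linear B -> D}) :
  {linear A ⊗ B -> C ⊗ D} := tlift (tmap_bil f g).

Let tflip_bil U V : bilinear2 (fun (u : U) (v : V) => v \ox u).
Proof.
by split=> [v|u] a x y; [rewrite (pure_bilinear V U).2|rewrite (pure_bilinear V U).1].
Qed.
Definition tflip U V : {linear U ⊗ V -> V ⊗ U} := tlift (@tflip_bil U V).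

Definition purel U V (v : V) : {linear U -> U ⊗ V} :=
  mklin ((pure_bilinear U V).1 v).
Definition purer U V (u : U) : {linear V -> U ⊗ V} :=
  mklin ((pure_bilinear U V).2 u).

Let assoc_lin U V W : linear (fun w : W => tmap (lid U) (purel V w)).
Proof.
move=> a x y; apply/linear_ext/tens_ext => u v.
by rewrite homDE homZE !tlift_pure /= (pure_bilinear V W).2 (pure_bilinear U _).2.
Qed.
Definition assoc U V W : {linear (U ⊗ V) ⊗ W -> U ⊗ V ⊗ W} :=
  tuncurry (lflip (mklin (@assoc_lin U V W))).

Let assocV_lin U V W : linear (fun u : U => tmap (purer V u) (lid W)).
Proof.
move=> a x y; apply/linear_ext/tens_ext => v w.
by rewrite homDE homZE !tlift_pure /= (pure_bilinear U V).1 (pure_bilinear _ W).1.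
Qed.
Definition assocV U V W : {linear U ⊗ V ⊗ W -> (U ⊗ V) ⊗ W} :=
  tuncurry (mklin (@assocV_lin U V W)).

Let lunit_bil U : bilinear2 (fun (c : k^o) (u : U) => c *: u).
Proof.
split=> [u|c] a x y; first by rewrite scalerDl scalerA.
by rewrite scalerDr !scalerA mulrC.
Qed.
Definition lunit U : {linear k^o ⊗ U -> U} := tlift (@lunit_bil U).
Definition runit U : {linear U ⊗ k^o -> U} := lunit U ∘ tflip U k^o.

Lemma tcurryE U V W (f : {linear U ⊗ V -> W}) u v : tcurry f u v = f (u \ox v).
Proof. by []. Qed.
Lemma tuncurryE U V W (f : {linear U -> {linear V -> W}}) u v :
  tuncurry f (u \ox v) = f u v.
Proof. exact: tlift_pure. Qed.
Lemma lflipE U V W (f : {linear U -> {linear V -> W}}) u v :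
  lflip f v u = f u v.
Proof. by []. Qed.
Lemma tmapE A B C D (f : {linear A -> C}) (g : {linear B -> D}) a b :
  tmap f g (a \ox b) = f a \ox g b.
Proof. exact: tlift_pure. Qed.
Lemma tflipE U V (u : U) (v : V) : tflip U V (u \ox v) = v \ox u.
Proof. exact: tlift_pure. Qed.
Lemma assocE U V W (u : U) (v : V) (w : W) :
  assoc U V W ((u \ox v) \ox w) = u \ox v \ox w.
Proof. by rewrite tuncurryE lflipE tmapE. Qed.
Lemma assocVE U V W (u : U) (v : V) (w : W) :
  assocV U V W (u \ox v \ox w) = (u \ox v) \ox w.
Proof. by rewrite tuncurryE tmapE. Qed.
Lemma lunitE U (c : k) (u : U) : lunit U ((c : k^o) \ox u) = c *: u.
Proof. exact: tlift_pure. Qed.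
Lemma runitE U (c : k) (u : U) : runit U (u \ox (c : k^o)) = c *: u.
Proof. by rewrite lcompE tflipE lunitE. Qed.

(** [f ⊗ id] on [A ⊗ B ⊗ X], for [f] with values in a tensor product or not *)
Definition act2 A B C D (f : {linear A ⊗ B -> C ⊗ D}) X :
  {linear A ⊗ B ⊗ X -> C ⊗ D ⊗ X} :=
  assoc C D X ∘ tmap f (lid X) ∘ assocV A B X.
Definition mul2 A B C (f : {linear A ⊗ B -> C}) X :
  {linear A ⊗ B ⊗ X -> C ⊗ X} := tmap f (lid X) ∘ assocV A B X.
End TensorMaps.

(** Direct sums, as opaque objects with the universal property *)
Section DirectSum.
Variables (k : fieldType) (I : choiceType) (M : I -> lmodType k).

Record direct_sum := DirectSum {
  ds_sort : lmodType k;
  ds_in : forall i, {linear M i -> ds_sort};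
  ds_lift : forall W : lmodType k, (forall i, {linear M i -> W}) ->
    {linear ds_sort -> W};
  ds_liftE : forall (W : lmodType k) (f : forall i, {linear M i -> W}) i m,
    ds_lift f (ds_in i m) = f i m;
  ds_ext : forall (W : lmodType k) (f g : {linear ds_sort -> W}),
    (forall i m, f (ds_in i m) = g (ds_in i m)) -> f =1 g }.

Lemma direct_sum_exists : direct_sum.
Proof.
pose G : choiceType := {i : I & (M i : choiceType)}.
pose dadm (W : lmodType k) (f : G -> W) :=
  forall i, linear (fun m : M i => f (Tagged M m)).
pose dscale (a : k) (p : G) : G := Tagged M (a *: tagged p).
have dadm_scale (W : lmodType k) (f : G -> W) : dadm W f ->
    forall a p, f (dscale a p) = a *: f p.
  by move=> hf a [i m]; rewrite -[LHS]/(mklin (hf i) (a *: m)) linearZ.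
pose q : presentation k := Presentation dadm_scale.
have in_lin i : linear (fun m : M i => pin (p := q) (Tagged M m)).
  move=> a x y; apply: pmod_eqP => W f hf; rewrite linearP !plift_pin.
  exact: hf.
have lift_adm (W : lmodType k) (f : forall i, {linear M i -> W}) :
    dadm W (fun p => f (tag p) (tagged p)).
  by move=> i a x y /=; rewrite linearP.
apply: (DirectSum (ds_sort := pmod q) (ds_in := fun i => mklin (in_lin i))
  (ds_lift := fun W f => plift (p := q) (lift_adm W f))).
- by move=> W f i m; rewrite plift_pin.
- by move=> W f g h; apply: pmod_ext => -[i m]; apply: h.
Qed.

Definition dsum : lmodType k := ds_sort direct_sum_exists.
Definition dsum_in i : {linear M i -> dsum} := ds_in _ i.
Definition dlift (W : lmodType k) (f : forall i, {linear M i -> W}) :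
  {linear dsum -> W} := ds_lift _ f.

Lemma dlift_in (W : lmodType k) (f : forall i, {linear M i -> W}) i m :
  dlift f (dsum_in i m) = f i m.
Proof. exact: ds_liftE. Qed.

Lemma dsum_ext (W : lmodType k) (f g : {linear dsum -> W}) :
  (forall i m, f (dsum_in i m) = g (dsum_in i m)) -> f =1 g.
Proof. exact: ds_ext. Qed.
End DirectSum.

Definition freemod (k : fieldType) (X : choiceType) : lmodType k :=
  dsum (fun _ : X => k^o : lmodType k).
Definition fgen (k : fieldType) (X : choiceType) (x : X) : freemod k X :=
  dsum_in (fun _ : X => k^o : lmodType k) x (1 : k).

Section FreeLift.
Variables (k : fieldType) (X : choiceType) (W : lmodType k) (f : X -> W).
Let flift1_lin x : linear (fun c : k^o => c *: f x).
Proof. by move=> a b c; rewrite scalerDl scalerA. Qed.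
Definition flift : {linear freemod k X -> W} :=
  dlift (M := fun _ : X => k^o : lmodType k) (fun x => mklin (flift1_lin x)).
Lemma flift_gen x : flift (fgen k x) = f x.
Proof. by rewrite dlift_in /= scale1r. Qed.
End FreeLift.

Section TensorPower.
Variable k : fieldType.
Implicit Types H V : lmodType k.

Fixpoint tpow V (n : nat) : lmodType k :=
  if n is n'.+1 then V ⊗ tpow V n' else k^o.

(** [v_1 ⊗ ... ⊗ v_n] for [s = [:: v_1; ...; v_n]] *)
Fixpoint tpure V (n : nat) (s : seq V) : tpow V n :=
  if n is n'.+1 then head 0 s \ox tpure n' (behead s) else (1 : k).

Definition tcast V m n (e : m = n) : {linear tpow V m -> tpow V n} :=
  ecast r {linear tpow V m -> tpow V r} e (lid (tpow V m)).

Fixpoint tcat V (m n : nat) :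
    {linear tpow V m ⊗ tpow V n -> tpow V (m + n)%N} :=
  match m with
  | 0 => lunit (tpow V n)
  | m'.+1 => tmap (lid V) (tcat V m' n) ∘ assoc V (tpow V m') (tpow V n)
  end.

Fixpoint tsplit V (m n : nat) :
    {linear tpow V (m + n)%N -> tpow V m ⊗ tpow V n} :=
  match m with
  | 0 => purer (tpow V n) (1 : k^o)
  | m'.+1 => assocV V (tpow V m') (tpow V n) ∘ tmap (lid V) (tsplit V m' n)
  end.

Definition is_braiding H (sigma : {linear H ⊗ H -> H ⊗ H}) : Prop :=
  let s1 := act2 sigma H in
  let s2 := tmap (lid H) sigma in
  s1 ∘ s2 ∘ s1 =1 s2 ∘ s1 ∘ s2.

Section Braid.
Variables (V : lmodType k) (sigma : {linear V ⊗ V -> V ⊗ V}).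

(** Positions are counted from [0]: [braid_at a n] is [sigma_{a+1}] on
    [V^{⊗ n}] if [a + 2 <= n], and the identity otherwise. *)
Fixpoint braid_at (a n : nat) : {linear tpow V n -> tpow V n} :=
  match n, a with
  | n'.+1, a'.+1 => tmap (lid V) (braid_at a' n')
  | n'.+2, 0 => act2 sigma (tpow V n')
  | n', _ => lid (tpow V n')
  end.

Fixpoint braid_word (w : seq nat) (n : nat) : {linear tpow V n -> tpow V n} :=
  if w is a :: w' then braid_at a n ∘ braid_word w' n else lid (tpow V n).

Definition chi_word (i j : nat) : seq nat :=
  flatten [seq rev (iota a j) | a <- iota 0 i].

(** [beta i j] is [T_w] for [w = chi_{ij}], computed with the expression
    [chi_word i j]; by [chi_wordE] it is an expression of [chi_{ij}], and it is
    reduced because its length is the number [i * j] of inversions of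
    [chi_{ij}]. *)
Definition beta (i j : nat) : {linear tpow V (i + j)%N -> tpow V (i + j)%N} :=
  braid_word (chi_word i j) (i + j)%N.

Definition beta_split (i j : nat) :
    {linear tpow V (i + j)%N -> tpow V j ⊗ tpow V i} :=
  tsplit V j i ∘ tcast V (addnC i j) ∘ beta i j.
End Braid.

Definition strans (a x : nat) : nat :=
  if x == a then a.+1 else if x == a.+1 then a else x.

Local Ltac case_ifs := repeat match goal with |- context [if ?b then _ else _] =>
  lazymatch b with context [if _ then _ else _] => fail | _ => case: (boolP b) => ? end end.

Lemma strans_cycle a j x : foldr strans x (rev (iota a j)) =
  if x == a then (a + j)%N else if (a < x <= a + j)%N then x.-1 else x.
Proof.
elim: j => [|j IH]; first by rewrite /=; case_ifs; lia.
rewrite -addn1 iotaD rev_cat /= IH /strans.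
case_ifs; lia.
Qed.

Lemma chi_wordE i j x : foldr strans x (chi_word i j) =
  if (x < i)%N then (j + x)%N else if (x < i + j)%N then (x - i)%N else x.
Proof.
elim: i x => [|i IH] x; first by rewrite subn0; case: ifP.
rewrite /chi_word -addn1 iotaD map_cat flatten_cat foldr_cat /= cats0.
rewrite strans_cycle [LHS]IH add0n.
case_ifs; lia.
Qed.

Lemma size_chi_word i j : size (chi_word i j) = (i * j)%N.
Proof.
rewrite size_flatten /shape -map_comp (eq_map (g := fun=> j)); last first.
  by move=> a /=; rewrite size_rev size_iota.
by elim: i 0%N => //= i IH a; rewrite IH mulSn.
Qed.
End TensorPower.

(** Planar rooted trees whose internal vertices have at least two branches:
    [Node T_0 f] is [T_0 ∨ ... ∨ T_k], where the nonempty list [f] holds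
    [T_1, ..., T_k]. *)
Inductive ptree : Type := Leaf | Node of ptree & pforest
with pforest : Type := FLast of ptree | FCons of ptree & pforest.

Scheme ptree_mut := Induction for ptree Sort Prop
  with pforest_mut := Induction for pforest Sort Prop.

HB.instance Definition _ := gen_eqMixin ptree.
HB.instance Definition _ := gen_choiceMixin ptree.

Fixpoint leaves (T : ptree) : nat :=
  if T is Node T0 f then (leaves T0 + leavesf f)%N else 1%N
with leavesf (f : pforest) : nat :=
  match f with
  | FLast T => leaves T
  | FCons T f' => (leaves T + leavesf f')%N
  end.

(** [D n] is the set of trees with [n + 1] leaves, i.e. with [n] angles *)
Definition D (n : nat) : Type := {T : ptree | leaves T == n.+1}.
HB.instance Definition _ n := Choice.on (D n).

Definition leafD : D 0 := exist _ Leaf (eqxx 1%N).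

Fixpoint fcat (f f' : pforest) : pforest :=
  match f with
  | FLast T => FCons T f'
  | FCons T g => FCons T (fcat g f')
  end.

(** The products of two trees are sums of trees with coefficients 1, given as
    lists.  For [f = T_1, ..., T_k], [tree_star_last f U] lists the forests
    [T_1, ..., T_{k-1}, R] with [R] in [T_k * U]. *)
Fixpoint tree_star (T : ptree) : ptree -> seq ptree :=
  match T with
  | Leaf => fun T' => [:: T']
  | Node T0 f =>
    fix star_T (T' : ptree) : seq ptree :=
      match T' with
      | Leaf => [:: Node T0 f]
      | Node T0' f' =>
           [seq Node T0 g | g <- tree_star_last f T']
        ++ [seq Node R f' | R <- star_T T0']
        ++ [seq Node T0 (fcat g f') | g <- tree_star_last f T0']
      end
  end
with tree_star_last (f : pforest) : ptree -> seq pforest :=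
  match f with
  | FLast T => fun U => [seq FLast R | R <- tree_star T U]
  | FCons T g => fun U => [seq FCons T h | h <- tree_star_last g U]
  end.

(** [1 ≺ 1], [1 ≻ 1] and [1 · 1] are not defined in the augmentation; the value
    [0] given to them below is never used. *)
Definition tree_prec (T T' : ptree) : seq ptree :=
  match T, T' with
  | Leaf, _ => [::]
  | Node _ _, Leaf => [:: T]
  | Node T0 f, Node _ _ => [seq Node T0 g | g <- tree_star_last f T']
  end.

Definition tree_succ (T T' : ptree) : seq ptree :=
  match T, T' with
  | _, Leaf => [::]
  | Leaf, Node _ _ => [:: T']
  | Node _ _, Node T0' f' => [seq Node R f' | R <- tree_star T T0']
  end.

Definition tree_dot (T T' : ptree) : seq ptree :=
  match T, T' with
  | Node T0 f, Node T0' f' => [seq Node T0 (fcat g f') | g <- tree_star_last f T0']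
  | _, _ => [::]
  end.

Lemma tree_starE T T' : T <> Leaf \/ T' <> Leaf ->
  tree_star T T' = tree_prec T T' ++ tree_succ T T' ++ tree_dot T T'.
Proof. by case: T => [|T0 f]; case: T' => [|T0' f'] //= -[]. Qed.

Lemma leavesf_fcat f f' : leavesf (fcat f f') = (leavesf f + leavesf f')%N.
Proof. by elim: f => [T|T f IH] //=; rewrite IH addnA. Qed.

Lemma tree_star_leaves T : forall T',
  all (fun R => (leaves R).+1 == (leaves T + leaves T')%N) (tree_star T T').
Proof.
apply: (@ptree_mut
  (fun T => forall T',
     all (fun R => (leaves R).+1 == (leaves T + leaves T')%N) (tree_star T T'))
  (fun f => forall U,
     all (fun g => (leavesf g).+1 == (leavesf f + leaves U)%N) (tree_star_last f U)))
  => /= {T}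
  [T'|T0 _ f IHf T'|T IHT U|T _ f IHf U].
- by rewrite add1n eqxx.
- apply: (@ptree_mut
    (fun T' => is_true (all (fun R =>
       (leaves R).+1 == (leaves T0 + leavesf f + leaves T')%N)
       (tree_star (Node T0 f) T'))) (fun=> True)) => //=.
    by rewrite addn1 eqxx.
  move=> T0' IH f' _; rewrite !all_cat !all_map; apply/and3P; split.
  + by move: (IHf (Node T0' f')); apply: sub_all => g /= /eqP; lia.
  + by move: IH; apply: sub_all => R /= /eqP; lia.
  + by move: (IHf T0'); apply: sub_all => g /= /eqP; rewrite leavesf_fcat; lia.
- by rewrite all_map; exact: IHT.
- by rewrite all_map; move: (IHf U); apply: sub_all => g /= /eqP; lia.
Qed.

Section AngularTrees.
Variables (k : fieldType) (V : lmodType k).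

Definition AT : lmodType k := dsum (fun n : nat => freemod k (D n) ⊗ tpow V n).

(** [AT1] is the sum over [n >= 1], included in [AT] by [incl1]. *)
Definition AT1 : lmodType k :=
  dsum (fun n : nat => freemod k (D n.+1) ⊗ tpow V n.+1).
Definition incl1 : {linear AT1 -> AT} :=
  dlift (fun n => dsum_in (fun n : nat => freemod k (D n) ⊗ tpow V n) n.+1).

(** [dec T w] is [T ⊗ w], the tree [T] decorated by [w]. *)
Definition dec n (T : D n) : {linear tpow V n -> AT} :=
  dsum_in (fun n : nat => freemod k (D n) ⊗ tpow V n) n ∘ purer _ (fgen k T).

(** The same for a tree [T] in [D n].  The default value [0] for [T] not in
    [D n] does not occur below, by [tree_star_leaves]. *)
Definition dect n (T : ptree) : {linear tpow V n -> AT} :=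
  if insub T is Some T' then dec (T' : D n) else 0.

Definition at_one : AT := dec leafD (1 : k).

Lemma dectE n (T : D n) : dect n (val T) = dec T.
Proof. by rewrite /dect valK. Qed.

Section Lift.
Variables (W : lmodType k) (f : forall n, D n -> {linear tpow V n -> W}).
(** The linear map sending [T ⊗ w] to [f T w] *)
Definition at_lift : {linear AT -> W} :=
  dlift (fun n => tuncurry (flift (@f n))).
Lemma at_lift_dec n (T : D n) w : at_lift (dec T w) = f T w.
Proof. by rewrite [LHS]dlift_in tuncurryE flift_gen. Qed.
End Lift.

Lemma at_ext (W : lmodType k) (f g : {linear AT -> W}) :
  (forall n (T : D n) w, f (dec T w) = g (dec T w)) -> f =1 g.
Proof.
move=> h; apply: dsum_ext => n m.
pose i := dsum_in (fun n : nat => freemod k (D n) ⊗ tpow V n) n.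
suff E : f ∘ i =1 g ∘ i by exact: E.
apply: tens_ext => x w; suff E : lflip (tcurry (f ∘ i)) w =1 lflip (tcurry (g ∘ i)) w by exact: E.
apply: dsum_ext => T c; rewrite -[c]mulr1 -[c * 1]/(c *: (1 : k^o)) !linearZ /=.
by congr (_ *: _); apply: h.
Qed.

Section Lift2.
Variables (W : lmodType k).
Variable f : forall m n, D m -> D n -> {linear tpow V m ⊗ tpow V n -> W}.
(** The linear map sending [(T ⊗ w) ⊗ (T' ⊗ w')] to [f T T' (w ⊗ w')] *)
Definition at_lift2 : {linear AT ⊗ AT -> W} :=
  tuncurry (at_lift (fun m (T : D m) =>
    lflip (at_lift (fun n (T' : D n) => lflip (tcurry (f T T')))))).
Lemma at_lift2_dec m n (T : D m) (T' : D n) w w' :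
  at_lift2 (dec T w \ox dec T' w') = f T T' (w \ox w').
Proof. by rewrite tuncurryE at_lift_dec lflipE at_lift_dec. Qed.
End Lift2.

(** The linear extension to [AT] of an operation on trees.  The recursion
    defining the products never permutes decorations, so every tree in the
    product of [(T; w)] and [(T'; w')] is decorated by [w] followed by [w'];
    [sigma] enters the braiding only. *)
Definition at_op (o : ptree -> ptree -> seq ptree) : {linear AT ⊗ AT -> AT} :=
  at_lift2 (fun m n (T : D m) (T' : D n) =>
    \sum_(R <- o (val T) (val T')) (dect (m + n) R ∘ tcat V m n)).

Definition at_prec := at_op tree_prec.
Definition at_succ := at_op tree_succ.
Definition at_dot := at_op tree_dot.
Definition at_star := at_op tree_star.

Definition at_eps : {linear AT -> k^o} :=
  at_lift (fun n =>
    match n return D n -> {linear tpow V n -> k^o} with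
    | 0 => fun=> lid k^o
    | _.+1 => fun=> 0
    end).

(** [T[v] = | ∨_v |] *)
Definition at_gen (v : V) : AT := dect 1 (Node Leaf (FLast Leaf)) (tpure 1 [:: v]).

Section LiftV.
Variables (W : lmodType k) (f : forall n, D n -> {linear tpow V n.+1 -> W}).
(** The linear map sending [v ⊗ (T ⊗ w)] to [f T (v ⊗ w)] *)
Definition at_liftV : {linear V ⊗ AT -> W} :=
  tuncurry (lflip (at_lift (fun n (T : D n) => lflip (tcurry (f T))))).
Lemma at_liftV_dec n (T : D n) v w :
  at_liftV (v \ox dec T w) = f T (v \ox w).
Proof. by rewrite tuncurryE lflipE at_lift_dec. Qed.
End LiftV.

Section Lift2V.
Variable W : lmodType k.
Variable f : forall m n, D m -> D n -> {linear tpow V m ⊗ tpow V n.+1 -> W}.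
(** The linear map sending [(T ⊗ w) ⊗ v ⊗ (T' ⊗ w')] to
    [f T T' (w ⊗ (v ⊗ w'))] *)
Definition at_lift2V : {linear AT ⊗ V ⊗ AT -> W} :=
  tuncurry (at_lift (fun m (T : D m) =>
    lflip (at_liftV (fun n (T' : D n) => lflip (tcurry (f T T')))))).
Lemma at_lift2V_dec m n (T : D m) (T' : D n) w v w' :
  at_lift2V (dec T w \ox v \ox dec T' w') = f T T' (w \ox v \ox w').
Proof. by rewrite tuncurryE at_lift_dec lflipE at_liftV_dec. Qed.
End Lift2V.

Section Braiding.
Variable sigma : {linear V ⊗ V -> V ⊗ V}.

Definition at_braid : {linear AT ⊗ AT -> AT ⊗ AT} :=
  at_lift2 (fun m n (T : D m) (T' : D n) =>
    tmap (dec T') (dec T) ∘ beta_split sigma m n ∘ tcat V m n).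

Definition at_braidV : {linear V ⊗ AT -> AT ⊗ V} :=
  at_liftV (fun m (T : D m) =>
    tmap (dec T) (runit V) ∘ beta_split sigma 1 m).
End Braiding.

(** [AT_V_pow i X] is [(AT ⊗ V)^{⊗ i} ⊗ X] and [AT_pow i X] is [AT^{⊗ i} ⊗ X],
    all iterated tensor products being nested to the right. *)
Fixpoint AT_V_pow (i : nat) (X : lmodType k) : lmodType k :=
  if i is i'.+1 then AT_V_pow i' (AT ⊗ V ⊗ X) else X.
Fixpoint AT_pow (i : nat) (X : lmodType k) : lmodType k :=
  if i is i'.+1 then AT_pow i' (AT ⊗ X) else X.

Fixpoint AT_V_map (i : nat) (X Y : lmodType k) (f : {linear X -> Y}) :
    {linear AT_V_pow i X -> AT_V_pow i Y} :=
  match i with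
  | 0 => f
  | i'.+1 => AT_V_map i' (tmap (lid AT) (tmap (lid V) f))
  end.
Fixpoint AT_map (i : nat) (X Y : lmodType k) (f : {linear X -> Y}) :
    {linear AT_pow i X -> AT_pow i Y} :=
  match i with
  | 0 => f
  | i'.+1 => AT_map i' (tmap (lid AT) f)
  end.

(** [T ⊗ v ⊗ T' |-> T ∨_v T'] *)
Definition graft_last : {linear AT ⊗ V ⊗ AT -> AT} :=
  at_lift2V (fun m n (T : D m) (T' : D n) =>
    dect (m + n.+1) (Node (val T) (FLast (val T'))) ∘ tcat V m n.+1).
(** [T ⊗ v ⊗ (T_1 ∨_{v_2} ... ∨_{v_k} T_k) |-> T ∨_v T_1 ∨_{v_2} ... ∨_{v_k} T_k] *)
Definition graft_cons : {linear AT ⊗ V ⊗ AT -> AT} :=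
  at_lift2V (fun m n (T : D m) (T' : D n) =>
    if val T' is Node T1 f
    then dect (m + n.+1) (Node (val T) (FCons T1 f)) ∘ tcat V m n.+1 else 0).

Fixpoint graft_all (i : nat) : {linear AT_V_pow i AT -> AT} :=
  if i is i'.+1 then graft_all i' ∘ AT_V_map i' graft_cons else lid AT.
(** The map [∨_k]; it is used for [k >= 1] only *)
Definition graft (k : nat) : {linear AT_V_pow k AT -> AT} :=
  if k is k'.+1 then graft_all k' ∘ AT_V_map k' graft_last else lid AT.

(** [*^(i) ⊗ id] on [AT^{⊗ i+1} ⊗ X], multiplying from the left *)
Fixpoint star_iter (i : nat) (X : lmodType k) :
    {linear AT ⊗ AT_pow i X -> AT ⊗ X} :=
  match i with
  | 0 => lid (AT ⊗ X)
  | i'.+1 => mul2 at_star X ∘ star_iter i' (AT ⊗ X)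
  end.

Section Sigma.
Variable sigma : {linear V ⊗ V -> V ⊗ V}.

(** [(σ_AT)_1 (σ_{V,AT})_2] on [AT ⊗ V ⊗ AT ⊗ X] *)
Definition braid_step (X : lmodType k) :
    {linear AT ⊗ V ⊗ AT ⊗ X -> AT ⊗ AT ⊗ V ⊗ X} :=
  act2 (at_braid sigma) (V ⊗ X) ∘ tmap (lid AT) (act2 (at_braidV sigma) X).

(** [(σ_AT)_1 (σ_{V,AT})_2 ... (σ_AT)_{2i-1} (σ_{V,AT})_{2i}] on
    [(AT ⊗ V)^{⊗ i} ⊗ AT ⊗ X] *)
Fixpoint braid_chain (i : nat) (X : lmodType k) :
    {linear AT_V_pow i (AT ⊗ X) -> AT ⊗ AT_V_pow i X} :=
  match i with
  | 0 => lid (AT ⊗ X)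
  | i'.+1 => braid_chain i' (AT ⊗ V ⊗ X) ∘ AT_V_map i' (braid_step X)
  end.

(** [Σ_{i+1}], acting trivially on the first [i + 1] factors and on [X] *)
Definition Sigma (i : nat) (X : lmodType k) :
    {linear AT ⊗ AT_pow i (AT_V_pow i.+1 (AT ⊗ X)) ->
            AT ⊗ AT_pow i.+1 (AT_V_pow i.+1 X)} :=
  tmap (lid AT) (AT_map i (braid_chain i.+1 X)).

(** [(AT ⊗ AT ⊗ V)^{⊗ i} ⊗ X] *)
Fixpoint AT2_V_pow (i : nat) (X : lmodType k) : lmodType k :=
  if i is i'.+1 then AT2_V_pow i' (AT ⊗ AT ⊗ V ⊗ X) else X.

(** [σ^(i) = Σ_i ... Σ_1] on the first [3i + 1] factors followed by [X]; the
    last factor of [σ^(i)] in the usual sense is [X = AT]. *)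
Fixpoint Sigma_iter (i : nat) (X : lmodType k) :
    {linear AT2_V_pow i (AT ⊗ X) -> AT ⊗ AT_pow i (AT_V_pow i X)} :=
  match i with
  | 0 => lid (AT ⊗ X)
  | i'.+1 => Sigma i' X ∘ Sigma_iter i' (AT ⊗ V ⊗ AT ⊗ X)
  end.
End Sigma.

End AngularTrees.

Section BraidedHopf.
Variables (k : fieldType) (H : lmodType k).
Variables (mu : {linear H ⊗ H -> H}) (Delta : {linear H -> H ⊗ H}).
Variables (eps : {linear H -> k^o}) (sigma : {linear H ⊗ H -> H ⊗ H}).

Let s1 : {linear H ⊗ H ⊗ H -> H ⊗ H ⊗ H} := act2 sigma H.
Let s2 : {linear H ⊗ H ⊗ H -> H ⊗ H ⊗ H} := tmap (lid H) sigma.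

(** Both laws are stated on [H ⊗ H ⊗ H], nested to the right. *)
Definition braided_op (m : {linear H ⊗ H -> H}) : Prop :=
  mul2 m H ∘ s2 ∘ s1 =1 sigma ∘ tmap (lid H) m /\
  tmap (lid H) m ∘ s1 ∘ s2 =1 sigma ∘ mul2 m H.

Definition is_braided_algebra : Prop :=
  [/\ is_braiding sigma,
      mu ∘ mul2 mu H =1 mu ∘ tmap (lid H) mu
    & braided_op mu].

Let Delta_id : {linear H ⊗ H -> H ⊗ H ⊗ H} :=
  assoc H H H ∘ tmap Delta (lid H).
Let id_Delta : {linear H ⊗ H -> H ⊗ H ⊗ H} := tmap (lid H) Delta.

Definition is_coalgebra : Prop :=
  [/\ Delta_id ∘ Delta =1 id_Delta ∘ Delta,
      lunit H ∘ tmap eps (lid H) ∘ Delta =1 id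
    & runit H ∘ tmap (lid H) eps ∘ Delta =1 id].

Definition is_braided_coalgebra : Prop :=
  [/\ is_braiding sigma /\ is_coalgebra,
      s1 ∘ s2 ∘ Delta_id =1 id_Delta ∘ sigma,
      s2 ∘ s1 ∘ id_Delta =1 Delta_id ∘ sigma,
      lunit H ∘ tmap eps (lid H) ∘ sigma =1 runit H ∘ tmap (lid H) eps
    & runit H ∘ tmap (lid H) eps ∘ sigma =1 lunit H ∘ tmap eps (lid H)].

(** [(m1 ⊗ m2) tau_2] on [(H ⊗ H) ⊗ (H ⊗ H)] *)
Definition mul_pairs (tau : {linear H ⊗ H -> H ⊗ H})
    (m1 m2 : {linear H ⊗ H -> H}) : {linear (H ⊗ H) ⊗ (H ⊗ H) -> H ⊗ H} :=
  tmap m1 m2 ∘ assocV H H (H ⊗ H) ∘ tmap (lid H) (act2 tau H)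
             ∘ assoc H H (H ⊗ H).

Definition is_braided_bialgebra : Prop :=
  [/\ is_braided_algebra, is_braided_coalgebra
    & Delta ∘ mu =1 mul_pairs sigma mu mu ∘ tmap Delta Delta].

Definition is_unit (one : H) : Prop :=
  forall x, mu (one \ox x) = x /\ mu (x \ox one) = x.

Definition is_antipode (one : H) (S : {linear H -> H}) : Prop :=
  forall x, mu (tmap S (lid H) (Delta x)) = (eps x : k) *: one /\
            mu (tmap (lid H) S (Delta x)) = (eps x : k) *: one.

Definition is_braided_hopf : Prop :=
  is_braided_bialgebra /\
  exists one : H, is_unit one /\ exists S : {linear H -> H}, is_antipode one S.

(** [sigma_2 sigma_1 sigma_3 sigma_2] on [(H ⊗ H) ⊗ (H ⊗ H)] *)
Definition braid_pairs :
    {linear (H ⊗ H) ⊗ (H ⊗ H) -> (H ⊗ H) ⊗ (H ⊗ H)} :=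
  let t1 := act2 sigma (H ⊗ H) in
  let t2 := tmap (lid H) (act2 sigma H) in
  let t3 := tmap (lid H) (tmap (lid H) sigma) in
  assocV H H (H ⊗ H) ∘ t2 ∘ t1 ∘ t3 ∘ t2 ∘ assoc H H (H ⊗ H).

Let line_lin (x : H) : linear (fun c : k^o => c *: x).
Proof. by move=> a b c; rewrite scalerDl scalerA. Qed.

(** For [H = R^+ = k one ⊕ R] with [R] the kernel of [eps], the operation of
    [R ⊠ R] attached to the operation [m] of [R].  The projector [K] selects the
    part of [(x ⊗ y) ⊗ (x' ⊗ y')] with [y] and [y'] in [k one], for which the
    result is [m (x, x') ⊗ y y'].  The value off [R ⊠ R] is irrelevant. *)
Definition box_op (one : H) (m : {linear H ⊗ H -> H})
    (z : (H ⊗ H) ⊗ (H ⊗ H)) : H ⊗ H :=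
  let e0 : {linear H -> H} := mklin (line_lin one) ∘ eps in
  let K := tmap (tmap (lid H) e0) (tmap (lid H) e0) in
  mul_pairs sigma mu m (z - K z) + mul_pairs (tflip H H) m mu (K z).
End BraidedHopf.

Section ATCoproduct.
Variables (k : fieldType) (V : lmodType k) (sigma : {linear V ⊗ V -> V ⊗ V}).

Let P : lmodType k := AT V.
Let P1 : lmodType k := AT1 V.
Let one : P := at_one V.
Let inj : {linear P1 -> P} := incl1 V.

(** [Delta] preserves the operation [m] of the braided tridendriform algebras
    [P1] and [P1 ⊠ P1]. *)
Definition preserves_op (Delta : {linear P -> P ⊗ P})
    (m : {linear P ⊗ P -> P}) : Prop :=
  forall x y : P1, Delta (m (inj x \ox inj y)) =
    box_op (at_star V) (at_eps V) (at_braid sigma) one m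
      (Delta (inj x) \ox Delta (inj y)).

(** [P1 ⊠ P1 = (P1 ⊗ k) ⊕ (k ⊗ P1) ⊕ (P1 ⊗ P1)] *)
Definition in_box (z : P ⊗ P) : Prop :=
  exists (a b : P1) (c : P1 ⊗ P1),
    z = inj a \ox one + one \ox inj b + tmap inj inj c.

Definition is_AT_coproduct (Delta : {linear P -> P ⊗ P}) : Prop :=
  [/\ Delta one = one \ox one,
      forall x : P1, in_box (Delta (inj x)),
      [/\ preserves_op Delta (at_prec V), preserves_op Delta (at_succ V)
        & preserves_op Delta (at_dot V)],
      forall z : P1 ⊗ P1,
        tmap Delta Delta (at_braid sigma (tmap inj inj z)) =
        braid_pairs (at_braid sigma) (tmap Delta Delta (tmap inj inj z))
    & forall v : V, Delta (at_gen v) = at_gen v \ox one + one \ox at_gen v].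

Record decorated_tree := DecoratedTree {
  tree_angles : nat;
  tree_shape : D tree_angles;
  tree_labels : tree_angles.-tuple V }.

Definition at_tree (T : decorated_tree) : P :=
  dec V (tree_shape T) (tpure (tree_angles T) (tree_labels T)).

(** [T_0 ⊗ v_1 ⊗ T_1 ⊗ ... ⊗ v_i ⊗ y] *)
Fixpoint AT_V_pure (T : nat -> P) (v : nat -> V) (i : nat) (X : lmodType k)
    (y : X) : AT_V_pow V i X :=
  if i is i'.+1 then AT_V_pure T v i' (T i' \ox v i'.+1 \ox y) else y.

(** [t_0 ⊗ v_1 ⊗ t_1 ⊗ ... ⊗ v_i ⊗ y] with [t_j] in [P ⊗ P] *)
Fixpoint AT2_V_pure (t : nat -> P ⊗ P) (v : nat -> V) (i : nat)
    (X : lmodType k) (y : X) : AT2_V_pow V i X :=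
  if i is i'.+1
  then AT2_V_pure t v i' (assoc P P (V ⊗ X) (t i' \ox v i'.+1 \ox y)) else y.

(** [T_0 ∨_{v_1} T_1 ... ∨_{v_i} T_i] *)
Definition graft_tree (T : nat -> P) (v : nat -> V) (i : nat) : P :=
  graft V i (AT_V_pure T v i (T i)).
End ATCoproduct.

(* Main.v *)
Require Import Defs.
From HB Require Import structures.
From mathcomp Require Import all_boot all_order all_algebra.
From mathcomp Require Import boolp zify.
Set Implicit Arguments.
Unset Strict Implicit.
Unset Printing Implicit Defensive.
Import GRing.Theory.
Local Open Scope ring_scope.

(** The products of [AT V] keep the decorations of two trees in order, one tree
    after the other; only the braiding and the coproduct permute decorations.
    This makes a closed formula for the coproduct possible.  Color the angles of
    a tree [T] left or right.  To a coloring [b] belongs a list of pairs [(L, R)]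
    of trees, the angles of [L] corresponding to the left angles of [T] and those
    of [R] to the right ones, and the coproduct is
    [[
      Delta (T; w) = sum over b and (L, R) of (L ⊗ R; u_b w),
    ]]
    where the braid [u_b] moves the labels colored left in front of the others.
    The list [cop T] of all [(b, L, R)] is defined by recursion: either the whole
    tree stays on the left, or all angles at the root go to the right, the
    branches are split independently, the left parts of the branches are
    multiplied and the right parts are grafted.  Every statement thereby falls
    into a part about trees, in which [sigma] does not occur, and a part about
    braids, in which trees do not occur.

    The part about trees consists of identities between sums over lists: the
    product is associative ([star_assoc]), splitting is a homomorphism for the
    three operations and for their sum ([cop_op], [cop_star]), and splitting twice
    gives the same triples of trees for each coloring of the angles with three
    colors, whichever half is split again ([cop_coassoc]).

    The part about braids is a calculus of operators on the tensor algebra.  The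
    unshuffling braid of a concatenation of colorings is that of its halves
    followed by an exchange of blocks ([unshuffle_cat]), sorting three colors
    does not depend on which color is separated first ([unshuffle3]), and blocks
    pass over any braid ([block_swap_left], [block_swap_right]).  The braiding of
    [AT V] is an exchange of blocks.

    The two parts are joined by decorating several trees with one tensor.  On
    such elements each structure map changes the trees and composes with a braid
    ([at_op_decor2], [braid_decor2], [Delta_decor]), so that a Hopf algebra axiom
    becomes one identity of each kind.  The coproduct is unique because every
    tree is obtained from the trees with one angle by the three operations
    ([AT_coproduct_unique]).  The antipode is a geometric series for the
    convolution product, finite on each tree ([antipode_l], [antipode_r]).  For
    the recursive formula, the braidings and products on its right-hand side are
    carried out branch by branch and yield the splittings of the tree with their
    unshuffling braids ([gather_label_word], [Delta_recursive]). *)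

(** * Trees and their angles *)

Lemma tree_forest_ind (P : ptree -> Prop) (Q : pforest -> Prop) :
  P Leaf -> (forall T, P T -> forall f, Q f -> P (Node T f)) ->
  (forall T, P T -> Q (FLast T)) ->
  (forall T, P T -> forall f, Q f -> Q (FCons T f)) ->
  (forall T, P T) /\ (forall f, Q f).
Proof.
move=> h0 h1 h2 h3; split; first exact: (ptree_mut h0 h1 h2 h3).
exact: (pforest_mut h0 h1 h2 h3).
Qed.

Definition is_leaf (T : ptree) : bool := if T is Leaf then true else false.
Definition angles (T : ptree) : nat := (leaves T).-1.
Definition anglesf (f : pforest) : nat := (leavesf f).-1.

Lemma leaves_gt0 T : (0 < leaves T)%N.
Proof. by elim: T => //= T IH f; rewrite addn_gt0 IH. Qed.
Lemma leavesf_gt0 f : (0 < leavesf f)%N.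
Proof. by case: f => [T|T f] /=; have := leaves_gt0 T; lia. Qed.

Lemma angles_node T f : angles (Node T f) = (angles T + (anglesf f).+1)%N.
Proof. by rewrite /angles /anglesf /=; have := leaves_gt0 T; have := leavesf_gt0 f; lia. Qed.
Lemma anglesf_cons T f : anglesf (FCons T f) = (angles T + (anglesf f).+1)%N.
Proof. by rewrite -angles_node. Qed.
Lemma angles_gt0 T0 f : (0 < angles (Node T0 f))%N.
Proof. by rewrite angles_node addnS. Qed.

Lemma angles_star T T' R : R \in tree_star T T' -> angles R = (angles T + angles T')%N.
Proof.
move=> /(allP (tree_star_leaves T T')) /= /eqP.
by rewrite /angles; have := leaves_gt0 T; have := leaves_gt0 T'; lia.
Qed.

Lemma star_leafr T : tree_star T Leaf = [:: T]. Proof. by case: T. Qed.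
Lemma star_last_leaf f : tree_star_last f Leaf = [:: f].
Proof. by elim: f => [T|T f IH] /=; rewrite ?star_leafr ?IH. Qed.

Lemma star_last_fcat f f' U :
  tree_star_last (fcat f f') U = [seq fcat f h | h <- tree_star_last f' U].
Proof. by elim: f => [T|T f IH] //=; rewrite IH -map_comp. Qed.

Lemma fcatA f g h : fcat f (fcat g h) = fcat (fcat f g) h.
Proof. by elim: f => [T|T f IH] //=; rewrite IH. Qed.

Lemma star_node T0 f T0' f' :
  tree_star (Node T0 f) (Node T0' f') =
    [seq Node T0 g | g <- tree_star_last f (Node T0' f')]
    ++ [seq Node R f' | R <- tree_star (Node T0 f) T0']
    ++ [seq Node T0 (fcat g f') | g <- tree_star_last f T0'].
Proof. by []. Qed.
Lemma star_leafl T : tree_star Leaf T = [:: T]. Proof. by []. Qed.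
Lemma star_last_last T U :
  tree_star_last (FLast T) U = [seq FLast R | R <- tree_star T U].
Proof. by []. Qed.
Lemma star_last_cons T f U :
  tree_star_last (FCons T f) U = [seq FCons T h | h <- tree_star_last f U].
Proof. by []. Qed.
Arguments tree_star : simpl never.
Arguments tree_star_last : simpl never.
Arguments tree_prec : simpl never.
Arguments tree_succ : simpl never.
Arguments tree_dot : simpl never.

(** * Associativity of the product of trees *)

Section Star.
Variable W : nmodType.

Lemma sum_star_node T0 f T0' f' (F : ptree -> W) :
  \sum_(R <- tree_star (Node T0 f) (Node T0' f')) F R =
    \sum_(g <- tree_star_last f (Node T0' f')) F (Node T0 g)
  + \sum_(R <- tree_star (Node T0 f) T0') F (Node R f')
  + \sum_(g <- tree_star_last f T0') F (Node T0 (fcat g f')).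
Proof. by rewrite star_node !big_cat !big_map /= addrA. Qed.

(** Expanding both sides on three trees with an internal root gives seven
    summands each, one for each axiom of a tridendriform algebra.  The part that
    grafts on the last branch needs the same statement for forests. *)
Lemma star_assoc_all :
  (forall T1 T2 T3 (F : ptree -> W),
     \sum_(R <- tree_star T1 T2) \sum_(S <- tree_star R T3) F S =
     \sum_(R <- tree_star T2 T3) \sum_(S <- tree_star T1 R) F S) /\
  (forall f T2 T3 (F : pforest -> W),
     \sum_(g <- tree_star_last f T2) \sum_(h <- tree_star_last g T3) F h =
     \sum_(R <- tree_star T2 T3) \sum_(h <- tree_star_last f R) F h).
Proof.
apply: tree_forest_ind.
- move=> T2 T3 F; rewrite star_leafl big_seq1; apply: eq_bigr => R _.
  by rewrite star_leafl big_seq1.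
- move=> T0 _ f IHf; case=> [|U0 g].
    by move=> T3 F; rewrite star_leafr star_leafl !big_seq1.
  apply: (proj1 (@tree_forest_ind _ (fun=> True) _ _ _ _)) => // [F|W0 IHW h _ F].
    by rewrite !star_leafr big_seq1; apply: eq_bigr => R _; rewrite star_leafr big_seq1.
  set x := Node T0 f; set y := Node U0 g; set z := Node W0 h.
  (* One summand for each tridendriform axiom. *)
  pose t1 := \sum_(R <- tree_star y z) \sum_(h' <- tree_star_last f R) F (Node T0 h').
  pose t2 := \sum_(R <- tree_star x U0) \sum_(g' <- tree_star_last g z) F (Node R g').
  pose t3 := \sum_(f' <- tree_star_last f U0) \sum_(g' <- tree_star_last g z)
               F (Node T0 (fcat f' g')).
  pose t4 := \sum_(R <- tree_star x y) \sum_(S <- tree_star R W0) F (Node S h).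
  pose t5 := \sum_(R <- tree_star y W0) \sum_(h' <- tree_star_last f R)
               F (Node T0 (fcat h' h)).
  pose t6 := \sum_(R <- tree_star x U0) \sum_(g' <- tree_star_last g W0)
               F (Node R (fcat g' h)).
  pose t7 := \sum_(f' <- tree_star_last f U0) \sum_(g' <- tree_star_last g W0)
               F (Node T0 (fcat (fcat f' g') h)).
  transitivity (t1 + t2 + t3 + t4 + (t5 + t6 + t7)).
    rewrite /t4 !(sum_star_node _ _ _ _ (fun R => \sum_(S <- tree_star R _) _)).
    under eq_bigr => g' _ do rewrite sum_star_node.
    under [X in _ + X + _ = _]eq_bigr => R _ do rewrite sum_star_node.
    under [X in _ + X = _]eq_bigr => g' _ do
      rewrite sum_star_node !star_last_fcat !big_map.
    rewrite !big_split /= IHf (IHf _ _ (fun h' => F (Node T0 (fcat h' h)))).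
    rewrite -/t1 -/t2 -/t3 -/t5 -/t6 -/t7.
    set u1 := \sum_(i <- _) _; set u2 := \sum_(i <- _) _; set u3 := \sum_(i <- _) _.
    rewrite (AC (3*3*3) ((1*4*7)*(2*5*8)*(3*6*9))) /=.
    by [].
  rewrite (sum_star_node _ _ _ _ (fun R => \sum_(S <- tree_star x R) _)).
  under eq_bigr => g' _ do rewrite sum_star_node.
  under [X in _ = _ + X + _]eq_bigr => R _ do rewrite sum_star_node.
  under [X in _ = _ + X]eq_bigr => g' _ do rewrite sum_star_node.
  rewrite !big_split /=.

  have -> : t4 = \sum_(R <- tree_star y W0) \sum_(S <- tree_star x R) F (Node S h).
    exact: (IHW (fun S => F (Node S h))).
  rewrite /t1 (sum_star_node _ _ _ _ (fun R => \sum_(S <- tree_star_last f R) _)).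
  rewrite [t2]exchange_big [t3]exchange_big [t6]exchange_big [t7]exchange_big /=.
  under [X in _ + (_ + _ + X) = _]eq_bigr => i _ do
    under eq_bigr => j _ do rewrite -fcatA.
  by rewrite (AC (6*3) ((1*4*5)*(2*6*7)*(3*8*9))).
- move=> T IH T2 T3 F; rewrite star_last_last big_map.
  under eq_bigr => R _ do rewrite star_last_last big_map.
  rewrite (IH _ _ (fun S => F (FLast S))); apply: eq_bigr => R _.
  by rewrite star_last_last big_map.
- move=> T _ f IH T2 T3 F; rewrite star_last_cons big_map.
  under eq_bigr => R _ do rewrite star_last_cons big_map.
  rewrite (IH _ _ (fun S => F (FCons T S))); apply: eq_bigr => R _.
  by rewrite star_last_cons big_map.
Qed.

Lemma star_assoc T1 T2 T3 (F : ptree -> W) :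
  \sum_(R <- tree_star T1 T2) \sum_(S <- tree_star R T3) F S =
  \sum_(R <- tree_star T2 T3) \sum_(S <- tree_star T1 R) F S.
Proof. exact: (proj1 star_assoc_all). Qed.

End Star.

(** * Splitting a tree in two *)

(** How two splittings combine when an angle that goes to the right lies between
    them: the left parts are multiplied, the right parts are kept apart by [h]. *)
Definition cop_join (A B C : Type) (h : A -> B -> C)
    (s : seq (bitseq * ptree * A)) (t : seq (bitseq * ptree * B)) :
    seq (bitseq * ptree * C) :=
  flatten [seq flatten [seq [seq (x.1.1 ++ false :: y.1.1, L, h x.2 y.2)
    | L <- tree_star x.1.2 y.1.2] | y <- t] | x <- s].

(** The coproduct without its braids.  A triple [(b, L, R)] in [cop T] colors
    the angles of [T], in order, [true] for left and [false] for right; the left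
    angles become those of [L] and the right ones those of [R].  Either the root
    stays on the left, and then the whole tree does, or all angles at the root
    go to the right and the branches split independently, the left parts of the
    branches being multiplied together. *)
Fixpoint cop (T : ptree) : seq (bitseq * ptree * ptree) :=
  if T is Node T0 f
  then (nseq (angles T) true, T, Leaf) :: cop_join Node (cop T0) (copf f)
  else [:: ([::], Leaf, Leaf)]
with copf (f : pforest) : seq (bitseq * ptree * pforest) :=
  match f with
  | FLast T => [seq (x.1, FLast x.2) | x <- cop T]
  | FCons T g => cop_join FCons (cop T) (copf g)
  end.

(** The splittings of a tree whose root goes to the right *)
Definition copn T0 f := cop_join Node (cop T0) (copf f).
Lemma cop_leaf : cop Leaf = [:: ([::], Leaf, Leaf)]. Proof. by []. Qed.
Lemma cop_node T0 f : cop (Node T0 f) =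
  (nseq (angles (Node T0 f)) true, Node T0 f, Leaf) :: copn T0 f.
Proof. by []. Qed.
Lemma copf_last T : copf (FLast T) = [seq (x.1, FLast x.2) | x <- cop T].
Proof. by []. Qed.
Lemma copf_cons T g : copf (FCons T g) = cop_join FCons (cop T) (copf g).
Proof. by []. Qed.
Arguments cop : simpl never.
Arguments copf : simpl never.

Lemma mem_cop_join (A B C : choiceType) (h : A -> B -> C) s t
    (P : bitseq * ptree * C -> Prop) :
  (forall x y L, x \in s -> y \in t -> L \in tree_star x.1.2 y.1.2 ->
     P (x.1.1 ++ false :: y.1.1, L, h x.2 y.2)) ->
  forall z, z \in cop_join h s t -> P z.
Proof.
move=> hP z /flattenP [? /mapP [x xs ->]] /flattenP [? /mapP [y yt ->]].
by move=> /mapP [L LL ->]; apply: hP.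
Qed.
HB.instance Definition _ := gen_eqMixin pforest.
HB.instance Definition _ := gen_choiceMixin pforest.

Definition cop_size (n p q : nat) (b : bitseq) :=
  [/\ size b = n, count id b = p & count negb b = q].

Lemma cop_sizes :
  (forall T x, x \in cop T -> cop_size (angles T) (angles x.1.2) (angles x.2) x.1.1) /\
  (forall f x, x \in copf f -> cop_size (anglesf f) (angles x.1.2) (anglesf x.2) x.1.1).
Proof.
have aux (A B C : choiceType) (h : A -> B -> C) dA dB dC n m s t :
    (forall a b, dC (h a b) = (dA a + (dB b).+1)%N) ->
    (forall x, x \in s -> cop_size n (angles x.1.2) (dA x.2) x.1.1) ->
    (forall x, x \in t -> cop_size m (angles x.1.2) (dB x.2) x.1.1) ->
    forall x, x \in cop_join h s t ->
      cop_size (n + m.+1) (angles x.1.2) (dC x.2) x.1.1.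
  move=> hh hs ht; apply: mem_cop_join => x y L /hs [s1 c1 d1] /ht [s2 c2 d2] sL.
  have {}sL := angles_star sL.
  by split; rewrite ?size_cat ?count_cat /= ?hh ?s1 ?s2 ?c1 ?c2 ?d1 ?d2 ?sL ?add0n.
apply: tree_forest_ind.
- by move=> x; rewrite inE => /eqP ->.
- move=> T IH f IHf x; rewrite cop_node inE => /orP [/eqP ->|] /=.
    by split; rewrite ?size_nseq ?count_nseq ?mul1n.
  rewrite angles_node; apply: (aux _ _ _ _ angles anglesf angles) => // a b.
  exact: angles_node.
- by move=> T IH x /mapP [y /IH ? ->].
- move=> T IH f IHf x; rewrite anglesf_cons; apply: (aux _ _ _ _ angles anglesf anglesf) => // a b.
  exact: anglesf_cons.
Qed.
Definition cop_sizeP := proj1 cop_sizes.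
Definition copf_sizeP := proj2 cop_sizes.

Lemma copn_node T0 f x : x \in copn T0 f -> exists R g, x.2 = Node R g.
Proof.
move: x; apply: (@mem_cop_join _ _ _ Node (cop T0) (copf f)
  (fun x => exists R g, x.2 = Node R g)) => y z L _ _ _.
by exists y.2, z.2.
Qed.

Section Cop.
Variable W : nmodType.

Lemma sum_cop_join (A B C : Type) (h : A -> B -> C) s t (F : bitseq * ptree * C -> W) :
  \sum_(z <- cop_join h s t) F z =
  \sum_(x <- s) \sum_(y <- t) \sum_(L <- tree_star x.1.2 y.1.2)
    F (x.1.1 ++ false :: y.1.1, L, h x.2 y.2).
Proof.
rewrite big_flatten big_map; apply: eq_bigr => x _.
rewrite big_flatten big_map; apply: eq_bigr => y _.
by rewrite big_map.
Qed.

Lemma sum_copf_fcat f f' (F : bitseq * ptree * pforest -> W) :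
  \sum_(z <- copf (fcat f f')) F z =
  \sum_(x <- copf f) \sum_(y <- copf f') \sum_(L <- tree_star x.1.2 y.1.2)
    F (x.1.1 ++ false :: y.1.1, L, fcat x.2 y.2).
Proof.
elim: f F => [T|T f IH] F /=.
  rewrite copf_cons sum_cop_join copf_last big_map; apply: eq_bigr => x _.
  by [].
rewrite !copf_cons sum_cop_join [RHS]sum_cop_join; apply: eq_bigr => x _.
rewrite IH; apply: eq_bigr => y _; rewrite [RHS]exchange_big /=; apply: eq_bigr => z _.
rewrite star_assoc; apply: eq_bigr => L _; apply: eq_bigr => M _.
by rewrite -catA.
Qed.

(** [cop] is multiplicative.  The statement for a forest concerns the product of
    its last tree, the only one involved in the recursion of the product. *)
Definition cop_mul T T' := forall F : bitseq * ptree * ptree -> W,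
  \sum_(R <- tree_star T T') \sum_(z <- cop R) F z =
  \sum_(x <- cop T) \sum_(y <- cop T') \sum_(L <- tree_star x.1.2 y.1.2)
    \sum_(R <- tree_star x.2 y.2) F (x.1.1 ++ y.1.1, L, R).
Definition copf_mul f T' := forall F : bitseq * ptree * pforest -> W,
  \sum_(g <- tree_star_last f T') \sum_(z <- copf g) F z =
  \sum_(x <- copf f) \sum_(y <- cop T') \sum_(L <- tree_star x.1.2 y.1.2)
    \sum_(g <- tree_star_last x.2 y.2) F (x.1.1 ++ y.1.1, L, g).

(** Compatibility with each of the three operations, for the terms of the result
    whose right-hand tree has a root.  The operation then acts on the right-hand
    trees, and associativity regroups the product of the left-hand ones. *)
Lemma cop_mul_prec T0 f T' (F : bitseq * ptree * ptree -> W) : copf_mul f T' ->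
  \sum_(g <- tree_star_last f T') \sum_(z <- copn T0 g) F z =
  \sum_(x <- copn T0 f) \sum_(y <- cop T') \sum_(L <- tree_star x.1.2 y.1.2)
    \sum_(R <- tree_prec x.2 y.2) F (x.1.1 ++ y.1.1, L, R).
Proof.
move=> H; under eq_bigr => g _ do rewrite sum_cop_join.
rewrite exchange_big sum_cop_join /=; apply: eq_bigr => x _.
rewrite (H (fun y => \sum_(L <- tree_star x.1.2 y.1.2)
  F (x.1.1 ++ false :: y.1.1, L, Node x.2 y.2))) /=.
apply: eq_bigr => y _; rewrite [RHS]exchange_big /=; apply: eq_bigr => z _.
rewrite star_assoc; apply: eq_bigr => L _; rewrite exchange_big /=; apply: eq_bigr => M _.
have -> : tree_prec (Node x.2 y.2) z.2 =
    [seq Node x.2 g | g <- tree_star_last y.2 z.2].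
  by case: z.2 => [|? ?]; rewrite ?star_last_leaf.
by rewrite big_map; apply: eq_bigr => g _; rewrite -catA.
Qed.

Lemma cop_mul_succ T T0' f' (F : bitseq * ptree * ptree -> W) : cop_mul T T0' ->
  \sum_(R <- tree_star T T0') \sum_(z <- copn R f') F z =
  \sum_(x <- cop T) \sum_(y <- copn T0' f') \sum_(L <- tree_star x.1.2 y.1.2)
    \sum_(R <- tree_succ x.2 y.2) F (x.1.1 ++ y.1.1, L, R).
Proof.
move=> H; under eq_bigr => g _ do rewrite sum_cop_join.
rewrite (H (fun x => \sum_(y <- copf f') \sum_(L <- tree_star x.1.2 y.1.2)
  F (x.1.1 ++ false :: y.1.1, L, Node x.2 y.2))) /=.
apply: eq_bigr => x _; rewrite sum_cop_join; apply: eq_bigr => y _.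
under eq_bigr => L _ do rewrite exchange_big /=.
rewrite exchange_big /=; apply: eq_bigr => z _.
under eq_bigr => L _ do rewrite exchange_big /=.
rewrite star_assoc; apply: eq_bigr => L _; apply: eq_bigr => M _.
have -> : tree_succ x.2 (Node y.2 z.2) =
    [seq Node R z.2 | R <- tree_star x.2 y.2].
  by case: x.2.
by rewrite big_map; apply: eq_bigr => g _; rewrite -catA.
Qed.

Lemma cop_mul_dot T0 f T0' f' (F : bitseq * ptree * ptree -> W) : copf_mul f T0' ->
  \sum_(g <- tree_star_last f T0') \sum_(z <- copn T0 (fcat g f')) F z =
  \sum_(x <- copn T0 f) \sum_(y <- copn T0' f') \sum_(L <- tree_star x.1.2 y.1.2)
    \sum_(R <- tree_dot x.2 y.2) F (x.1.1 ++ y.1.1, L, R).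
Proof.
move=> H; under eq_bigr => g _ do rewrite sum_cop_join.
rewrite exchange_big sum_cop_join /=; apply: eq_bigr => x _.
under eq_bigr => g _ do rewrite sum_copf_fcat.
rewrite (H (fun y => \sum_(z <- copf f') \sum_(M <- tree_star y.1.2 z.1.2)
  \sum_(L <- tree_star x.1.2 M)
  F (x.1.1 ++ false :: (y.1.1 ++ false :: z.1.1), L, Node x.2 (fcat y.2 z.2)))) /=.
apply: eq_bigr => y _.
rewrite [RHS]exchange_big sum_cop_join /=; apply: eq_bigr => z _.
under eq_bigr => L _ do rewrite exchange_big /=.
rewrite exchange_big /=; apply: eq_bigr => u _.
under eq_bigr => L _ do rewrite exchange_big /=.
rewrite star_assoc; apply: eq_bigr => L _.
rewrite star_assoc; apply: eq_bigr => M _.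
rewrite exchange_big /=; apply: eq_bigr => N _.
by rewrite big_map; apply: eq_bigr => g _; rewrite -!catA.
Qed.

Lemma nseq_angles_star T T' R : R \in tree_star T T' ->
  nseq (angles R) true = nseq (angles T) true ++ nseq (angles T') true.
Proof. by move=> /angles_star ->; rewrite nseqD. Qed.

Lemma cop_mul_all : (forall T T', cop_mul T T') /\ (forall f T', copf_mul f T').
Proof.
apply: tree_forest_ind.
- move=> T' F; rewrite cop_leaf star_leafl !big_seq1; apply: eq_bigr => x _.
  by rewrite !star_leafl !big_seq1; case: x => [[]].
- move=> T0 _ f IHf.
  apply: (proj1 (@tree_forest_ind _ (fun=> True) _ _ _ _)) => // [F|T0' IHT h _ F].
    rewrite cop_leaf star_leafr !big_seq1; apply: eq_bigr => x _.
    by rewrite big_seq1 !star_leafr !big_seq1 cats0; case: x => [[]].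
  set x := Node T0 f; set y := Node T0' h.
  transitivity (\sum_(R <- tree_star x y) F (nseq (angles R) true, R, Leaf) +
    (\sum_(g <- tree_star_last f y) \sum_(z <- copn T0 g) F z
     + \sum_(R <- tree_star x T0') \sum_(z <- copn R h) F z
     + \sum_(g <- tree_star_last f T0') \sum_(z <- copn T0 (fcat g h)) F z)).
    rewrite !sum_star_node.
    rewrite [RHS](AC (3*3) ((1*4)*(2*5)*(3*6))) -!big_split /=.
    by congr (_ + _ + _); apply: eq_bigr => g _; rewrite cop_node big_cons.
  rewrite cop_mul_prec // cop_mul_succ // cop_mul_dot //.
  rewrite !cop_node !big_cons /= star_leafr.
  under [X in _ + (X + _ + _) = _]eq_bigr do rewrite big_cons /=.
  under [X in _ = _ + X]eq_bigr do rewrite big_cons /=.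
  rewrite !big_split /= !addrA [RHS](AC 4 (1*3*2*4)) /=.
  rewrite [LHS](AC 6 (1*2*4*(3*5*6))) /=.
  congr (_ + _ + _ + _).
  + rewrite big_seq [RHS]big_seq; apply: eq_bigr => R /nseq_angles_star ->.
    by rewrite big_seq1.
  + rewrite big_seq [RHS]big_seq; apply: eq_bigr => z /copn_node [R [g ->]].
    by rewrite star_leafr.
  + rewrite big_seq [RHS]big_seq; apply: eq_bigr => z /copn_node [R [g ->]].
    by rewrite star_leafl.
  rewrite -!big_split /= big_seq [RHS]big_seq; apply: eq_bigr => u /copn_node [R [g ->]].
  rewrite -!big_split /= big_seq [RHS]big_seq; apply: eq_bigr => v _.
  rewrite -!big_split /=; apply: eq_bigr => L _.
  by rewrite tree_starE; [rewrite !big_cat /= addrA|left].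
- move=> T IH T' F; rewrite star_last_last big_map copf_last big_map.
  under eq_bigr do rewrite copf_last big_map.
  rewrite (IH _ (fun z => F (z.1, FLast z.2))) /=; apply: eq_bigr => x _.
  apply: eq_bigr => y _; apply: eq_bigr => L _.
  by rewrite star_last_last big_map.
- move=> T _ f IH T' F; rewrite star_last_cons big_map copf_cons sum_cop_join.
  under eq_bigr do rewrite copf_cons sum_cop_join.
  rewrite exchange_big /=; apply: eq_bigr => x _.
  rewrite (IH _ (fun y => \sum_(L <- tree_star x.1.2 y.1.2)
    F (x.1.1 ++ false :: y.1.1, L, FCons x.2 y.2))) /=.
  apply: eq_bigr => y _; rewrite [RHS]exchange_big /=; apply: eq_bigr => z _.
  rewrite star_assoc; apply: eq_bigr => L _; rewrite exchange_big /=; apply: eq_bigr => M _.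
  by rewrite star_last_cons big_map; apply: eq_bigr => g _; rewrite -catA.
Qed.

(** Splitting is a homomorphism for each of the three operations.  When both
    right-hand trees are trivial the operation must act on the left-hand ones,
    since it is undefined on two trivial trees; this is the case distinction
    in the operations of the box product. *)
Lemma cop_op (o : ptree -> ptree -> seq ptree) T0 f T0' f'
    (F : bitseq * ptree * ptree -> W) :
  [\/ o = tree_prec, o = tree_succ | o = tree_dot] ->
  let T := Node T0 f in let T' := Node T0' f' in
  \sum_(R <- o T T') \sum_(z <- cop R) F z =
  \sum_(x <- cop T) \sum_(y <- cop T')
    if is_leaf x.2 && is_leaf y.2
    then \sum_(R <- o x.1.2 y.1.2) F (x.1.1 ++ y.1.1, R, Leaf)
    else \sum_(L <- tree_star x.1.2 y.1.2) \sum_(R <- o x.2 y.2)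
           F (x.1.1 ++ y.1.1, L, R).
Proof.
move=> ho T T'.
pose G (x y : bitseq * ptree * ptree) :=
  \sum_(L <- tree_star x.1.2 y.1.2) \sum_(R <- o x.2 y.2) F (x.1.1 ++ y.1.1, L, R).
pose hd U := (nseq (angles U) true, U, Leaf) : bitseq * ptree * ptree.
transitivity (\sum_(R <- o T T') F (nseq (angles T) true ++ nseq (angles T') true, R, Leaf) +
    (\sum_(y <- copn T0' f') G (hd T) y + \sum_(x <- copn T0 f) \sum_(y <- cop T') G x y));
  last first.
  rewrite [cop T]cop_node big_cons [cop T']cop_node big_cons /=.
  rewrite -!addrA; congr (_ + (_ + _)).
    rewrite big_seq [RHS]big_seq; apply: eq_bigr => y /copn_node [R [g E]].
    by rewrite /G E.
  rewrite big_seq [RHS]big_seq; apply: eq_bigr => x /copn_node [R [g E]].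
  by apply: eq_bigr => y _; rewrite /G E.
have -> : \sum_(R <- o T T') \sum_(z <- cop R) F z =
    \sum_(R <- o T T') F (nseq (angles T) true ++ nseq (angles T') true, R, Leaf) +
    \sum_(R <- o T T') \sum_(z <- behead (cop R)) F z.
  rewrite -big_split /= big_seq [RHS]big_seq; apply: eq_bigr => R oR.
  have sR : R \in tree_star T T'.
    rewrite tree_starE; last by left.
    by rewrite !mem_cat; case: ho oR => -> ->; rewrite ?orbT.
  rewrite -(nseq_angles_star sR); case: R {sR} oR => [oR|? ? _].
    by case: ho oR => ->; rewrite /tree_prec /tree_succ /tree_dot => /mapP [].
  by rewrite cop_node big_cons.
congr (_ + _).
have [M Mf] := cop_mul_all.
case: ho => E; rewrite E.
- rewrite big_map cop_mul_prec // -[LHS]add0r; congr (_ + _).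
    rewrite big_seq big1 // => y /copn_node [R [g Ey]].
    by rewrite /G E Ey big1 // => L _; rewrite big_nil.
  by apply: eq_bigr => x _; apply: eq_bigr => y _; rewrite /G E.
- rewrite big_map cop_mul_succ // cop_node big_cons; congr (_ + _).
    by apply: eq_bigr => x _; rewrite /G E.
  rewrite big_seq [RHS]big_seq; apply: eq_bigr => x /copn_node [R [g Ex]].
  rewrite cop_node big_cons {2}/G E /= Ex.
  rewrite [X in X + _]big1 ?add0r; last by move=> L _; rewrite /= E Ex /tree_succ big_nil.
  by [].

- rewrite big_map cop_mul_dot // -[LHS]add0r; congr (_ + _).
    by rewrite big1 // => y _; rewrite /G E big1 // => L _; rewrite /tree_dot /= big_nil.
  rewrite big_seq [RHS]big_seq; apply: eq_bigr => x /copn_node [R [g Ex]].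
  rewrite cop_node big_cons {2}/G E /= Ex.
  rewrite [X in X + _]big1 ?add0r; last by move=> L _; rewrite /= E Ex /tree_dot big_nil.
  by [].

Qed.

Lemma cop_star T T' (F : bitseq * ptree * ptree -> W) :
  \sum_(R <- tree_star T T') \sum_(z <- cop R) F z =
  \sum_(x <- cop T) \sum_(y <- cop T') \sum_(L <- tree_star x.1.2 y.1.2)
    \sum_(R <- tree_star x.2 y.2) F (x.1.1 ++ y.1.1, L, R).
Proof. exact: (proj1 cop_mul_all). Qed.

(** The counit laws: exactly one splitting has a trivial right-hand tree and
    exactly one has a trivial left-hand tree. *)
Lemma cop_counitr T (F : bitseq -> ptree -> W) :
  \sum_(x <- cop T) (if x.2 is Leaf then F x.1.1 x.1.2 else 0) =
  F (nseq (angles T) true) T.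
Proof.
case: T => [|T0 f]; first by rewrite cop_leaf big_seq1.
rewrite cop_node big_cons /= big_seq big1 ?addr0 // => x /copn_node [R [g ->]].
by [].
Qed.

Lemma star_counit T T' (a : W) :
  \sum_(R <- tree_star T T') (if R is Leaf then a else 0) =
  if T is Leaf then if T' is Leaf then a else 0 else 0.
Proof.
case: T => [|T0 f]; first by rewrite star_leafl big_seq1.
rewrite big_seq big1 // => -[/angles_star|//].
by rewrite angles_node addnS.
Qed.

Lemma cop_counitl_all :
  (forall T (F : bitseq -> ptree -> W),
     \sum_(x <- cop T) (if x.1.2 is Leaf then F x.1.1 x.2 else 0) =
     F (nseq (angles T) false) T) /\
  (forall f (F : bitseq -> pforest -> W),
     \sum_(x <- copf f) (if x.1.2 is Leaf then F x.1.1 x.2 else 0) =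
     F (nseq (anglesf f) false) f).
Proof.
have aux (A B C : choiceType) (h : A -> B -> C) s t m n a b (F : bitseq -> C -> W) :
    (forall F : bitseq -> A -> W,
      \sum_(x <- s) (if x.1.2 is Leaf then F x.1.1 x.2 else 0) = F (nseq m false) a) ->
    (forall F : bitseq -> B -> W,
      \sum_(x <- t) (if x.1.2 is Leaf then F x.1.1 x.2 else 0) = F (nseq n false) b) ->
    \sum_(x <- cop_join h s t) (if x.1.2 is Leaf then F x.1.1 x.2 else 0) =
    F (nseq (m + n.+1) false) (h a b).
  move=> hs ht; rewrite sum_cop_join /=.
  under eq_bigr => x _.
    under eq_bigr => y _ do rewrite star_counit.
    over.
  rewrite nseqD /= -(hs (fun b1 a => F (b1 ++ false :: nseq n false) (h a b))).
  apply: eq_bigr => x _; case: x.1.2 => [|? ?]; last by rewrite big1.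
  exact: (ht (fun b2 b => F (x.1.1 ++ false :: b2) (h x.2 b))).
apply: tree_forest_ind.
- by move=> F; rewrite cop_leaf big_seq1.
- move=> T IH f IHf F; rewrite cop_node big_cons /= add0r angles_node.
  exact: aux.
- by move=> T IH F; rewrite copf_last big_map (IH (fun b T => F b (FLast T))).
- by move=> T IH f IHf F; rewrite copf_cons anglesf_cons; apply: aux.
Qed.

Lemma cop_counitl T (F : bitseq -> ptree -> W) :
  \sum_(x <- cop T) (if x.1.2 is Leaf then F x.1.1 x.2 else 0) =
  F (nseq (angles T) false) T.
Proof. exact: (proj1 cop_counitl_all). Qed.
End Cop.

(** * Splitting a tree in three *)

(** The two ways of splitting twice color the angles with [0], [1], [2]: [mergel]
    refines the left part of [b] by [b'] and [merger] refines its right part. *)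
Fixpoint mergel (b b' : bitseq) : seq nat :=
  match b with
  | true :: c => (if head true b' then 0 else 1)%N :: mergel c (behead b')
  | false :: c => 2 :: mergel c b'
  | [::] => [::]
  end.
Fixpoint merger (b b' : bitseq) : seq nat :=
  match b with
  | true :: c => 0%N :: merger c b'
  | false :: c => (if head true b' then 1 else 2)%N :: merger c (behead b')
  | [::] => [::]
  end.

Lemma mergel_cat b c b' c' : size b' = count id b ->
  mergel (b ++ c) (b' ++ c') = mergel b b' ++ mergel c c'.
Proof.
elim: b b' => [|[] b IH] b' /=; first by case: b'.
  by case: b' => [|x b'] //= [/IH ->].
by rewrite add0n => /IH ->.
Qed.
Lemma merger_cat b c b' c' : size b' = count negb b ->
  merger (b ++ c) (b' ++ c') = merger b b' ++ merger c c'.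
Proof.
elim: b b' => [|[] b IH] b' /=; first by case: b'.
  by rewrite add0n => /IH ->.
by case: b' => [|x b'] //= [/IH ->].
Qed.

Section Coassoc.
Variable W : nmodType.

(** Coassociativity of a list [s] of splittings, [copA] splitting the right-hand
    parts.  The coloring is part of the data summed over, so that the braids
    can be added afterwards. *)
Definition coassoc_on (A : eqType) (copA : A -> seq (bitseq * ptree * A))
    (s : seq (bitseq * ptree * A)) :=
  forall F : seq nat -> ptree -> ptree -> A -> W,
  \sum_(x <- s) \sum_(y <- cop x.1.2) F (mergel x.1.1 y.1.1) y.1.2 y.2 x.2 =
  \sum_(x <- s) \sum_(y <- copA x.2) F (merger x.1.1 y.1.1) x.1.2 y.1.2 y.2.

Definition sizes_on (A : eqType) (copA : A -> seq (bitseq * ptree * A))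
    (s : seq (bitseq * ptree * A)) :=
  forall x, x \in s -> count id x.1.1 = angles x.1.2 /\
    forall y, y \in copA x.2 -> size y.1.1 = count negb x.1.1.

(** Splitting the left part of a joined splitting uses the multiplicativity of
    [cop]; after that the two factors can be treated separately. *)
Lemma cop_join_coassoc (A B C : eqType) (h : A -> B -> C) copA copB s t
    (F : seq nat -> ptree -> ptree -> C -> W) :
  coassoc_on copA s -> coassoc_on copB t ->
  sizes_on copA s -> sizes_on copB t ->
  \sum_(x <- cop_join h s t) \sum_(y <- cop x.1.2)
     F (mergel x.1.1 y.1.1) y.1.2 y.2 x.2 =
  \sum_(x <- s) \sum_(y <- t) \sum_(L <- tree_star x.1.2 y.1.2)
    \sum_(z <- cop_join h (copA x.2) (copB y.2))
      F (merger (x.1.1 ++ false :: y.1.1) z.1.1) L z.1.2 z.2.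
Proof.
move=> cs ct ss st; rewrite sum_cop_join /=.
transitivity (\sum_(x <- s) \sum_(y <- cop x.1.2) \sum_(u <- t) \sum_(v <- cop u.1.2)
   \sum_(M <- tree_star y.1.2 v.1.2) \sum_(N <- tree_star y.2 v.2)
   F (mergel x.1.1 y.1.1 ++ 2 :: mergel u.1.1 v.1.1) M N (h x.2 u.2)).
  rewrite big_seq [RHS]big_seq; apply: eq_bigr => x /ss [xs _].
  rewrite [RHS]exchange_big /=; apply: eq_bigr => u _.
  rewrite (cop_star _ _ (fun y => F (mergel (x.1.1 ++ false :: u.1.1) y.1.1)
    y.1.2 y.2 (h x.2 u.2))) /=.
  apply: eq_big_seq => y /cop_sizeP [ys _ _]; apply: eq_bigr => v _.
  by rewrite mergel_cat // ys xs.
under [LHS]eq_bigr => x _ do under eq_bigr => y _ do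
  rewrite (ct (fun c L1 L2 r => \sum_(M <- tree_star y.1.2 L1)
    \sum_(N <- tree_star y.2 L2) F (mergel x.1.1 y.1.1 ++ 2 :: c) M N (h x.2 r))).
rewrite (cs (fun c L1 L2 r => \sum_(u <- t) \sum_(v <- copB u.2)
  \sum_(M <- tree_star L1 u.1.2) \sum_(N <- tree_star L2 v.1.2)
    F (c ++ 2 :: merger u.1.1 v.1.1) M N (h r v.2))).
apply: eq_big_seq => x /ss [_ xs].
rewrite exchange_big /=; apply: eq_big_seq => u /st [_ us].
under [RHS]eq_bigr do rewrite sum_cop_join /=.
rewrite [RHS]exchange_big /=; apply: eq_big_seq => y /xs yx.
rewrite exchange_big /=; apply: eq_bigr => v _.
apply: eq_bigr => w _; apply: eq_bigr => N _.
by rewrite merger_cat.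
Qed.

Lemma sizes_cop T : sizes_on cop (cop T).
Proof.
by move=> x /cop_sizeP [_ -> ->]; split=> // y /cop_sizeP [->].
Qed.
Lemma sizes_copf f : sizes_on copf (copf f).
Proof.
by move=> x /copf_sizeP [_ -> ->]; split=> // y /copf_sizeP [->].
Qed.

Let col01 (x : bool) : nat := if x then 0%N else 1%N.
Lemma mergel_true n b : size b = n -> mergel (nseq n true) b = map col01 b.
Proof. by move=> <-; elim: b => //= x b ->. Qed.
Lemma merger_true b : merger b (nseq (count negb b) true) = map col01 b.
Proof. by elim: b => [|[] b IH] //=; rewrite ?add0n IH. Qed.
Lemma merger_nil n : merger (nseq n true) [::] = nseq n 0%N.
Proof. by elim: n => //= n ->. Qed.

(** The splittings of the root to the right are handled by [cop_join_coassoc].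
    What remains on either side are the terms whose last tree is trivial, and
    those are the same. *)
Lemma cop_coassoc_all :
  (forall T, coassoc_on cop (cop T)) /\ (forall f, coassoc_on copf (copf f)).
Proof.
apply: tree_forest_ind.
- by move=> F; rewrite cop_leaf !big_seq1.
- move=> T IH f IHf F; set U := Node T f.
  rewrite cop_node [LHS]big_cons [RHS]big_cons /= cop_leaf big_seq1.
  rewrite /copn (cop_join_coassoc Node F IH IHf (@sizes_cop T) (@sizes_copf f)).
  rewrite cop_node big_cons -addrA.
  congr (_ + _).
    by rewrite /= merger_nil mergel_true ?size_nseq // map_nseq.
  have szU z : z \in copn T f -> size z.1.1 = angles U /\ count negb z.1.1 = angles z.2.
    move=> zU; have zU' : z \in cop U by rewrite cop_node inE zU orbT.
    by have [] := cop_sizeP zU'.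
  (* The second splitting keeps [z.2] whole or moves its root to the right. *)
  transitivity (\sum_(z <- copn T f) (F (map col01 z.1.1) z.1.2 z.2 Leaf +
      \sum_(y <- behead (cop z.2)) F (merger z.1.1 y.1.1) z.1.2 y.1.2 y.2)).
    rewrite big_split /=; congr (_ + _); last by rewrite [RHS]sum_cop_join.
    by apply: eq_big_seq => z /szU [E _]; rewrite mergel_true.
  apply: eq_big_seq => z zU; have [_ E] := szU z zU.
  have [R [g Eg]] := copn_node zU.
  by rewrite Eg cop_node big_cons /= -Eg -E merger_true.
- move=> T IH F; rewrite copf_last !big_map (IH (fun c L M R => F c L M (FLast R))) /=.
  by apply: eq_bigr => x _; rewrite copf_last big_map.
- move=> T IH f IHf F.
  rewrite copf_cons (cop_join_coassoc FCons F IH IHf (@sizes_cop T) (@sizes_copf f)).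
  by rewrite sum_cop_join; do 3![apply: eq_bigr => ? _].
Qed.

Lemma cop_coassoc T : coassoc_on cop (cop T).
Proof. exact: (proj1 cop_coassoc_all). Qed.
End Coassoc.

(** * Linear maps and tensor products *)

Section LinearMaps.
Variable k : fieldType.
Implicit Types A B C D U V W X Y : lmodType k.

Lemma lcompA U V W X (h : {linear W -> X}) (g : {linear V -> W}) (f : {linear U -> V}) :
  h ∘ (g ∘ f) = h ∘ g ∘ f.
Proof. exact: linear_ext. Qed.
Lemma lcompf1 U V (f : {linear U -> V}) : f ∘ lid U = f.
Proof. exact: linear_ext. Qed.
Lemma lcomp1f U V (f : {linear U -> V}) : lid V ∘ f = f.
Proof. exact: linear_ext. Qed.
Lemma hom_sumE U V (I : Type) (s : seq I) (P : pred I) (F : I -> {linear U -> V}) x :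
  (\sum_(i <- s | P i) F i) x = \sum_(i <- s | P i) F i x.
Proof. by elim/big_rec2: _ => // i f y _ <-. Qed.
Lemma lcomp_suml U V W (I : Type) (s : seq I) (P : pred I) (F : I -> {linear V -> W})
    (f : {linear U -> V}) :
  (\sum_(i <- s | P i) F i) ∘ f = \sum_(i <- s | P i) (F i ∘ f).
Proof. by apply: linear_ext => x; rewrite lcompE !hom_sumE. Qed.
Lemma lcomp_sumr U V W (I : Type) (s : seq I) (P : pred I) (g : {linear V -> W})
    (F : I -> {linear U -> V}) :
  g ∘ (\sum_(i <- s | P i) F i) = \sum_(i <- s | P i) (g ∘ F i).
Proof. by apply: linear_ext => x; rewrite lcompE !hom_sumE linear_sum. Qed.
Lemma lcomp0f U V W (f : {linear U -> V}) : (0 : {linear V -> W}) ∘ f = 0.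
Proof. exact: linear_ext. Qed.
Lemma lcompf0 U V W (f : {linear V -> W}) : f ∘ (0 : {linear U -> V}) = 0.
Proof. by apply: linear_ext => x; rewrite lcompE !hom0E linear0. Qed.

Lemma tensE U V W (f g : {linear U ⊗ V -> W}) :
  (forall u v, f (u \ox v) = g (u \ox v)) -> f = g.
Proof. by move=> h; apply/linear_ext/tens_ext. Qed.
Lemma tens3E U V W X (f g : {linear U ⊗ V ⊗ W -> X}) :
  (forall u v w, f (u \ox v \ox w) = g (u \ox v \ox w)) -> f = g.
Proof.
move=> h; apply: tensE => u t.
suff E : f ∘ purer _ u = g ∘ purer _ u by exact: (congr1 (fun h : {linear _ -> _} => h t) E).
exact/tensE/h.
Qed.
Lemma lin_app U V (f g : {linear U -> V}) x : f = g -> f x = g x.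
Proof. by move=> ->. Qed.
Lemma tens_app U V W (f g : {linear U ⊗ V -> W}) z :
  (forall u v, f (u \ox v) = g (u \ox v)) -> f z = g z.
Proof. by move=> h; rewrite (tensE h). Qed.

Lemma purelE U V (u : U) (v : V) : purel U v u = u \ox v. Proof. by []. Qed.
Lemma purerE U V (u : U) (v : V) : purer V u v = u \ox v. Proof. by []. Qed.
Lemma pure_suml U V (I : Type) (s : seq I) (P : pred I) (F : I -> U) (v : V) :
  (\sum_(i <- s | P i) F i) \ox v = \sum_(i <- s | P i) F i \ox v.
Proof. exact: (linear_sum (purel U v)). Qed.
Lemma pure_sumr U V (I : Type) (s : seq I) (P : pred I) (F : I -> V) (u : U) :
  u \ox (\sum_(i <- s | P i) F i) = \sum_(i <- s | P i) u \ox F i.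
Proof. exact: (linear_sum (purer V u)). Qed.
Lemma pure0l U V (v : V) : (0 : U) \ox v = 0.
Proof. exact: (linear0 (purel U v)). Qed.
Lemma pure0r U V (u : U) : u \ox (0 : V) = 0.
Proof. exact: (linear0 (purer V u)). Qed.

Lemma tmap_comp A B C A' B' C' (f : {linear A -> B}) (g : {linear B -> C})
    (f' : {linear A' -> B'}) (g' : {linear B' -> C'}) :
  tmap (g ∘ f) (g' ∘ f') = tmap g g' ∘ tmap f f'.
Proof. by apply: tensE => u v; rewrite lcompE !tmapE. Qed.
Lemma tmap_id A B : tmap (lid A) (lid B) = lid (A ⊗ B).
Proof. by apply: tensE => u v; rewrite tmapE. Qed.
Lemma tmap_suml A B C D (I : Type) (s : seq I) (P : pred I) (F : I -> {linear A -> B})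
    (g : {linear C -> D}) :
  tmap (\sum_(i <- s | P i) F i) g = \sum_(i <- s | P i) tmap (F i) g.
Proof.
apply: tensE => u v; rewrite tmapE !hom_sumE pure_suml.
by apply: eq_bigr => i _; rewrite tmapE.
Qed.
Lemma tmap_sumr A B C D (I : Type) (s : seq I) (P : pred I) (F : I -> {linear A -> B})
    (g : {linear C -> D}) :
  tmap g (\sum_(i <- s | P i) F i) = \sum_(i <- s | P i) tmap g (F i).
Proof.
apply: tensE => u v; rewrite tmapE !hom_sumE pure_sumr.
by apply: eq_bigr => i _; rewrite tmapE.
Qed.

Lemma tens3lE U V W X (f g : {linear (U ⊗ V) ⊗ W -> X}) :
  (forall u v w, f ((u \ox v) \ox w) = g ((u \ox v) \ox w)) -> f = g.
Proof.
move=> h; suff E : tcurry f = tcurry g.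
  by apply: tensE => z c; rewrite -!tcurryE E.
by apply: tensE => a b; apply: linear_ext => c; rewrite !tcurryE.
Qed.
Lemma assocK A B C : assocV A B C ∘ assoc A B C = lid _.
Proof. by apply: tens3lE => a b c; rewrite lcompE assocE assocVE. Qed.

Lemma assoc_nat A B C A' B' C' (f : {linear A -> A'}) (g : {linear B -> B'})
    (h : {linear C -> C'}) :
  assoc A' B' C' ∘ tmap (tmap f g) h = tmap f (tmap g h) ∘ assoc A B C.
Proof. by apply: tens3lE => a b c; rewrite !lcompE assocE !tmapE assocE. Qed.
Lemma assocV_nat A B C A' B' C' (f : {linear A -> A'}) (g : {linear B -> B'})
    (h : {linear C -> C'}) :
  assocV A' B' C' ∘ tmap f (tmap g h) = tmap (tmap f g) h ∘ assocV A B C.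
Proof. by apply: tens3E => a b c; rewrite !lcompE assocVE !tmapE assocVE. Qed.

Lemma act2E A B C D (f : {linear A ⊗ B -> C ⊗ D}) X a b (x : X) :
  act2 f X (a \ox b \ox x) = assoc C D X (f (a \ox b) \ox x).
Proof. by rewrite !lcompE assocVE tmapE. Qed.

Lemma act2_nat A B C D (f : {linear A ⊗ B -> C ⊗ D}) X Y (g : {linear X -> Y}) :
  act2 f Y ∘ tmap (lid A) (tmap (lid B) g) =
  tmap (lid C) (tmap (lid D) g) ∘ act2 f X.
Proof.
apply: tens3E => a b x; rewrite lcompE [RHS]lcompE !tmapE !act2E.
move: (f _) => z; apply: (tens_app (f := assoc C D Y ∘ purel _ (g x))
   (g := tmap (lid C) (tmap (lid D) g) ∘ assoc C D X ∘ purel _ x)) => c d.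
by rewrite !lcompE /= !assocE !tmapE.
Qed.
Lemma lcompDl U V W (f g : {linear V -> W}) (h : {linear U -> V}) :
  (f + g) ∘ h = f ∘ h + g ∘ h.
Proof. exact: linear_ext. Qed.
Lemma lcompBl U V W (f g : {linear V -> W}) (h : {linear U -> V}) :
  (f - g) ∘ h = f ∘ h - g ∘ h.
Proof. exact: linear_ext. Qed.
Lemma lcompBr U V W (h : {linear V -> W}) (f g : {linear U -> V}) :
  h ∘ (f - g) = h ∘ f - h ∘ g.
Proof. by apply: linear_ext => x; exact: linearB. Qed.
Lemma tmapBl U V W X (f g : {linear U -> V}) (h : {linear W -> X}) :
  tmap (f - g) h = tmap f h - tmap g h.
Proof.
apply: tensE => u v; rewrite [RHS]/= !tmapE.
exact: (linearB (purel V (h v))).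
Qed.
Lemma tmapBr U V W X (f g : {linear U -> V}) (h : {linear W -> X}) :
  tmap h (f - g) = tmap h f - tmap h g.
Proof.
apply: tensE => u v; rewrite [RHS]/= !tmapE.
exact: (linearB (purer V (h u))).
Qed.
Lemma tmap0l U V W X (h : {linear W -> X}) : tmap (0 : {linear U -> V}) h = 0.
Proof. by apply: tensE => u v; rewrite tmapE !hom0E pure0l. Qed.
Lemma tmap0r U V W X (h : {linear W -> X}) : tmap h (0 : {linear U -> V}) = 0.
Proof. by apply: tensE => u v; rewrite tmapE !hom0E pure0r. Qed.
End LinearMaps.

(** * Braids acting on the tensor algebra *)

Section BraidCalculus.
Variables (k : fieldType) (V : lmodType k).

(** Working on the whole tensor algebra of [V] rather than on each power avoids
    transporting along equalities such as [m + n = n + m]. *)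
Definition TV : lmodType k := dsum (fun n : nat => tpow V n).
Definition tin n : {linear tpow V n -> TV} := dsum_in (fun n : nat => tpow V n) n.
Definition tone : TV := tin 0 (1 : k).
Definition tcons : {linear V ⊗ TV -> TV} :=
  tuncurry (lflip (dlift (fun n => lflip (tcurry (tin n.+1))))).

Lemma tcons_tin n v x : tcons (v \ox tin n x) = tin n.+1 (v \ox x).
Proof. by rewrite tuncurryE lflipE [dlift _ _]dlift_in. Qed.
Lemma tcons_in n : tcons ∘ tmap (lid V) (tin n) = tin n.+1.
Proof. by apply: tensE => v x; rewrite lcompE tmapE tcons_tin. Qed.

Lemma tin0 c : tin 0 c = c *: tone.
Proof. by rewrite -linearZ; congr (tin 0 _); exact: (esym (mulr1 c)). Qed.

Lemma tv_inE (W : lmodType k) (f g : {linear TV -> W}) :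
  (forall n, f ∘ tin n = g ∘ tin n) -> f = g.
Proof.
move=> h; apply/linear_ext/dsum_ext => n x.
exact: (lin_app x (h n)).
Qed.

Lemma tvE (W : lmodType k) (f g : {linear TV -> W}) :
  f tone = g tone -> f ∘ tcons = g ∘ tcons -> f = g.
Proof.
move=> h0 h1; apply: tv_inE => -[|n].
  by apply: linear_ext => c; rewrite !lcompE tin0 !linearZ h0.
by rewrite -tcons_in !lcompA h1.
Qed.

(** The tensor algebra is the sum of the ground field and of [V ⊗ TV]. *)
Section Case.
Variables (W : lmodType k) (w : W) (f : {linear V ⊗ TV -> W}).
Let scale_lin : linear (fun c : k^o => c *: w).
Proof. by move=> a b c; rewrite scalerDl scalerA. Qed.
Definition tvcase : {linear TV -> W} :=
  dlift (fun n => match n return {linear tpow V n -> W} with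
                  | 0 => mklin scale_lin
                  | n'.+1 => f ∘ tmap (lid V) (tin n')
                  end).
Lemma tvcase_one : tvcase tone = w.
Proof. by rewrite [LHS]dlift_in /= scale1r. Qed.
Lemma tvcase_cons : tvcase ∘ tcons = f.
Proof.
suff E : lflip (tcurry (tvcase ∘ tcons)) = lflip (tcurry f).
  by apply: tensE => v x; rewrite -(tcurryE f) -(lflipE _ _ x) -E.
apply: tv_inE => n; apply: linear_ext => x; apply: linear_ext => v.
by rewrite !lcompE !lflipE !tcurryE lcompE tcons_tin [LHS]dlift_in lcompE tmapE.
Qed.
Lemma tvcase_consE z : tvcase (tcons z) = f z.
Proof. by rewrite -[RHS](lin_app z tvcase_cons). Qed.
End Case.

(** Shifts an operator by one strand.  It is the identity in degree 0, so that
    it respects composition and identity. *)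
Definition lift1 (f : {linear TV -> TV}) : {linear TV -> TV} :=
  tvcase tone (tcons ∘ tmap (lid V) f).
Lemma lift1_one f : lift1 f tone = tone.
Proof. exact: tvcase_one. Qed.
Lemma lift1_cons f : lift1 f ∘ tcons = tcons ∘ tmap (lid V) f.
Proof. exact: tvcase_cons. Qed.
Lemma lift1_id : lift1 (lid TV) = lid TV.
Proof. by apply: tvE; rewrite ?lift1_one // lift1_cons tmap_id lcompf1 lcomp1f. Qed.
Lemma lift1_comp f g : lift1 (f ∘ g) = lift1 f ∘ lift1 g.
Proof.
apply: tvE; first by rewrite lcompE !lift1_one.
rewrite lift1_cons -lcompA lift1_cons lcompA lift1_cons -lcompA -tmap_comp.
by rewrite lcomp1f.
Qed.

Definition liftn p f := iter p lift1 f.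
Lemma liftnD p q f : liftn (p + q) f = liftn p (liftn q f).
Proof. exact: iterD. Qed.
Lemma liftn_id p : liftn p (lid TV) = lid TV.
Proof. by elim: p => //= p ->; rewrite lift1_id. Qed.
Lemma liftn_comp p f g : liftn p (f ∘ g) = liftn p f ∘ liftn p g.
Proof. by elim: p => //= p ->; rewrite lift1_comp. Qed.
Lemma liftnSr p f : liftn p.+1 f = liftn p (lift1 f).
Proof. exact: iterSr. Qed.

(** Splits off the first [p] factors; tensors of degree less than [p] go to 0. *)
Fixpoint cut (p : nat) : {linear TV -> TV ⊗ TV} :=
  if p is p'.+1
  then tvcase 0 (tmap tcons (lid TV) ∘ assocV V TV TV ∘ tmap (lid V) (cut p'))
  else purer TV tone.

Arguments cut : simpl never.
Definition scons (X : lmodType k) v : {linear TV ⊗ X -> TV ⊗ X} :=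
  tmap (tcons ∘ purer _ v) (lid X).
Lemma sconsE (X : lmodType k) v a (b : X) : scons X v (a \ox b) = tcons (v \ox a) \ox b.
Proof. exact: tmapE. Qed.

Lemma cutS_one p : cut p.+1 tone = 0.
Proof. exact: tvcase_one. Qed.
Lemma cutS_cons p v x : cut p.+1 (tcons (v \ox x)) = scons TV v (cut p x).
Proof.
rewrite [LHS]tvcase_consE !lcompE tmapE; move: (cut p x) => z.
apply: (tens_app (f := tmap tcons (lid TV) ∘ assocV V TV TV ∘ purer _ v)
  (g := scons TV v)) => a b.
by rewrite !lcompE /= assocVE tmapE sconsE.
Qed.
Lemma cut0 x : cut 0 x = tone \ox x. Proof. by []. Qed.

Lemma tv_consE (W : lmodType k) (f g : {linear TV -> W}) :
  f tone = g tone -> (forall v x, f (tcons (v \ox x)) = g (tcons (v \ox x))) -> f = g.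
Proof. by move=> h0 h1; apply: tvE => //; apply: tensE => v x; apply: h1. Qed.
Lemma lift1_consE f v x : lift1 f (tcons (v \ox x)) = tcons (v \ox f x).
Proof. by rewrite [LHS]tvcase_consE lcompE tmapE. Qed.

(** Both sides cut a tensor after [p] and after [p + q] factors. *)
Lemma cut_coassoc p q : assoc TV TV TV ∘ tmap (cut p) (lid TV) ∘ cut (p + q) =
  tmap (lid TV) (cut q) ∘ cut p.
Proof.
elim: p => [|p IH].
  apply: linear_ext => x; rewrite add0n !lcompE [RHS]tmapE; move: (cut q x) => z.
  apply: (tens_app (f := assoc _ _ _ ∘ tmap (cut 0) (lid TV)) (g := purer _ tone)) => a b.
  by rewrite lcompE tmapE assocE.
apply: tv_consE => [|v x]; first by rewrite addSn !lcompE !cutS_one !linear0.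
rewrite addSn !lcompE !cutS_cons.
transitivity (scons _ v ((tmap (lid TV) (cut q) ∘ cut p) x)).
  rewrite -IH !lcompE; move: (cut (p + q) x) => z.
  apply: (tens_app (f := assoc _ _ _ ∘ tmap (cut p.+1) (lid TV) ∘ scons _ v)
    (g := scons _ v ∘ assoc TV TV TV ∘ tmap (cut p) (lid TV))) => a b.
  rewrite lcompE sconsE [RHS]lcompE lcompE !tmapE cutS_cons.
  move: (cut p a) => c.
  apply: (tens_app (f := assoc _ _ _ ∘ purel _ b ∘ scons _ v)
    (g := scons _ v ∘ assoc TV TV TV ∘ purel _ b)) => c1 c2.
  by rewrite !(lcompE, sconsE, purelE, assocE).
rewrite lcompE; move: (cut p x) => z.
apply: (tens_app (f := scons _ v ∘ tmap (lid TV) (cut q))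
  (g := tmap (lid TV) (cut q) ∘ scons _ v)) => a b.
by rewrite !lcompE !(tmapE, sconsE).
Qed.

Lemma cut_tin0 p : cut p ∘ tin p = purel TV tone ∘ tin p.
Proof.
elim: p => [|p IH].
  apply: linear_ext => c; rewrite !lcompE cut0 purelE tin0.
  by rewrite -[_ \ox (_ *: _)]/(purer TV tone _) -[(_ *: _) \ox _]/(purel TV tone _) !linearZ.
apply: tensE => v x; rewrite !lcompE purelE -tcons_tin cutS_cons -[cut p _]lcompE IH.
by rewrite lcompE purelE sconsE.
Qed.

Lemma cut_liftn p g : cut p ∘ liftn p g = tmap (lid TV) g ∘ cut p.
Proof.
elim: p => [|p IH]; first by apply: linear_ext => x; rewrite !lcompE [RHS]tmapE.
apply: tv_consE => [|v x]; first by rewrite !lcompE lift1_one cutS_one linear0.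
rewrite !lcompE lift1_consE !cutS_cons [cut p _](lin_app x IH) lcompE.
move: (cut p x) => z.
apply: (tens_app (f := scons _ v ∘ tmap (lid TV) g)
  (g := tmap (lid TV) g ∘ scons _ v)) => a b.
by rewrite !lcompE !(tmapE, sconsE).
Qed.

Section Sigma.
Variable sigma : {linear V ⊗ V -> V ⊗ V}.

(** [sigma] on the first two factors.  It is 0 in degree 1, where [sigma] does
    not act: the braid relation then holds on all of [TV], while a value 1 in
    that degree would break it in degree 2. *)
Definition op0 : {linear TV -> TV} :=
  tvcase tone (tuncurry (lflip (tvcase 0
    (lflip (tcurry (tcons ∘ tmap (lid V) tcons ∘ act2 sigma TV)))))).

Definition tcons2 : {linear V ⊗ V ⊗ TV -> TV} := tcons ∘ tmap (lid V) tcons.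
Lemma tcons2E v w x : tcons2 (v \ox w \ox x) = tcons (v \ox tcons (w \ox x)).
Proof. by rewrite lcompE tmapE. Qed.

Lemma op0_one : op0 tone = tone. Proof. exact: tvcase_one. Qed.
Lemma op0_cons_one v : op0 (tcons (v \ox tone)) = 0.
Proof. by rewrite [LHS]tvcase_consE tuncurryE lflipE tvcase_one. Qed.
Lemma op0_cons2 z : op0 (tcons2 z) = tcons2 (act2 sigma TV z).
Proof.
suff E : op0 ∘ tcons2 = tcons2 ∘ act2 sigma TV by exact: (lin_app z E).
apply: tens3E => v w x.
rewrite lcompE tcons2E [LHS]tvcase_consE tuncurryE lflipE tvcase_consE.
by rewrite lflipE tcurryE.
Qed.

Lemma tv_cons2E (W : lmodType k) (f g : {linear TV -> W}) :
  f tone = g tone ->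
  (forall v, f (tcons (v \ox tone)) = g (tcons (v \ox tone))) ->
  (forall z, f (tcons2 z) = g (tcons2 z)) -> f = g.
Proof.
move=> h0 h1 h2; apply: tvE => //.
suff E : lflip (tcurry (f ∘ tcons)) = lflip (tcurry (g ∘ tcons)).
  by apply: tensE => v x; rewrite -(tcurryE (f ∘ tcons)) -(lflipE _ _ x) E.
apply: tv_consE => [|w x]; apply: linear_ext => v; rewrite !lflipE !tcurryE !lcompE //.
by have := h2 (v \ox w \ox x); rewrite tcons2E.
Qed.

Lemma lift2_cons2 f z : lift1 (lift1 f) (tcons2 z) = tcons2 (tmap (lid V) (tmap (lid V) f) z).
Proof.
apply: (tens_app (f := lift1 (lift1 f) ∘ tcons2)
  (g := tcons2 ∘ tmap (lid V) (tmap (lid V) f))) => v t.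
apply: (tens_app (f := lift1 (lift1 f) ∘ tcons2 ∘ purer _ v)
  (g := tcons2 ∘ tmap (lid V) (tmap (lid V) f) ∘ purer _ v)) => w x.
by rewrite !(lcompE, purerE, tmapE, lift1_consE).
Qed.

Lemma op0_lift2 h : op0 ∘ lift1 (lift1 h) = lift1 (lift1 h) ∘ op0.
Proof.
apply: tv_cons2E => [|v|z]; rewrite lcompE [RHS]lcompE.
- by rewrite op0_one !lift1_one op0_one.
- by rewrite op0_cons_one linear0 lift1_consE lift1_one op0_cons_one.
- by rewrite op0_cons2 !lift2_cons2 op0_cons2; congr (tcons2 _); apply: (lin_app z (act2_nat _ _)).
Qed.

Hypothesis sigma_braid : is_braiding sigma.

Let assoc3 (X : lmodType k) : {linear (V ⊗ V ⊗ V) ⊗ X -> V ⊗ V ⊗ V ⊗ X} :=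
  tmap (lid V) (assoc V V X) ∘ assoc V (V ⊗ V) X.
Let assoc3E (X : lmodType k) a b c (x : X) : assoc3 X ((a \ox b \ox c) \ox x) = a \ox b \ox c \ox x.
Proof. by rewrite lcompE assocE tmapE assocE. Qed.
Let assoc3_s1 (X : lmodType k) z : act2 sigma (V ⊗ X) (assoc3 X z) =
  assoc3 X (tmap (act2 sigma V) (lid X) z).
Proof.
apply: (tens_app (f := act2 sigma (V ⊗ X) ∘ assoc3 X)
  (g := assoc3 X ∘ tmap (act2 sigma V) (lid X))) => t x.
apply: (lin_app t (f := act2 sigma (V ⊗ X) ∘ assoc3 X ∘ purel _ x)
  (g := assoc3 X ∘ tmap (act2 sigma V) (lid X) ∘ purel _ x)).
apply: tens3E => a b c; rewrite [LHS]lcompE [RHS]lcompE [purel _ _ _]/=.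
rewrite lcompE [RHS]lcompE assoc3E tmapE !act2E.
move: (sigma _) => u.
apply: (tens_app (f := assoc V V (V ⊗ X) ∘ purel _ (c \ox x))
  (g := assoc3 X ∘ purel _ x ∘ assoc V V V ∘ purel _ c)) => d e.
by rewrite !(lcompE, purelE) !assocE tmapE assocE.
Qed.
Let assoc3_s2 (X : lmodType k) z : tmap (lid V) (act2 sigma X) (assoc3 X z) =
  assoc3 X (tmap (tmap (lid V) sigma) (lid X) z).
Proof.
apply: (tens_app (f := tmap (lid V) (act2 sigma X) ∘ assoc3 X)
  (g := assoc3 X ∘ tmap (tmap (lid V) sigma) (lid X))) => t x.
apply: (lin_app t (f := tmap (lid V) (act2 sigma X) ∘ assoc3 X ∘ purel _ x)
  (g := assoc3 X ∘ tmap (tmap (lid V) sigma) (lid X) ∘ purel _ x)).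
apply: tens3E => a b c; rewrite [LHS]lcompE [RHS]lcompE [purel _ _ _]/=.
rewrite lcompE [RHS]lcompE assoc3E !tmapE act2E.
move: (sigma _) => u.
apply: (tens_app (f := purer _ a ∘ assoc V V X ∘ purel _ x)
  (g := assoc3 X ∘ purel _ x ∘ purer _ a)) => d e.
by rewrite !(lcompE, purelE, purerE) !assocE tmapE assocE.
Qed.

(** The braid relation with a spectator [X], by transport along [assoc3]. *)
Lemma act2_braid (X : lmodType k) (s1 := act2 sigma (V ⊗ X))
  (s2 := tmap (lid V) (act2 sigma X)) : s1 ∘ s2 ∘ s1 = s2 ∘ s1 ∘ s2.
Proof.
apply: tens3E => a b t.
apply: (tens_app (f := s1 ∘ s2 ∘ s1 ∘ purer _ a ∘ purer _ b)
  (g := s2 ∘ s1 ∘ s2 ∘ purer _ a ∘ purer _ b)) => c x.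
have A1 z : s1 (assoc3 X z) = assoc3 X (tmap (act2 sigma V) (lid X) z).
  exact: assoc3_s1.
have A2 z : s2 (assoc3 X z) = assoc3 X (tmap (tmap (lid V) sigma) (lid X) z).
  exact: assoc3_s2.
change (s1 (s2 (s1 (a \ox b \ox c \ox x))) = s2 (s1 (s2 (a \ox b \ox c \ox x)))).
rewrite -assoc3E A1 A2 A1 A2 A1 A2 !tmapE; congr (assoc3 X (_ \ox _)).
by have := sigma_braid (a \ox b \ox c); rewrite !lcompE tmapE.
Qed.

Definition tcons3 : {linear V ⊗ V ⊗ V ⊗ TV -> TV} := tcons ∘ tmap (lid V) tcons2.
Lemma tcons3E z : tcons3 z = tcons2 (tmap (lid V) (tmap (lid V) tcons) z).
Proof. by rewrite !lcompE; congr (tcons _); rewrite -[RHS]lcompE -tmap_comp lcomp1f. Qed.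

Lemma tv_cons3E (W : lmodType k) (f g : {linear TV -> W}) :
  f tone = g tone ->
  (forall v, f (tcons (v \ox tone)) = g (tcons (v \ox tone))) ->
  (forall z : V ⊗ V, f (tcons2 (tmap (lid V) (purel V tone) z)) =
     g (tcons2 (tmap (lid V) (purel V tone) z))) ->
  (forall z, f (tcons3 z) = g (tcons3 z)) -> f = g.
Proof.
move=> h0 h1 h2 h3; apply: tv_cons2E => // z.
apply: (tens_app (f := f ∘ tcons2) (g := g ∘ tcons2)) => v t.
apply: (tens_app (f := f ∘ tcons2 ∘ purer _ v) (g := g ∘ tcons2 ∘ purer _ v)) => w x.
apply: (lin_app x (f := f ∘ tcons2 ∘ purer _ v ∘ purer _ w)
  (g := g ∘ tcons2 ∘ purer _ v ∘ purer _ w)).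
apply: tv_consE => [|u y].
  by have := h2 (v \ox w); rewrite !tmapE.
by have := h3 (v \ox w \ox u \ox y); rewrite tcons3E !tmapE.
Qed.

Lemma op0_cons3 z : op0 (tcons3 z) = tcons3 (act2 sigma (V ⊗ TV) z).
Proof. by rewrite !tcons3E op0_cons2; congr (tcons2 _); apply: (lin_app z (act2_nat _ _)). Qed.
Lemma op1_cons3 z : lift1 op0 (tcons3 z) = tcons3 (tmap (lid V) (act2 sigma TV) z).
Proof.
apply: (tens_app (f := lift1 op0 ∘ tcons3)
  (g := tcons3 ∘ tmap (lid V) (act2 sigma TV))) => v t.
have tE w u : tcons3 (w \ox u) = tcons (w \ox tcons2 u) by rewrite lcompE tmapE.
by rewrite lcompE [RHS]lcompE tmapE !tE lift1_consE op0_cons2.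
Qed.

Lemma op0_cons2_one z : op0 (tcons2 (tmap (lid V) (purel V tone) z)) =
  tcons2 (tmap (lid V) (purel V tone) (sigma z)).
Proof.
rewrite op0_cons2; congr (tcons2 _).
apply: (tens_app (f := act2 sigma TV ∘ tmap (lid V) (purel V tone))
  (g := tmap (lid V) (purel V tone) ∘ sigma)) => v w.
rewrite lcompE [RHS]lcompE tmapE act2E; move: (sigma _) => u.
apply: (tens_app (f := assoc V V TV ∘ purel _ tone) (g := tmap _ (purel V tone))) => a b.
by rewrite lcompE assocE tmapE.
Qed.
Lemma op1_cons2_one z : lift1 op0 (tcons2 (tmap (lid V) (purel V tone) z)) = 0.
Proof.
apply: (tens_app (f := lift1 op0 ∘ tcons2 ∘ tmap (lid V) (purel V tone)) (g := 0)) => v w.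
by rewrite !(lcompE, tmapE, lift1_consE) op0_cons_one pure0r linear0.
Qed.

(** In degree 0 both sides are the identity and in degrees 1 and 2 both vanish;
    from degree 3 on this is [act2_braid]. *)
Lemma op0_braid :
  op0 ∘ lift1 op0 ∘ op0 = lift1 op0 ∘ op0 ∘ lift1 op0.
Proof.
apply: tv_cons3E => [|v|z|z]; rewrite !lcompE.
- by rewrite !(op0_one, lift1_one).
- by rewrite op0_cons_one !linear0 lift1_consE op0_one op0_cons_one linear0.
- by rewrite op0_cons2_one !op1_cons2_one !linear0.
- rewrite !(op0_cons3, op1_cons3); congr (tcons3 _).
  exact: (lin_app z (act2_braid TV)).
Qed.

Fixpoint pass n : {linear TV -> TV} := if n is n'.+1 then lift1 (pass n') ∘ op0 else lid TV.
Arguments pass : simpl never.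
Lemma pass0 : pass 0 = lid TV. Proof. by []. Qed.
Lemma passS n : pass n.+1 = lift1 (pass n) ∘ op0. Proof. by []. Qed.

(** The braid that moves the strands colored [true] to the left of those colored
    [false], keeping the order within each color *)
Fixpoint unshuffle (b : bitseq) : {linear TV -> TV} :=
  match b with
  | [::] => lid TV
  | true :: b' => lift1 (unshuffle b')
  | false :: b' => pass (count id b') ∘ lift1 (unshuffle b')
  end.
(** Exchanging two blocks of strands is an instance of unshuffling, so that the
    braiding of [AT V] and the coproduct obey the same rules. *)
Definition block_swap m n := unshuffle (nseq m false ++ nseq n true).

Lemma unshuffle_true n : unshuffle (nseq n true) = lid TV.
Proof. by elim: n => //= n ->; rewrite lift1_id. Qed.
Lemma unshuffle_false n : unshuffle (nseq n false) = lid TV.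
Proof. by elim: n => //= n ->; rewrite lift1_id count_nseq mul0n lcomp1f. Qed.
Lemma block_swap0 n : block_swap 0 n = lid TV. Proof. exact: unshuffle_true. Qed.
Lemma block_swapS m n : block_swap m.+1 n = pass n ∘ lift1 (block_swap m n).
Proof. by rewrite /block_swap /= count_cat !count_nseq /= mul0n mul1n. Qed.

(** The operators given by positive braids on the first [n] strands.  The
    naturality of cutting and of exchanging blocks is proved by induction on it. *)
Inductive strands : nat -> {linear TV -> TV} -> Prop :=
| strands_id n : strands n (lid TV)
| strands_op0 n : strands n.+2 op0
| strands_lift n f : strands n f -> strands n.+1 (lift1 f)
| strands_comp n f g : strands n f -> strands n g -> strands n (f ∘ g).

Lemma strands_pass m n : (m < n)%N -> strands n (pass m).
Proof.
elim: m n => [|m IH] [|n] //; first by constructor.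
rewrite ltnS => mn; apply: strands_comp; first by apply/strands_lift/IH.
by case: n mn => // n _; constructor.
Qed.
Lemma strands_unshuffle b n : (size b <= n)%N -> strands n (unshuffle b).
Proof.
elim: b n => [|[] b IH] [|n] //=; try by constructor.
  by rewrite ltnS => bn; apply/strands_lift/IH.
rewrite ltnS => bn; apply: strands_comp; last by apply/strands_lift/IH.
by apply: strands_pass; have := count_size id b; lia.
Qed.
Lemma strands_block_swap m n : strands (m + n) (block_swap m n).
Proof. by apply: strands_unshuffle; rewrite size_cat !size_nseq. Qed.

Let scons2 : {linear V ⊗ V ⊗ TV ⊗ TV -> TV ⊗ TV} :=
  tmap tcons2 (lid TV) ∘ assocV V (V ⊗ TV) TV ∘ tmap (lid V) (assocV V TV TV).
Let scons2E v w a b : scons2 (v \ox w \ox a \ox b) = tcons2 (v \ox w \ox a) \ox b.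
Proof. by rewrite lcompE tmapE lcompE !assocVE tmapE. Qed.
Let cut_cons2 p z : cut p.+2 (tcons2 z) = scons2 (tmap (lid V) (tmap (lid V) (cut p)) z).
Proof.
apply: (lin_app z (f := cut p.+2 ∘ tcons2)
  (g := scons2 ∘ tmap (lid V) (tmap (lid V) (cut p)))).
apply: tens3E => v w x; rewrite lcompE [RHS]lcompE !tmapE tcons2E !cutS_cons.
move: (cut p x) => y.
apply: (tens_app (f := scons TV v ∘ scons TV w) (g := scons2 ∘ purer _ v ∘ purer _ w)) => a b.
by rewrite lcompE !sconsE [RHS]lcompE purerE lcompE purerE scons2E tcons2E.
Qed.
Let scons2_act z : scons2 (act2 sigma (TV ⊗ TV) z) = tmap op0 (lid TV) (scons2 z).
Proof.
apply: (lin_app z (f := scons2 ∘ act2 sigma (TV ⊗ TV)) (g := tmap op0 (lid TV) ∘ scons2)).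
apply: tens3E => v w y.
apply: (tens_app (f := scons2 ∘ act2 sigma (TV ⊗ TV) ∘ purer _ v ∘ purer _ w)
  (g := tmap op0 (lid TV) ∘ scons2 ∘ purer _ v ∘ purer _ w)) => a b.
rewrite 2!lcompE [RHS]lcompE [RHS]lcompE !purerE lcompE [RHS]lcompE.
rewrite act2E scons2E tmapE op0_cons2 act2E; move: (sigma _) => u.
apply: (tens_app (f := scons2 ∘ assoc V V (TV ⊗ TV) ∘ purel _ (a \ox b))
  (g := purel _ b ∘ tcons2 ∘ assoc V V TV ∘ purel _ a)) => c d.
rewrite lcompE purelE lcompE [RHS]lcompE purelE [RHS]lcompE !assocE.
by rewrite scons2E.
Qed.

(** What lies behind the first [p] factors is a spectator. *)
Lemma cut_strands p f : strands p f -> cut p ∘ f = tmap f (lid TV) ∘ cut p.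
Proof.
elim=> {p f} [p|p|p f _ IH|p f g _ IHf _ IHg].
- by rewrite lcompf1 tmap_id lcomp1f.
- apply: tv_cons2E => [|v|z].
  + by rewrite !lcompE op0_one !cutS_one linear0.
  + by rewrite !lcompE op0_cons_one linear0 !cutS_cons cutS_one !linear0.
  rewrite lcompE [RHS]lcompE op0_cons2 !cut_cons2 -scons2_act; congr (scons2 _).
  by symmetry; apply: (lin_app z (act2_nat _ _)).
- apply: tv_consE => [|v x]; rewrite lcompE [RHS]lcompE.
    by rewrite lift1_one cutS_one linear0.
  rewrite lift1_consE !cutS_cons [cut p _](lin_app x IH) lcompE.
  move: (cut p x) => y.
  apply: (tens_app (f := scons TV v ∘ tmap f (lid TV))
    (g := tmap (lift1 f) (lid TV) ∘ scons TV v)) => a b.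
  by rewrite lcompE [RHS]lcompE !(tmapE, sconsE) lift1_consE.
- by rewrite lcompA IHf -lcompA IHg lcompA -tmap_comp lcomp1f.
Qed.

Lemma strands_liftnC p f g : strands p f -> f ∘ liftn p g = liftn p g ∘ f.
Proof.
move=> h; elim: h => {p f} [p|p|p f _ IH|p f f' _ IHf _ IHf'].
- by rewrite lcompf1 lcomp1f.
- exact: op0_lift2.
- by rewrite /= -!lift1_comp IH.
- by rewrite -lcompA IHf' lcompA IHf lcompA.
Qed.

Lemma strands_deg p f n : strands p f ->
  exists g : {linear tpow V n -> tpow V n}, f ∘ tin n = tin n ∘ g.
Proof.
move=> h; elim: h n => {p f} [p|p|p f _ IH|p f g _ IHf _ IHg] n.
- by exists (lid _); rewrite lcomp1f lcompf1.
- case: n => [|[|n]].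
  + exists (lid _); apply: linear_ext => c; rewrite !lcompE tin0 !linearZ op0_one /=.
    by rewrite -tin0.
  + exists 0; rewrite lcompf0; apply: tensE => v c.
    rewrite lcompE -tcons_tin tin0 hom0E.
    rewrite -[v \ox _]/(purer TV v _) !linearZ /= op0_cons_one.
    by rewrite scaler0.
  exists (act2 sigma (tpow V n)).
  have -> : tin n.+2 = tcons2 ∘ tmap (lid V) (tmap (lid V) (tin n)).
    by rewrite -lcompA -tmap_comp lcomp1f tcons_in (tcons_in n.+1).
  rewrite -[RHS]lcompA -(act2_nat sigma (tin n)) !lcompA; congr (_ ∘ _).
  exact/linear_ext/op0_cons2.
- case: n => [|n].
    exists (lid _); apply: linear_ext => c; rewrite !lcompE tin0 !linearZ lift1_one /=.
    by rewrite -tin0.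
  have [g E] := IH n; exists (tmap (lid V) g).
  by rewrite -tcons_in lcompA lift1_cons -!lcompA -!tmap_comp E.
- have [f' Ef] := IHf n; have [g' Eg] := IHg n; exists (f' ∘ g').
  by rewrite -lcompA Eg lcompA Ef lcompA.
Qed.

Lemma pass_liftn n g : pass n ∘ liftn n.+1 g = liftn n.+1 g ∘ pass n.
Proof.
elim: n => [|n IH]; first by rewrite lcompf1 lcomp1f.
rewrite passS -lcompA op0_lift2 lcompA -lift1_comp IH lift1_comp.
by rewrite -lcompA.
Qed.

(** A strand passing over [n] strands passes over any braid of these: this is
    where the braid relation enters. *)
Lemma pass_strands n f : strands n f -> pass n ∘ lift1 f = f ∘ pass n.
Proof.
elim=> {n f} [n|n|n f _ IH|n f g _ IHf _ IHg].
- by rewrite lift1_id lcompf1 lcomp1f.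
- rewrite !passS !lift1_comp -!lcompA [lift1 op0 ∘ _]lcompA -op0_braid.
  by rewrite !lcompA op0_lift2.
- by rewrite passS -lcompA op0_lift2 lcompA -lift1_comp IH lift1_comp lcompA.
- by rewrite lift1_comp lcompA IHf -lcompA IHg lcompA.
Qed.

Lemma passD m n : pass (m + n) = liftn m (pass n) ∘ pass m.
Proof.
elim: m => [|m IH]; first by rewrite lcompf1.
by rewrite addSn !passS IH lift1_comp lcompA.
Qed.

(** Naturality of the exchange of blocks in either block; [pass2_op0] is the case
    of a single crossing of two strands passing over [n] others. *)
Lemma block_swap_right m n g : strands n g -> block_swap m n ∘ liftn m g = g ∘ block_swap m n.
Proof.
move=> h; elim: m => [|m IH]; first by rewrite block_swap0 lcompf1 lcomp1f.
by rewrite block_swapS -lcompA -lift1_comp IH lift1_comp lcompA pass_strands // lcompA.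
Qed.

Lemma pass2_op0 n : pass n ∘ lift1 (pass n) ∘ op0 = liftn n op0 ∘ (pass n ∘ lift1 (pass n)).
Proof.
elim: n => [|n IH]; first by rewrite pass0 lift1_id !lcomp1f !lcompf1.
have E : pass n.+1 ∘ lift1 (pass n.+1) = lift1 (pass n ∘ lift1 (pass n)) ∘ (op0 ∘ lift1 op0).
  by rewrite !passS !lift1_comp -!lcompA; congr (_ ∘ _); rewrite !lcompA op0_lift2.
rewrite E; move: IH; set M := pass n ∘ _ => IH.
rewrite -[LHS]lcompA op0_braid -[lift1 op0 ∘ op0 ∘ _]lcompA [LHS]lcompA -lift1_comp.
by rewrite IH lift1_comp !lcompA.
Qed.

Lemma block_swap_left m n f : strands m f -> block_swap m n ∘ f = liftn n f ∘ block_swap m n.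
Proof.
elim=> {m f} [m|m|m f _ IH|m f g _ IHf _ IHg].
- by rewrite liftn_id lcompf1 lcomp1f.
- rewrite !block_swapS lift1_comp -!lcompA -op0_lift2 !lcompA.
  by rewrite pass2_op0 !lcompA.
- rewrite block_swapS -lcompA -lift1_comp IH lift1_comp lcompA.
  by rewrite -[lift1 (liftn n f)]/(liftn n.+1 f) pass_liftn liftnSr lcompA.
- by rewrite lcompA IHf -lcompA IHg lcompA liftn_comp.
Qed.

(** To unshuffle a concatenation, unshuffle each half and exchange the two middle
    blocks; this is what makes the coproduct multiplicative.  Only crossings that
    are far apart have to commute. *)
Lemma unshuffle_cat b b' : unshuffle (b ++ b') =
  liftn (count id b) (block_swap (count negb b) (count id b'))
  ∘ unshuffle b ∘ liftn (size b) (unshuffle b').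
Proof.
elim: b => [|[] b IH] /=; first by rewrite block_swap0 !lcomp1f.
  by rewrite IH !lift1_comp.
rewrite count_cat IH passD !lift1_comp block_swapS liftn_comp !add0n -!lcompA; congr (_ ∘ _).
by rewrite !lcompA -[lift1 (liftn _ _)]/(liftn _.+1 _) pass_liftn liftnSr.
Qed.

(** The hexagon identities *)
Lemma block_swap_addl m n p : block_swap (m + n) p = block_swap m p ∘ liftn m (block_swap n p).
Proof.
elim: m => [|m IH]; first by rewrite block_swap0 lcomp1f.
by rewrite addSn !block_swapS IH lift1_comp lcompA.
Qed.

Lemma block_swap_addr m n p : block_swap m (n + p) = liftn n (block_swap m p) ∘ block_swap m n.
Proof.
rewrite {1}/block_swap nseqD catA unshuffle_cat -/(block_swap m n) unshuffle_true liftn_id lcompf1.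
by rewrite !count_cat !count_nseq /= !mul0n !mul1n addn0 add0n.
Qed.

(** Sorting three colors [0], [1], [2] by first separating [2] from the others,
    or by first separating [0], gives the same braid; this is what makes the
    coproduct coassociative. *)
Lemma unshuffle3 (c : seq nat) :
  unshuffle [seq x == 0%N | x <- c & (x < 2)%N] ∘ unshuffle [seq (x < 2)%N | x <- c] =
  liftn (count (pred1 0%N) c) (unshuffle [seq (x < 2)%N | x <- c & x != 0%N])
  ∘ unshuffle [seq x == 0%N | x <- c].
Proof.
elim: c => [|x c IH]; first by rewrite lcompf1.
have n0 : count id [seq y == 0%N | y <- c] = count (pred1 0%N) c by rewrite count_map.
have n0' : count id [seq y == 0%N | y <- c & (y < 2)%N] = count (pred1 0%N) c.
  by rewrite count_map count_filter; apply: eq_count => -[].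
have n01 : count id [seq (y < 2)%N | y <- c] =
    (count (pred1 0%N) c + count id [seq (y < 2)%N | y <- c & y != 0%N])%N.
  by rewrite !count_map count_filter; elim: (c) => //= -[|[|y]] c'' /=; lia.
case: x => [|[|x]] /=.
- by rewrite -!lift1_comp IH.
- rewrite n0 n0' -lcompA -lift1_comp IH lift1_comp add0n.
  rewrite -[lift1 (liftn _ _)]/(liftn _.+1 _) lcompA pass_liftn lcompA.
  by rewrite liftnSr.
- rewrite n0 n01 add0n lcompA -pass_strands; last first.
    apply: strands_unshuffle; rewrite size_map size_filter -n01 count_map.
    exact: leqnn.
  rewrite -lcompA -lift1_comp IH lift1_comp passD liftn_comp -!lcompA; congr (_ ∘ _).
  by rewrite !lcompA -[lift1 (liftn _ _)]/(liftn _.+1 _) pass_liftn liftnSr.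
Qed.

Lemma mergel_fst b b' : size b' = count id b -> [seq (x < 2)%N | x <- mergel b b'] = b.
Proof.
elim: b b' => [|[] b IH] b' //=; last by rewrite add0n => /IH ->.
by case: b' => [|x b'] //= [/IH ->]; case: x.
Qed.
Lemma mergel_snd b b' : size b' = count id b ->
  [seq x == 0%N | x <- mergel b b' & (x < 2)%N] = b'.
Proof.
elim: b b' => [|[] b IH] b' /=; first by case: b'.
  by case: b' => [|x b'] //= [/IH]; case: x => /= ->.
by rewrite add0n => /IH ->.
Qed.
Lemma merger_fst b b' : size b' = count negb b -> [seq x == 0%N | x <- merger b b'] = b.
Proof.
elim: b b' => [|[] b IH] b' //=; first by rewrite add0n => /IH ->.
by case: b' => [|x b'] //= [/IH ->]; case: x.
Qed.
Lemma merger_snd b b' : size b' = count negb b ->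
  [seq (x < 2)%N | x <- merger b b' & x != 0%N] = b'.
Proof.
elim: b b' => [|[] b IH] b' /=; first by case: b'.
  by rewrite add0n => /IH ->.
by case: b' => [|x b'] //= [/IH]; case: x => /= ->.
Qed.

(** The common value of both sides of [unshuffle3] *)
Definition unshuffle_col (c : seq nat) :=
  unshuffle [seq x == 0%N | x <- c & (x < 2)%N] ∘ unshuffle [seq (x < 2)%N | x <- c].
Lemma unshuffle_mergel b b' : size b' = count id b ->
  unshuffle b' ∘ unshuffle b = unshuffle_col (mergel b b').
Proof. by move=> h; rewrite /unshuffle_col mergel_fst // mergel_snd. Qed.
Lemma unshuffle_merger b b' : size b' = count negb b ->
  liftn (count id b) (unshuffle b') ∘ unshuffle b = unshuffle_col (merger b b').
Proof.
move=> h; rewrite /unshuffle_col unshuffle3 merger_fst // merger_snd //; congr (liftn _ _ ∘ _).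
by rewrite -{1}(merger_fst h) count_map; apply: eq_count => x /=.
Qed.

(** The crossing at position [a]; in range it agrees with [braid_at]. *)
Fixpoint op a : {linear TV -> TV} := if a is a'.+1 then lift1 (op a') else op0.
Definition bw (w : seq nat) : {linear TV -> TV} :=
  foldr (fun a f => op a ∘ f) (lid TV) w.
Lemma bw_cat w w' : bw (w ++ w') = bw w ∘ bw w'.
Proof. by elim: w => [|a w IH] /=; rewrite ?lcomp1f // IH lcompA. Qed.
Lemma bw_map w : bw (map S w) = lift1 (bw w).
Proof. by elim: w => [|a w IH] /=; rewrite ?lift1_id // IH lift1_comp. Qed.
Lemma bw_pass n : bw (rev (iota 0 n)) = pass n.
Proof.
elim: n => // n IH; rewrite passS /= (iotaDl 1 0 n) rev_cons -map_rev -cats1 bw_cat bw_map IH.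
by rewrite /= lcompf1.
Qed.
(** The word for the exchange of two blocks lists the passages of the strands of
    the first block, in the order of the recursion of [block_swap]. *)
Lemma bw_chi m n : bw (chi_word m n) = block_swap m n.
Proof.
elim: m => [|m IH]; first by rewrite block_swap0.
rewrite block_swapS -IH -bw_map -bw_pass -bw_cat /chi_word /=.
congr (bw (_ ++ _)); rewrite map_flatten -!map_comp (iotaDl 1 0 m) -map_comp.
congr flatten; apply: eq_map => a /=.
by rewrite map_rev (iotaDl 1 a n).
Qed.

Lemma op0_tin n : op0 ∘ tin n.+2 = tin n.+2 ∘ act2 sigma (tpow V n).
Proof.
have -> : tin n.+2 = tcons2 ∘ tmap (lid V) (tmap (lid V) (tin n)).
  by rewrite -lcompA -tmap_comp lcomp1f tcons_in (tcons_in n.+1).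
rewrite -[RHS]lcompA -(act2_nat sigma (tin n)) !lcompA; congr (_ ∘ _).
exact/linear_ext/op0_cons2.
Qed.
Lemma op_tin a n : (a.+1 < n)%N -> op a ∘ tin n = tin n ∘ braid_at sigma a n.
Proof.
elim: a n => [|a IH] [|[|n]] // an; first exact: op0_tin.
rewrite -[op a.+1]/(lift1 (op a)) -[tin n.+2](tcons_in n.+1).
rewrite lcompA lift1_cons -lcompA -tmap_comp (IH n.+1 an) -[RHS]lcompA -tmap_comp.
by rewrite lcomp1f.
Qed.
Lemma bw_tin w n : all (fun a => a.+1 < n)%N w -> bw w ∘ tin n = tin n ∘ braid_word sigma w n.
Proof.
elim: w => [|a w IH] /=; first by rewrite lcomp1f lcompf1.
by move=> /andP [an wn]; rewrite -lcompA IH // lcompA op_tin // lcompA.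
Qed.
Lemma beta_tin m n : tin (m + n) ∘ beta sigma m n = block_swap m n ∘ tin (m + n).
Proof.
rewrite -bw_chi bw_tin //; apply/allP => a /flattenP [? /mapP [i +]] -> .
by rewrite mem_iota mem_rev mem_iota; lia.
Qed.
End Sigma.

Lemma cut_tin m n : cut m ∘ tin (m + n) = tmap (tin m) (tin n) ∘ tsplit V m n.
Proof.
elim: m => [|m IH]; first by apply: linear_ext => x; rewrite !lcompE cut0 /= tmapE.
apply: tensE => v x; rewrite lcompE -[tin _ _]tcons_tin cutS_cons.
rewrite -[cut m _]lcompE IH !lcompE tmapE; move: (tsplit V m n x) => y.
apply: (tens_app (f := scons TV v ∘ tmap (tin m) (tin n))
  (g := tmap (tin m.+1) (tin n) ∘ assocV V (tpow V m) (tpow V n) ∘ purer _ v)) => a b.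
by rewrite lcompE tmapE sconsE !lcompE purerE assocVE tmapE tcons_tin.
Qed.

Lemma tsplitS m n v x : tsplit V m.+1 n (v \ox x) =
  assocV V (tpow V m) (tpow V n) (v \ox tsplit V m n x).
Proof. by rewrite lcompE tmapE. Qed.
Lemma tcatS m n v a b : tcat V m.+1 n ((v \ox a) \ox b) = v \ox tcat V m n (a \ox b).
Proof. by rewrite lcompE assocE tmapE. Qed.
Lemma tcat0 n c x : tcat V 0 n ((c : k^o) \ox x) = c *: x.
Proof. exact: lunitE. Qed.

Lemma tcatK m n : tcat V m n ∘ tsplit V m n = lid _.
Proof.
elim: m => [|m IH]; first by apply: linear_ext => x; rewrite lcompE tcat0 scale1r.
apply: tensE => v x; rewrite lcompE tsplitS.
have E := lin_app x IH; rewrite -[RHS]/(v \ox (lid _ x)) -E [X in _ = _ \ox X]lcompE.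
move: (tsplit V m n x) => y.
pose c : {linear tpow V m.+1 ⊗ tpow V n -> V ⊗ tpow V (m + n)} := tcat V m.+1 n.
apply: (tens_app (f := c ∘ assocV V (tpow V m) (tpow V n) ∘ purer _ v)
  (g := purer _ v ∘ tcat V m n)) => a b.
by rewrite lcompE [RHS]lcompE !purerE lcompE assocVE [LHS]tcatS.
Qed.
Lemma tsplitK m n : tsplit V m n ∘ tcat V m n = lid _.
Proof.
elim: m => [|m IH].
  apply: tensE => c x; rewrite lcompE tcat0 linearZ.
  have E : c = c *: (1 : k^o) by exact: esym (mulr1 c).
  transitivity (purel (tpow V 0) x (c *: (1 : k^o))); last by rewrite -E.
  by rewrite linearZ.
apply: tens3lE => v a b; rewrite lcompE tcatS tsplitS -[tsplit _ _ _ _]lcompE IH.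
exact: assocVE.
Qed.
End BraidCalculus.

(** * Maps out of the tensor algebra, side by side *)

Section Dtens.
Variables (k : fieldType) (V : lmodType k).
Implicit Types X Y Z W : lmodType k.

(** [D] acts on the first [p] factors and [E] on the others.  The body is locked
    because it is itself a composition: otherwise reassociating compositions by
    rewriting would take it apart. *)
Definition dtens X Y p (D : {linear TV V -> X}) (E : {linear TV V -> Y}) :
  {linear TV V -> X ⊗ Y} := locked (tmap D E ∘ cut V p).
Lemma dtensE X Y p (D : {linear TV V -> X}) (E : {linear TV V -> Y}) :
  dtens p D E = tmap D E ∘ cut V p.
Proof. by rewrite /dtens -lock. Qed.

Lemma tmap_dtens X Y X' Y' p (D : {linear TV V -> X}) (E : {linear TV V -> Y})
    (f : {linear X -> X'}) (g : {linear Y -> Y'}) :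
  tmap f g ∘ dtens p D E = dtens p (f ∘ D) (g ∘ E).
Proof. by rewrite !dtensE lcompA -tmap_comp. Qed.

Lemma dtens_left (sigma : {linear V ⊗ V -> V ⊗ V}) X Y p (D : {linear TV V -> X})
    (E : {linear TV V -> Y}) f : strands sigma p f ->
  dtens p (D ∘ f) E = dtens p D E ∘ f.
Proof.
by move=> h; rewrite !dtensE -lcompA (cut_strands h) lcompA -tmap_comp lcompf1.
Qed.
Lemma dtens_right X Y p (D : {linear TV V -> X}) (E : {linear TV V -> Y}) f :
  dtens p D (E ∘ f) = dtens p D E ∘ liftn p f.
Proof. by rewrite !dtensE -lcompA cut_liftn lcompA -tmap_comp lcompf1. Qed.

Lemma dtensA X Y Z p q (D : {linear TV V -> X}) (E : {linear TV V -> Y})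
    (F : {linear TV V -> Z}) :
  assoc X Y Z ∘ dtens (p + q) (dtens p D E) F = dtens p D (dtens q E F).
Proof.
rewrite !dtensE -{1}[F]lcompf1 tmap_comp !lcompA assoc_nat.
rewrite -[LHS]lcompA -[LHS]lcompA [assoc _ _ _ ∘ _]lcompA cut_coassoc.
by rewrite lcompA -tmap_comp lcompf1.
Qed.
Lemma dtensAV X Y Z p q (D : {linear TV V -> X}) (E : {linear TV V -> Y})
    (F : {linear TV V -> Z}) :
  assocV X Y Z ∘ dtens p D (dtens q E F) = dtens (p + q) (dtens p D E) F.
Proof. by rewrite -dtensA lcompA assocK lcomp1f. Qed.

Lemma dtens_suml X Y p (I : Type) (s : seq I) (F : I -> {linear TV V -> X})
    (E : {linear TV V -> Y}) :
  dtens p (\sum_(i <- s) F i) E = \sum_(i <- s) dtens p (F i) E.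
Proof.
rewrite dtensE tmap_suml lcomp_suml.
by apply: eq_bigr => i _; rewrite dtensE.
Qed.
Lemma dtens_sumr X Y p (I : Type) (s : seq I) (F : I -> {linear TV V -> Y})
    (D : {linear TV V -> X}) :
  dtens p D (\sum_(i <- s) F i) = \sum_(i <- s) dtens p D (F i).
Proof.
rewrite dtensE tmap_sumr lcomp_suml.
by apply: eq_bigr => i _; rewrite dtensE.
Qed.

Lemma dtens0l X Y p (E : {linear TV V -> Y}) : dtens p (0 : {linear TV V -> X}) E = 0.
Proof. by rewrite dtensE tmap0l lcomp0f. Qed.
Lemma dtens0r X Y p (E : {linear TV V -> Y}) : dtens p E (0 : {linear TV V -> X}) = 0.
Proof. by rewrite dtensE tmap0r lcomp0f. Qed.

Lemma act2_dtens X Y X' Y' Z p q (D : {linear TV V -> X}) (E : {linear TV V -> Y})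
    (F : {linear TV V -> Z}) (f : {linear X ⊗ Y -> X' ⊗ Y'}) :
  act2 f Z ∘ dtens p D (dtens q E F) =
  assoc X' Y' Z ∘ dtens (p + q) (f ∘ dtens p D E) F.
Proof. by rewrite /act2 -lcompA dtensAV -lcompA tmap_dtens lcomp1f. Qed.
Lemma mul2_dtens X Y X' Z p q (D : {linear TV V -> X}) (E : {linear TV V -> Y})
    (F : {linear TV V -> Z}) (f : {linear X ⊗ Y -> X'}) :
  mul2 f Z ∘ dtens p D (dtens q E F) = dtens (p + q) (f ∘ dtens p D E) F.
Proof. by rewrite /mul2 -lcompA dtensAV tmap_dtens lcomp1f. Qed.

Definition homog X p (D : {linear TV V -> X}) := forall n, n <> p -> D ∘ tin V n = 0.

Lemma cut_small p n : (n < p)%N -> cut V p ∘ tin V n = 0.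
Proof.
elim: n p => [|n IH] [|p] // np.
  by apply: linear_ext => c; rewrite lcompE tin0 linearZ cutS_one /= scaler0.
apply: tensE => v x; rewrite lcompE -[tin _ _ _]tcons_tin cutS_cons.
by rewrite -[cut _ _ _]lcompE IH // linear0.
Qed.
Lemma homog_dtens X Y p q (D : {linear TV V -> X}) (E : {linear TV V -> Y}) :
  homog q E -> homog (p + q) (dtens p D E).
Proof.
move=> hE n npq; rewrite dtensE -lcompA; case: (ltnP n p) => [np|pn].
  by rewrite cut_small // lcompf0.
rewrite -(subnKC pn) cut_tin lcompA -tmap_comp hE; last by lia.
by apply: linear_ext => x; rewrite lcompE; apply: (tens_app (g := 0)) => a b;
  rewrite tmapE pure0r.
Qed.
Lemma homog_sum X p (I : eqType) (s : seq I) (F : I -> {linear TV V -> X}) :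
  (forall i, i \in s -> homog p (F i)) -> homog p (\sum_(i <- s) F i).
Proof.
by move=> h n np; rewrite lcomp_suml big_seq big1 // => i si; apply: h.
Qed.
Lemma homog_strands (sigma : {linear V ⊗ V -> V ⊗ V}) q f X p (D : {linear TV V -> X}) :
  strands sigma q f -> homog p D -> homog p (D ∘ f).
Proof.
move=> hf hD n np; have [g E] := strands_deg n hf.
by rewrite -lcompA E lcompA hD // lcomp0f.
Qed.
Lemma homog_comp X Y p (D : {linear TV V -> X}) (f : {linear X -> Y}) :
  homog p D -> homog p (f ∘ D).
Proof. by move=> hD n np; rewrite -lcompA hD // lcompf0. Qed.

Lemma homogE X p (f g : {linear TV V -> X}) : homog p f -> homog p g ->
  f ∘ tin V p = g ∘ tin V p -> f = g.
Proof.
move=> hf hg h; apply: tv_inE => n; case: (eqVneq n p) => [->//|/eqP np].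
by rewrite hf // hg.
Qed.

Lemma cut_tcat p q w w' : cut V p (tin V (p + q) (tcat V p q (w \ox w'))) =
  tin V p w \ox tin V q w'.
Proof.
rewrite -[cut _ _ _]lcompE cut_tin lcompE -[tsplit _ _ _ _]lcompE tsplitK.
exact: tmapE.
Qed.
Lemma dtens_tcat X Y p q (D : {linear TV V -> X}) (E : {linear TV V -> Y}) w w' :
  dtens p D E (tin V (p + q) (tcat V p q (w \ox w'))) = D (tin V p w) \ox E (tin V q w').
Proof. by rewrite dtensE lcompE cut_tcat tmapE. Qed.

Lemma homogE2 X p q (f g : {linear TV V -> X}) : homog (p + q) f -> homog (p + q) g ->
  (forall w w', f (tin V (p + q) (tcat V p q (w \ox w'))) =
                g (tin V (p + q) (tcat V p q (w \ox w')))) -> f = g.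
Proof.
move=> hf hg h; apply: (homogE hf hg).
rewrite -[tin _ _]lcompf1 -tcatK !lcompA; congr (_ ∘ _).
by apply: tensE => w w'; rewrite !lcompE h.
Qed.

(** Families through which linear maps out of [X] can be compared.  Homogeneity
    makes them stable under [dtens]. *)
Definition spans X (I : Type) (p : I -> nat) (D : I -> {linear TV V -> X}) :=
  (forall i, homog (p i) (D i)) /\
  forall W (f g : {linear X -> W}), (forall i, f ∘ D i = g ∘ D i) -> f = g.

Lemma spans_dtens X Y (I J : Type) p q (D : I -> {linear TV V -> X})
    (E : J -> {linear TV V -> Y}) : spans p D -> spans q E ->
  spans (fun ij : I * J => p ij.1 + q ij.2)%N
        (fun ij => dtens (p ij.1) (D ij.1) (E ij.2)).
Proof.
move=> [hD sD] [hE sE]; split=> [[i j]|W f g h]; first exact: homog_dtens.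
suff E0 : tcurry f = tcurry g by apply: tensE => u v; rewrite -!tcurryE E0.
apply: sD => i; apply: (@homogE _ (p i)); try exact: homog_comp.
apply: linear_ext => w; apply: sE => j; apply: (@homogE _ (q j)); try exact: homog_comp.
apply: linear_ext => w'; rewrite !lcompE !tcurryE -!dtens_tcat -!lcompE.
by rewrite (h (i, j)).
Qed.
End Dtens.

(** * Products, braiding and coproduct on decorated trees *)

Section TreeRules.
Variables (k : fieldType) (V : lmodType k).

(** Decorates the angles of [T]; a tensor whose degree is not the number of
    angles gives 0. *)
Definition decor (T : ptree) : {linear TV V -> AT V} := dlift (fun n => dect V n T).

Lemma decor_tin T n : decor T ∘ tin V n = dect V n T.
Proof. by apply: linear_ext => x; rewrite lcompE [LHS]dlift_in. Qed.
Lemma anglesE T : leaves T == (angles T).+1.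
Proof. by rewrite /angles prednK // leaves_gt0. Qed.
Definition toD T : D (angles T) := exist _ T (anglesE T).
Lemma dect_angles T : dect V (angles T) T = dec V (toD T).
Proof. by rewrite -dectE. Qed.
Lemma homog_decor T : homog (angles T) (decor T).
Proof.
move=> n nT; rewrite decor_tin /dect insubN //; apply/eqP => h; apply: nT.
by rewrite /angles h.
Qed.
Lemma angles_D n (T : D n) : angles (val T) = n.
Proof. by rewrite /angles (eqP (valP T)). Qed.
Lemma decor_val n (T : D n) w : decor (val T) (tin V n w) = dec V T w.
Proof. by rewrite -[LHS]lcompE decor_tin dectE. Qed.
Lemma decor_tin_angles T w : decor T (tin V (angles T) w) = dec V (toD T) w.
Proof. exact: (decor_val (toD T)). Qed.

Lemma spans_decor : spans angles decor.
Proof.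
split=> [T|W f g h]; first exact: homog_decor.
apply/linear_ext/at_ext => n T w.
by rewrite -decor_val; apply: (lin_app _ (h (val T))).
Qed.

(** A tensor decorates the angles of several trees at once, from left to right.
    On such elements each structure map changes the trees and composes with a
    braid, which is the content of the rules below. *)
Definition decor2 T T' := dtens (angles T) (decor T) (decor T').
Definition decor3 T T' T'' := dtens (angles T) (decor T) (decor2 T' T'').
Lemma spans2 : spans (fun x => angles x.1 + angles x.2)%N (fun x => decor2 x.1 x.2).
Proof. exact: spans_dtens spans_decor spans_decor. Qed.
Lemma spans3 : spans (fun x => angles x.1 + (angles x.2.1 + angles x.2.2))%N
  (fun x => decor3 x.1 x.2.1 x.2.2).
Proof. exact: spans_dtens spans_decor spans2. Qed.
Lemma homog_decor2 T T' : homog (angles T + angles T') (decor2 T T').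
Proof. exact: (spans2.1 (T, T')). Qed.
Lemma at2E (W : lmodType k) (f g : {linear AT V ⊗ AT V -> W}) :
  (forall T T', f ∘ decor2 T T' = g ∘ decor2 T T') -> f = g.
Proof. by move=> h; apply: spans2.2 => -[T T']; apply: h. Qed.
Lemma at3E (W : lmodType k) (f g : {linear AT V ⊗ AT V ⊗ AT V -> W}) :
  (forall T T' T'', f ∘ decor3 T T' T'' = g ∘ decor3 T T' T'') -> f = g.
Proof. by move=> h; apply: spans3.2 => -[T [T' T'']]; apply: h. Qed.
Lemma at1E (W : lmodType k) (f g : {linear AT V -> W}) :
  (forall T, f ∘ decor T = g ∘ decor T) -> f = g.
Proof. exact: spans_decor.2. Qed.

(** Since the product of trees keeps the decorations in order, an operation acts
    on a decorated pair of trees without any braid. *)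
Definition sized (o : ptree -> ptree -> seq ptree) := forall T T' R,
  R \in o T T' -> angles R = (angles T + angles T')%N.
Lemma star_sized : sized tree_star. Proof. by move=> T T' R; apply: angles_star. Qed.
Lemma op_sub_star T T' R (o : ptree -> ptree -> seq ptree) :
  [\/ o = tree_prec, o = tree_succ | o = tree_dot] -> R \in o T T' -> R \in tree_star T T'.
Proof.
move=> ho oR; have [[E E']|h] : (T = Leaf /\ T' = Leaf) \/ (T <> Leaf \/ T' <> Leaf).
  by case: T T' {oR} => [|??] [|??]; [left|right; right|right; left|right; left].
  by move: oR; rewrite E E'; case: ho => ->.
by rewrite tree_starE // !mem_cat; case: ho oR => -> ->; rewrite ?orbT.
Qed.
Lemma op_sized o : [\/ o = tree_prec, o = tree_succ | o = tree_dot] -> sized o.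
Proof. by move=> ho T T' R /(op_sub_star ho); apply: angles_star. Qed.

Lemma at_op_decor2 o T T' : sized o -> at_op V o ∘ decor2 T T' = \sum_(R <- o T T') decor R.
Proof.
move=> so; apply: (@homogE2 _ _ _ (angles T) (angles T')).
- exact/homog_comp/homog_decor2.
- by apply: homog_sum => R oR; rewrite -(so _ _ _ oR); apply: homog_decor.
move=> w w'; rewrite lcompE dtens_tcat !decor_tin_angles at_lift2_dec !hom_sumE.
by apply: eq_bigr => R _; rewrite lcompE -decor_tin.
Qed.

Section Sigma.
Variable sigma : {linear V ⊗ V -> V ⊗ V}.
Notation c := (at_braid sigma).

Lemma tcast_tin m n (e : m = n) (x : tpow V m) : tin V n (Defs.tcast V e x) = tin V m x.
Proof. by case: n / e. Qed.

Lemma beta_split_tin m n :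
  tmap (tin V n) (tin V m) ∘ beta_split sigma m n = cut V n ∘ block_swap sigma m n ∘ tin V (m + n).
Proof.
apply: linear_ext => x; rewrite lcompE [beta_split _ _ _ _]lcompE [(_ ∘ Defs.tcast _ _) _]lcompE.
rewrite -[tmap _ _ _]lcompE -cut_tin lcompE tcast_tin.
by rewrite -[tin _ _ _]lcompE beta_tin.
Qed.

Lemma braid_decor2 T T' : c ∘ decor2 T T' = decor2 T' T ∘ block_swap sigma (angles T) (angles T').
Proof.
apply: (@homogE2 _ _ _ (angles T) (angles T')).
- exact/homog_comp/homog_decor2.
- apply: (homog_strands (strands_block_swap _ _ _)); rewrite addnC; exact: homog_decor2.
move=> w w'; rewrite lcompE dtens_tcat !decor_tin_angles at_lift2_dec.
rewrite -!dect_angles -!decor_tin tmap_comp -[tmap _ _ ∘ _ ∘ _]lcompA beta_split_tin.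
by rewrite !lcompE /decor2 dtensE lcompE.
Qed.

Section Rules.
Variable Z : lmodType k.
Implicit Type F : {linear TV V -> Z}.
Notation n T := (angles T).

Lemma mul2_rule o T T' F : sized o ->
  mul2 (at_op V o) Z ∘ dtens (n T) (decor T) (dtens (n T') (decor T') F) =
  \sum_(R <- o T T') dtens (n R) (decor R) F.
Proof.
move=> so; rewrite mul2_dtens [at_op V o ∘ _]at_op_decor2 // dtens_suml.
by apply: eq_big_seq => R /so ->.
Qed.
Lemma act2_rule T T' F (tau : {linear AT V ⊗ AT V -> AT V ⊗ AT V}) g :
  strands sigma (n T + n T') g -> tau ∘ decor2 T T' = decor2 T' T ∘ g ->
  act2 tau Z ∘ dtens (n T) (decor T) (dtens (n T') (decor T') F) =
  dtens (n T') (decor T') (dtens (n T) (decor T) F) ∘ g.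
Proof.
move=> hg ht; rewrite act2_dtens [tau ∘ _]ht (dtens_left _ _ hg).
by rewrite addnC lcompA dtensA.
Qed.
Lemma braid_rule T T' F :
  act2 c Z ∘ dtens (n T) (decor T) (dtens (n T') (decor T') F) =
  dtens (n T') (decor T') (dtens (n T) (decor T) F) ∘ block_swap sigma (n T) (n T').
Proof. by apply: act2_rule; [apply: strands_block_swap|apply: braid_decor2]. Qed.
End Rules.

Lemma op_rule_l o T1 T2 T3 : sized o -> mul2 (at_op V o) (AT V) ∘ decor3 T1 T2 T3 =
  \sum_(R <- o T1 T2) decor2 R T3.
Proof. exact: mul2_rule. Qed.
Lemma braid_rule_l T1 T2 T3 : act2 c (AT V) ∘ decor3 T1 T2 T3 =
  decor3 T2 T1 T3 ∘ block_swap sigma (angles T1) (angles T2).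
Proof. exact: braid_rule. Qed.
Lemma braid_rule_r T1 T2 T3 : tmap (lid (AT V)) c ∘ decor3 T1 T2 T3 =
  decor3 T1 T3 T2 ∘ liftn (angles T1) (block_swap sigma (angles T2) (angles T3)).
Proof. by rewrite tmap_dtens lcomp1f braid_decor2 dtens_right. Qed.
Lemma op_rule_r o T1 T2 T3 : sized o -> tmap (lid (AT V)) (at_op V o) ∘ decor3 T1 T2 T3 =
  \sum_(R <- o T2 T3) decor2 T1 R.
Proof. by move=> so; rewrite tmap_dtens lcomp1f at_op_decor2 // dtens_sumr. Qed.

Definition decor22 T1 T2 T3 T4 := dtens (angles T1 + angles T2) (decor2 T1 T2) (decor2 T3 T4).

(** The hypothesis on [tau] covers both the braiding and, on trivial trees, the
    flip that appears in the box product. *)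
Lemma mul_pairs_rule o o' T1 T2 T3 T4 (tau : {linear AT V ⊗ AT V -> AT V ⊗ AT V}) g :
  sized o -> sized o' ->
  strands sigma (angles T2 + angles T3) g -> tau ∘ decor2 T2 T3 = decor2 T3 T2 ∘ g ->
  mul_pairs tau (at_op V o) (at_op V o') ∘ decor22 T1 T2 T3 T4 =
  \sum_(R <- o T1 T3) \sum_(S <- o' T2 T4) (decor2 R S ∘ liftn (angles T1) g).
Proof.
move=> so so' hg ht; rewrite /mul_pairs -!lcompA dtensA.
rewrite tmap_dtens lcomp1f (act2_rule _ hg ht) dtens_right.
rewrite [assocV _ _ _ ∘ _]lcompA dtensAV lcompA tmap_dtens !at_op_decor2 //.
rewrite dtens_suml lcomp_suml; apply: eq_big_seq => R /so E.
by rewrite dtens_sumr lcomp_suml; apply: eq_bigr => S _; rewrite /decor2 E.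
Qed.

(** The splitting of the tree, composed with the braid that unshuffles its labels
    accordingly *)
Definition at_Delta : {linear AT V -> AT V ⊗ AT V} := at_lift (fun n T =>
  \sum_(x <- cop (val T)) (decor2 x.1.2 x.2 ∘ unshuffle sigma x.1.1 ∘ tin V n)).
Notation Delta := at_Delta.

Lemma cop_angles T x : x \in cop T -> (angles x.1.2 + angles x.2)%N = angles T.
Proof.
by move=> /cop_sizeP [<- <- <-]; rewrite -(count_predC id).
Qed.
Lemma strands_cop T x : x \in cop T -> strands sigma (angles T) (unshuffle sigma x.1.1).
Proof. by move=> /cop_sizeP [<- _ _]; apply: strands_unshuffle. Qed.
Lemma homog_cop T x : x \in cop T ->
  homog (angles T) (decor2 x.1.2 x.2 ∘ unshuffle sigma x.1.1).
Proof.
move=> xT; apply: (homog_strands (strands_cop xT)).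
by rewrite -(cop_angles xT); apply: homog_decor2.
Qed.

Lemma Delta_decor T : Delta ∘ decor T = \sum_(x <- cop T) (decor2 x.1.2 x.2 ∘ unshuffle sigma x.1.1).
Proof.
apply: (@homogE _ _ _ (angles T)); first exact/homog_comp/homog_decor.
  by apply: homog_sum => x; apply: homog_cop.
rewrite -lcompA decor_tin dect_angles; apply: linear_ext => w.
by rewrite lcompE at_lift_dec lcomp_suml.
Qed.

Lemma Delta_rule_l (Z : lmodType k) (F : {linear TV V -> Z}) T : assoc _ _ _ ∘ tmap Delta (lid Z)
    ∘ dtens (angles T) (decor T) F =
  \sum_(x <- cop T) (dtens (angles x.1.2) (decor x.1.2) (dtens (angles x.2) (decor x.2) F)
                     ∘ unshuffle sigma x.1.1).
Proof.
rewrite -lcompA tmap_dtens lcomp1f Delta_decor dtens_suml lcomp_sumr.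
apply: eq_big_seq => x xT; rewrite (dtens_left _ _ (strands_cop xT)).
by rewrite -(cop_angles xT) lcompA dtensA.
Qed.
Lemma Delta_rule_l2 T T' : assoc _ _ _ ∘ tmap Delta (lid (AT V)) ∘ decor2 T T' =
  \sum_(x <- cop T) (decor3 x.1.2 x.2 T' ∘ unshuffle sigma x.1.1).
Proof. exact: Delta_rule_l. Qed.
Lemma Delta_rule_r T1 T : tmap (lid (AT V)) Delta ∘ decor2 T1 T =
  \sum_(x <- cop T) (decor3 T1 x.1.2 x.2 ∘ liftn (angles T1) (unshuffle sigma x.1.1)).
Proof.
rewrite tmap_dtens lcomp1f Delta_decor dtens_sumr.
by apply: eq_bigr => x _; rewrite dtens_right.
Qed.
Lemma Delta2_rule T T' : tmap Delta Delta ∘ decor2 T T' =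
  \sum_(x <- cop T) \sum_(y <- cop T') (decor22 x.1.2 x.2 y.1.2 y.2 ∘
    (unshuffle sigma x.1.1 ∘ liftn (angles T) (unshuffle sigma y.1.1))).
Proof.
rewrite tmap_dtens !Delta_decor dtens_suml; apply: eq_big_seq => x xT.
rewrite dtens_sumr; apply: eq_bigr => y _.
by rewrite dtens_right (dtens_left _ _ (strands_cop xT)) /decor22 (cop_angles xT) lcompA.
Qed.

(** * The braided bialgebra *)

Lemma at_star_assoc : at_star V ∘ mul2 (at_star V) (AT V) =
  at_star V ∘ tmap (lid (AT V)) (at_star V).
Proof.
apply: at3E => T1 T2 T3; rewrite /at_star.
rewrite -[LHS]lcompA -[RHS]lcompA (op_rule_r _ _ _ star_sized) (op_rule_l _ _ _ star_sized) !lcomp_sumr.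
under eq_bigr do rewrite (at_op_decor2 _ _ star_sized).
under [RHS]eq_bigr do rewrite (at_op_decor2 _ _ star_sized).
exact: (star_assoc (W := {linear TV V -> AT V})).
Qed.

Lemma decor_leaf_tone : decor Leaf (tone V) = at_one V.
Proof. by rewrite (decor_val leafD). Qed.

Lemma dtens_leaf_l (Z : lmodType k) (F : {linear TV V -> Z}) : dtens 0 (decor Leaf) F = purer _ (at_one V) ∘ F.
Proof. by apply: linear_ext => x; rewrite dtensE !lcompE cut0 tmapE decor_leaf_tone. Qed.
Lemma dtens_leaf_r p (X : lmodType k) (F : {linear TV V -> X}) : homog p F ->
  dtens p F (decor Leaf) = purel _ (at_one V) ∘ F.
Proof.
move=> hF; apply: (@homogE _ _ _ p).
- by have := @homog_dtens _ _ _ _ p _ F _ (@homog_decor Leaf); rewrite addn0.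
- exact: homog_comp.
apply: linear_ext => x; rewrite lcompE [RHS]lcompE.
rewrite dtensE [(tmap _ _ ∘ cut _ _) _]lcompE -[cut _ _ _]lcompE cut_tin0 lcompE purelE tmapE.
by rewrite decor_leaf_tone.
Qed.

Lemma at_star_unit : is_unit (at_star V) (at_one V).
Proof.
move=> x.
rewrite /at_star; have El : at_op V tree_star ∘ purer _ (at_one V) = lid _.
  apply: at1E => T; rewrite -lcompA -dtens_leaf_l (at_op_decor2 Leaf _ star_sized).
  by rewrite star_leafl big_seq1 lcomp1f.
have Er : at_op V tree_star ∘ purel _ (at_one V) = lid _.
  apply: at1E => T; rewrite -lcompA -(dtens_leaf_r (@homog_decor _)) (at_op_decor2 _ _ star_sized).
  by rewrite star_leafr big_seq1 lcomp1f.
by split; [apply: (lin_app x El)|apply: (lin_app x Er)].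
Qed.

Hypothesis sigma_braid : is_braiding sigma.

Lemma at_braid_braiding : is_braiding c.
Proof.
suff E : act2 c (AT V) ∘ tmap (lid (AT V)) c ∘ act2 c (AT V) =
         tmap (lid (AT V)) c ∘ act2 c (AT V) ∘ tmap (lid (AT V)) c.
  by move=> x; apply: (lin_app x E).
apply: at3E => T1 T2 T3.
(* [act2] is a composition: abstracting it keeps [lcompA] from opening it. *)
move: (act2 c _) braid_rule_l (tmap _ c) braid_rule_r => s1 B1 s2 B2.
rewrite -!lcompA B1 B2 [s2 ∘ _]lcompA B2 [s1 ∘ (decor3 _ _ _ ∘ _)]lcompA B1.
rewrite -!lcompA [s1 ∘ _]lcompA B1 [s2 ∘ _]lcompA B2 -!lcompA; congr (_ ∘ _).
rewrite -block_swap_addr // [liftn _ _ ∘ (block_swap _ _ _ ∘ _)]lcompA -block_swap_addr // addnC block_swap_right //.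
by rewrite addnC; apply: strands_block_swap.
Qed.

Lemma at_op_braided o : sized o -> braided_op c (at_op V o).
Proof.
move=> so; split.
  suff E : mul2 (at_op V o) (AT V) ∘ tmap (lid (AT V)) c ∘ act2 c (AT V) =
      c ∘ tmap (lid (AT V)) (at_op V o) by move=> x; apply: (lin_app x E).
  apply: at3E => T1 T2 T3; rewrite -[RHS]lcompA (op_rule_r _ _ _ so).
  have M A B C := op_rule_l A B C so.
  move: (act2 c _) braid_rule_l (tmap _ c) braid_rule_r (mul2 _ _) M => s1 B1 s2 B2 m M.
  rewrite -!lcompA B1 [s2 ∘ _]lcompA B2 !lcompA M.
  rewrite -lcompA -block_swap_addr // lcomp_suml lcomp_sumr.
  by apply: eq_big_seq => R /so <-; rewrite braid_decor2.
suff E : tmap (lid (AT V)) (at_op V o) ∘ act2 c (AT V) ∘ tmap (lid (AT V)) c =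
    c ∘ mul2 (at_op V o) (AT V) by move=> x; apply: (lin_app x E).
apply: at3E => T1 T2 T3; rewrite -[RHS]lcompA (op_rule_l _ _ _ so).
have M A B C := op_rule_r A B C so.
move: (act2 c _) braid_rule_l (tmap _ c) braid_rule_r (tmap _ (at_op V o)) M
  => s1 B1 s2 B2 m M.
rewrite -!lcompA B2 [s1 ∘ _]lcompA B1 !lcompA M.
rewrite -lcompA -block_swap_addl // lcomp_suml lcomp_sumr.
by apply: eq_big_seq => R /so <-; rewrite braid_decor2.
Qed.

Lemma at_braided_algebra : is_braided_algebra (at_star V) c.
Proof.
split; first exact: at_braid_braiding.
  by move=> x; apply: (lin_app x at_star_assoc).
exact: at_op_braided star_sized.
Qed.

Notation H := (AT V).
(** The trees match by [cop_coassoc] and the braids by [unshuffle3], coloring by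
    coloring. *)
Lemma Delta_coassoc : assoc H H H ∘ tmap Delta (lid H) ∘ Delta =
  tmap (lid H) Delta ∘ Delta.
Proof.
apply: at1E => T; rewrite -!lcompA Delta_decor !lcomp_sumr.
under eq_bigr do rewrite !lcompA Delta_rule_l lcomp_suml.
under [RHS]eq_bigr do rewrite !lcompA Delta_rule_r lcomp_suml.
have := @cop_coassoc {linear TV V -> H ⊗ H ⊗ H} T
  (fun c L M R => decor3 L M R ∘ unshuffle_col sigma c).
rewrite big_seq [X in _ = X -> _]big_seq => E.
rewrite big_seq [RHS]big_seq.
transitivity (\sum_(i <- cop T | i \in cop T)
       \sum_(y <- cop i.1.2)
          (decor3 y.1.2 y.2 i.2 ∘ unshuffle_col sigma (mergel i.1.1 y.1.1))).
  apply: eq_bigr => x /cop_sizeP [_ E1 E2]; apply: eq_big_seq => y /cop_sizeP [E3 _ _].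
  by rewrite -lcompA unshuffle_mergel // E3 E1.
rewrite E; apply: eq_bigr => x /cop_sizeP [_ E1 E2].
apply: eq_big_seq => y /cop_sizeP [E3 _ _].
by rewrite -lcompA -E1 unshuffle_merger // E3 E2.
Qed.

Lemma eps_decor_node T0 f : at_eps V ∘ decor (Node T0 f) = 0.
Proof.
apply: (@homogE _ _ _ (angles (Node T0 f))); first exact/homog_comp/homog_decor.
  by move=> n _; rewrite lcomp0f.
rewrite -lcompA decor_tin dect_angles; apply: linear_ext => w; rewrite lcompE at_lift_dec.
move: (toD _) w; have := angles_gt0 T0 f; case: (angles _) => // n _ T w.
Qed.
Lemma eps_one : at_eps V (at_one V) = 1.
Proof. by rewrite at_lift_dec. Qed.
Lemma lunit_eps (F : {linear TV V -> H}) T :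
  lunit H ∘ tmap (at_eps V) (lid H) ∘ dtens (angles T) (decor T) F =
  if T is Leaf then F else 0.
Proof.
rewrite -lcompA tmap_dtens lcomp1f; case: T => [|T f]; last first.
  rewrite eps_decor_node; apply: linear_ext => x; rewrite lcompE dtensE [(tmap _ _ ∘ cut _ _) _]lcompE.
  move: (cut _ _ _) => z; apply: (tens_app (f := lunit H ∘ tmap 0 F) (g := 0)) => a b.
  by rewrite lcompE tmapE hom0E pure0l linear0.
apply: linear_ext => x; rewrite lcompE dtensE [(tmap _ _ ∘ cut _ _) _]lcompE cut0 tmapE.
by rewrite lunitE lcompE decor_leaf_tone eps_one scale1r.
Qed.
Lemma runit_eps p (F : {linear TV V -> H}) T : homog p F ->
  runit H ∘ tmap (lid H) (at_eps V) ∘ dtens p F (decor T) =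
  if T is Leaf then F else 0.
Proof.
move=> hF; case: T => [|T f]; last first.
  rewrite -lcompA tmap_dtens lcomp1f eps_decor_node.
  apply: linear_ext => x; rewrite lcompE dtensE [(tmap _ _ ∘ cut _ _) _]lcompE.
  move: (cut _ _ _) => z; apply: (tens_app (f := runit H ∘ tmap F 0) (g := 0)) => a b.
  by rewrite lcompE tmapE hom0E pure0r linear0.
rewrite (dtens_leaf_r hF); apply: linear_ext => x; rewrite !lcompE purelE tmapE.
by rewrite tflipE lunitE eps_one scale1r.
Qed.

Lemma Delta_counit_l : lunit H ∘ tmap (at_eps V) (lid H) ∘ Delta = lid H.
Proof.
apply: at1E => T; rewrite -lcompA Delta_decor lcomp_sumr lcomp1f.
under eq_bigr do rewrite lcompA lunit_eps.
have := cop_counitl T (fun b R => decor R ∘ unshuffle sigma b).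
rewrite unshuffle_false lcompf1 => <-; apply: eq_bigr => x _.
by case: x.1.2 => // *; rewrite lcomp0f.
Qed.
Lemma Delta_counit_r : runit H ∘ tmap (lid H) (at_eps V) ∘ Delta = lid H.
Proof.
apply: at1E => T; rewrite -lcompA Delta_decor lcomp_sumr lcomp1f.
under eq_bigr do rewrite lcompA (runit_eps _ (@homog_decor _)).
have := cop_counitr T (fun b R => decor R ∘ unshuffle sigma b).
rewrite unshuffle_true lcompf1 => <-; apply: eq_bigr => x _.
by case: x.2 => // *; rewrite lcomp0f.
Qed.

Lemma Delta_coalgebra : is_coalgebra Delta (at_eps V).
Proof.
split; move=> x.
- exact: (lin_app x Delta_coassoc).
- exact: (lin_app x Delta_counit_l).
- exact: (lin_app x Delta_counit_r).
Qed.

Lemma block_swap_n0 n : block_swap sigma n 0 = lid (TV V).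
Proof. by rewrite /block_swap cats0 unshuffle_false. Qed.

(** The laws involving the coproduct express that blocks pass over the braid
    [unshuffle]; those involving the counit say that nothing is exchanged with an
    empty block. *)
Lemma Delta_braided_coalgebra : is_braided_coalgebra Delta (at_eps V) c.
Proof.
split; first by split; [apply: at_braid_braiding|apply: Delta_coalgebra].
- suff E : act2 c H ∘ tmap (lid H) c ∘ (assoc H H H ∘ tmap Delta (lid H)) =
    tmap (lid H) Delta ∘ c by move=> x; apply: (lin_app x E).
  apply: at2E => T T'.
  move: (act2 c _) braid_rule_l (tmap _ c) braid_rule_r (assoc _ _ _ ∘ _) Delta_rule_l2
    (tmap _ Delta) Delta_rule_r => s1 B1 s2 B2 d1 D1 d2 D2.
  rewrite -!lcompA braid_decor2 D1 [RHS]lcompA D2 lcomp_suml !lcomp_sumr.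
  apply: eq_big_seq => x xT.
  rewrite [s2 ∘ (decor3 _ _ _ ∘ _)]lcompA B2 -!lcompA lcompA B1 -!lcompA; congr (_ ∘ _).
  rewrite lcompA -block_swap_addl // (cop_angles xT) -block_swap_left //; exact: strands_cop.
- suff E : tmap (lid H) c ∘ act2 c H ∘ tmap (lid H) Delta =
    assoc H H H ∘ tmap Delta (lid H) ∘ c by move=> x; apply: (lin_app x E).
  apply: at2E => T T'.
  move: (act2 c _) braid_rule_l (tmap _ c) braid_rule_r (assoc _ _ _ ∘ _) Delta_rule_l2
    (tmap _ Delta) Delta_rule_r => s1 B1 s2 B2 d1 D1 d2 D2.
  rewrite -!lcompA braid_decor2 D2 [RHS]lcompA D1 lcomp_suml !lcomp_sumr.
  apply: eq_big_seq => x xT.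
  rewrite [s1 ∘ (decor3 _ _ _ ∘ _)]lcompA B1 -!lcompA lcompA B2 -!lcompA; congr (_ ∘ _).
  rewrite lcompA -block_swap_addr // (cop_angles xT) block_swap_right //; exact: strands_cop.
- suff E : lunit H ∘ tmap (at_eps V) (lid H) ∘ c = runit H ∘ tmap (lid H) (at_eps V).
    by move=> x; apply: (lin_app x E).
  apply: at2E => T T'; rewrite -[LHS]lcompA braid_decor2 lcompA lunit_eps.
  rewrite (runit_eps _ (@homog_decor _)); case: T' => [|? ?]; last by rewrite lcomp0f.
  by rewrite block_swap_n0 lcompf1.
- suff E : runit H ∘ tmap (lid H) (at_eps V) ∘ c = lunit H ∘ tmap (at_eps V) (lid H).
    by move=> x; apply: (lin_app x E).
  apply: at2E => T T'; rewrite -[LHS]lcompA braid_decor2 lcompA lunit_eps.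
  rewrite (runit_eps _ (@homog_decor _)); case: T => [|? ?]; last by rewrite lcomp0f.
  by rewrite block_swap0 lcompf1.
Qed.

(** The trees match by [cop_star] and the braids by [unshuffle_cat]. *)
Lemma Delta_mul : Delta ∘ at_star V =
  mul_pairs c (at_star V) (at_star V) ∘ tmap Delta Delta.
Proof.
apply: at2E => T T'; rewrite /at_star -[LHS]lcompA -[RHS]lcompA Delta2_rule (at_op_decor2 _ _ star_sized).
rewrite !lcomp_sumr; under eq_bigr do rewrite Delta_decor.
rewrite (@cop_star {linear TV V -> H ⊗ H} _ _ (fun z => decor2 z.1.2 z.2 ∘ unshuffle sigma z.1.1)).
apply: eq_big_seq => x /cop_sizeP [sx cx nx]; rewrite lcomp_sumr.
apply: eq_big_seq => y /cop_sizeP [sy cy ny].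
rewrite lcompA (mul_pairs_rule _ _ star_sized star_sized (strands_block_swap _ _ _) (braid_decor2 _ _)).
rewrite lcomp_suml; apply: eq_bigr => L _; rewrite lcomp_suml; apply: eq_bigr => R _.
by rewrite unshuffle_cat // sx cx nx cy !lcompA.
Qed.

Lemma Delta_bialgebra : is_braided_bialgebra (at_star V) Delta (at_eps V) c.
Proof.
split; [exact: at_braided_algebra|exact: Delta_braided_coalgebra|].
by move=> x; apply: (lin_app x Delta_mul).
Qed.
End Sigma.
End TreeRules.

(** * The augmentation ideal *)

Section Augmentation.
Variables (k : fieldType) (V : lmodType k).
Notation H := (AT V).

(** The retraction of [incl1] that kills the trivial tree *)
Definition proj1AT : {linear H -> AT1 V} := dlift (fun n =>
  match n return {linear freemod k (D n) ⊗ tpow V n -> AT1 V} with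
  | 0 => 0
  | n'.+1 => dsum_in (fun n : nat => freemod k (D n.+1) ⊗ tpow V n.+1) n'
  end).

Lemma incl1_in n z : incl1 V (dsum_in (fun n : nat => freemod k (D n.+1) ⊗ tpow V n.+1) n z) =
  dsum_in (fun n : nat => freemod k (D n) ⊗ tpow V n) n.+1 z.
Proof. exact: dlift_in. Qed.
Lemma proj1_incl1 : proj1AT ∘ incl1 V = lid _.
Proof.
apply/linear_ext/dsum_ext => n z; rewrite lcompE incl1_in.
exact: dlift_in.
Qed.
Lemma incl1_proj1_node T0 f : incl1 V ∘ proj1AT ∘ decor V (Node T0 f) = decor V (Node T0 f).
Proof.
apply: (homogE (p := angles (Node T0 f))); try exact: homog_decor.
  exact/homog_comp/homog_decor.
rewrite -lcompA decor_tin dect_angles; move: (toD _); have := angles_gt0 T0 f.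
case: (angles _) => // n _ T; apply: linear_ext => w; rewrite !lcompE.
by rewrite [proj1AT _]dlift_in incl1_in.
Qed.
Lemma incl1_proj1_leaf : incl1 V ∘ proj1AT ∘ decor V Leaf = 0.
Proof.
apply: (homogE (p := 0)).
- exact/homog_comp/(@homog_decor _ _ Leaf).
- by move=> n _; rewrite lcomp0f.
apply: linear_ext => w; rewrite lcompE lcompE -[w]/(w : tpow V (angles Leaf)) decor_tin_angles.
by rewrite lcompE [proj1AT _]dlift_in hom0E linear0.
Qed.

(** The augmentation ideal is spanned by the decorated trees with a root. *)
Lemma incl1E (W : lmodType k) (f g : {linear H -> W}) :
  (forall T0 h, f ∘ decor V (Node T0 h) = g ∘ decor V (Node T0 h)) -> f ∘ incl1 V = g ∘ incl1 V.
Proof.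
move=> h; pose pr := incl1 V ∘ proj1AT.
have prK : pr ∘ incl1 V = incl1 V by rewrite /pr -lcompA proj1_incl1 lcompf1.
suff E : f ∘ pr = g ∘ pr by rewrite -prK lcompA [RHS]lcompA E.
apply: at1E => -[|T0 f0]; rewrite -[LHS]lcompA -[RHS]lcompA.
  by rewrite incl1_proj1_leaf !lcompf0.
by rewrite incl1_proj1_node h.
Qed.

Lemma incl1_2E (W : lmodType k) (f g : {linear H ⊗ H -> W}) :
  (forall T0 h T0' h', f ∘ decor2 V (Node T0 h) (Node T0' h') =
                       g ∘ decor2 V (Node T0 h) (Node T0' h')) ->
  f ∘ tmap (incl1 V) (incl1 V) = g ∘ tmap (incl1 V) (incl1 V).
Proof.
move=> h; pose pr := incl1 V ∘ proj1AT.
have prK : pr ∘ incl1 V = incl1 V by rewrite /pr -lcompA proj1_incl1 lcompf1.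
suff E : f ∘ tmap pr pr = g ∘ tmap pr pr.
  by rewrite -prK tmap_comp lcompA [RHS]lcompA E.
apply: at2E => T T'; rewrite -[LHS]lcompA -[RHS]lcompA tmap_dtens.
case: T => [|T0 f0]; first by rewrite incl1_proj1_leaf dtens0l !lcompf0.
case: T' => [|T0' f0']; first by rewrite incl1_proj1_leaf dtens0r !lcompf0.
by rewrite !incl1_proj1_node h.
Qed.

(** The projection onto the unit tests whether a right-hand tree is trivial. *)
Section Unit.
Variable e0 : {linear H -> H}.
Hypothesis e0E : forall x, e0 x = (at_eps V x : k) *: at_one V.

Lemma e0_node T0 f : e0 ∘ decor V (Node T0 f) = 0.
Proof.
apply: linear_ext => x; rewrite lcompE e0E.

by rewrite -[at_eps V _]lcompE eps_decor_node scale0r.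
Qed.
Lemma e0_one : e0 (at_one V) = at_one V.
Proof. by rewrite e0E eps_one scale1r. Qed.
Lemma e0_leaf : e0 ∘ decor V Leaf = decor V Leaf.
Proof.
apply: (homogE (p := 0)); try exact: (@homog_decor _ _ Leaf).
  exact/homog_comp/(@homog_decor _ _ Leaf).
apply: linear_ext => c; rewrite lcompE lcompE tin0 !linearZ /= decor_leaf_tone.
by rewrite e0_one [RHS]lcompE tin0 linearZ /= decor_leaf_tone.
Qed.
Lemma e0_decor2 T T' : tmap (lid H) e0 ∘ decor2 V T T' = if is_leaf T' then decor2 V T T' else 0.
Proof.
rewrite tmap_dtens lcomp1f; case: T' => [|T0 f]; first by rewrite e0_leaf.
by rewrite e0_node dtens0r.
Qed.
Lemma e0_decor22 T1 T2 T3 T4 : tmap (tmap (lid H) e0) (tmap (lid H) e0) ∘ decor22 V T1 T2 T3 T4 =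
  if is_leaf T2 && is_leaf T4 then decor22 V T1 T2 T3 T4 else 0.
Proof.
rewrite tmap_dtens !e0_decor2; case: (is_leaf T2); last by rewrite dtens0l.
by case: (is_leaf T4); last by rewrite dtens0r.
Qed.
End Unit.
End Augmentation.

(** * Compatibility with the tridendriform operations *)

Section Coproduct.
Variables (k : fieldType) (V : lmodType k) (sigma : {linear V ⊗ V -> V ⊗ V}).
Notation H := (AT V).
Notation c := (at_braid sigma).
Notation Delta := (at_Delta sigma).

Lemma Delta_one : Delta (at_one V) = at_one V \ox at_one V.
Proof.
rewrite -decor_leaf_tone -[LHS]lcompE Delta_decor cop_leaf big_seq1 lcompf1.
by rewrite [decor2 _ _ _]dtens_leaf_l lcompE decor_leaf_tone.
Qed.

Let eta_lin : linear (fun a : k^o => a *: at_one V).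
Proof. by move=> a x y; rewrite scalerDl scalerA. Qed.
(** The unit of the convolution product *)
Definition etaeps : {linear H -> H} := mklin eta_lin ∘ at_eps V.
Lemma etaepsE x : etaeps x = (at_eps V x : k) *: at_one V.
Proof. by []. Qed.

Lemma etaeps_Delta_l : tmap etaeps (lid H) ∘ Delta = purer H (at_one V).
Proof.
have E : tmap etaeps (lid H) = purer H (at_one V) ∘ (lunit H ∘ tmap (at_eps V) (lid H)).
  apply: tensE => x y; rewrite 2!lcompE !tmapE lunitE etaepsE.
  by rewrite purerE -[LHS]/(purel _ _ _) -[RHS]/(purer _ _ _) !linearZ.
by rewrite E -lcompA Delta_counit_l lcompf1.
Qed.
Lemma etaeps_Delta_r : tmap (lid H) etaeps ∘ Delta = purel H (at_one V).
Proof.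
have E : tmap (lid H) etaeps = purel H (at_one V) ∘ (runit H ∘ tmap (lid H) (at_eps V)).
  apply: tensE => x y; rewrite 3!lcompE !tmapE tflipE lunitE etaepsE.
  by rewrite purelE -[LHS]/(purer _ _ _) -[RHS]/(purel _ _ _) !linearZ.
by rewrite E -lcompA Delta_counit_r lcompf1.
Qed.
Lemma incl1_proj1 : incl1 V ∘ proj1AT V = lid H - etaeps.
Proof.
apply: at1E => -[|T0 f]; rewrite lcompBl lcomp1f.
  by rewrite incl1_proj1_leaf (e0_leaf etaepsE) subrr.
by rewrite incl1_proj1_node (e0_node etaepsE) subr0.
Qed.

(** With [p = 1 - etaeps], the counit laws give
    [(p ⊗ p) Delta x = Delta x - x ⊗ 1 - 1 ⊗ x] on the augmentation ideal. *)
Lemma Delta_in_box (x : AT1 V) : in_box (Delta (incl1 V x)).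
Proof.
exists x, x, (tmap (proj1AT V) (proj1AT V) (Delta (incl1 V x))).
suff E : Delta ∘ incl1 V = (purel H (at_one V) + purer H (at_one V)
   + tmap (lid H - etaeps) (lid H - etaeps) ∘ Delta) ∘ incl1 V.
  by rewrite [LHS](lin_app x E) -incl1_proj1 tmap_comp.
have E2 : tmap etaeps etaeps ∘ Delta = purel H (at_one V) ∘ etaeps.
  rewrite -[X in tmap X _]lcompf1 -[X in tmap _ X]lcomp1f tmap_comp -lcompA.
  rewrite etaeps_Delta_r; apply: linear_ext => y.
  by rewrite !lcompE !purelE tmapE.
apply: incl1E => T0 f; rewrite tmapBl !tmapBr tmap_id lcompDl !lcompBl lcomp1f.
rewrite etaeps_Delta_l etaeps_Delta_r E2 -[X in _ - (_ - X)]lcompA (e0_node etaepsE).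
rewrite lcompf0 subr0 lcompDl.
by rewrite -[X in _ = _ + X]addrA -opprD [RHS]addrC subrK.
Qed.

Section BoxOp.
Variable o : ptree -> ptree -> seq ptree.
Hypothesis ho : [\/ o = tree_prec, o = tree_succ | o = tree_dot].
Let so := op_sized ho.

(** The operation of the box product attached to [o]; [box_opE] identifies it
    with [box_op].  A linear map is needed in order to compose with it. *)
Definition box_lin : {linear (H ⊗ H) ⊗ (H ⊗ H) -> H ⊗ H} :=
  let K := tmap (tmap (lid H) etaeps) (tmap (lid H) etaeps) in
  mul_pairs c (at_star V) (at_op V o) ∘ (lid _ - K)
  + mul_pairs (tflip H H) (at_op V o) (at_star V) ∘ K.

(** With a trivial tree the braiding is the flip, so both formulas for the
    operation of the box product can be computed by [mul_pairs_rule]. *)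
Lemma tflip_leaf T : tflip H H ∘ decor2 V Leaf T = decor2 V T Leaf ∘ lid (TV V).
Proof.
rewrite [decor2 _ _ _]dtens_leaf_l lcompf1 [RHS](dtens_leaf_r (@homog_decor _ _ T)).
by rewrite lcompA; congr (_ ∘ _); apply: linear_ext => x; rewrite lcompE tflipE.
Qed.

Lemma box_lin_decor22 T1 T2 T3 T4 : box_lin ∘ decor22 V T1 T2 T3 T4 =
  if is_leaf T2 && is_leaf T4 then \sum_(R <- o T1 T3) decor2 V R Leaf else
  \sum_(R <- tree_star T1 T3) \sum_(S <- o T2 T4)
    (decor2 V R S ∘ liftn (angles T1) (block_swap sigma (angles T2) (angles T3))).
Proof.
rewrite /box_lin lcompDl -[X in X + _]lcompA -[X in _ + X]lcompA lcompBl lcomp1f.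
rewrite (e0_decor22 etaepsE); case: ifP => [|_].
  case: T2 T4 => // -[] // _; rewrite subrr lcompf0 add0r.
  rewrite (mul_pairs_rule (sigma := sigma) _ _ so (@star_sized) _ (tflip_leaf _)); last first.
    exact: strands_id sigma _.
  apply: eq_bigr => R _; rewrite star_leafl big_seq1 liftn_id.
  exact: lcompf1.
rewrite lcompf0 addr0 subr0.
exact: (mul_pairs_rule _ _ (@star_sized) so (strands_block_swap _ _ _) (braid_decor2 _ _ _)).
Qed.

Lemma Delta_op_node T0 f T0' f' (T := Node T0 f) (T' := Node T0' f') :
  Delta ∘ at_op V o ∘ decor2 V T T' = box_lin ∘ tmap Delta Delta ∘ decor2 V T T'.
Proof.
rewrite -[LHS]lcompA -[RHS]lcompA at_op_decor2 // lcomp_sumr.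
under eq_bigr do rewrite Delta_decor.
rewrite (@cop_op {linear TV V -> H ⊗ H} _ _ _ _ _
  (fun z => decor2 V z.1.2 z.2 ∘ unshuffle sigma z.1.1) ho).
rewrite Delta2_rule lcomp_sumr; apply: eq_big_seq => x /cop_sizeP [sx cx nx].
rewrite lcomp_sumr; apply: eq_big_seq => y /cop_sizeP [sy cy ny].
rewrite [RHS]lcompA box_lin_decor22; case: ifP => [/andP [lx ly]|_].
  rewrite lcomp_suml; apply: eq_bigr => R _ /=.
  case: (x.2) lx nx => // _ nx.
  by rewrite unshuffle_cat // nx sx block_swap0 liftn_id lcomp1f.
rewrite lcomp_suml; apply: eq_bigr => L _; rewrite lcomp_suml; apply: eq_bigr => R _.
by rewrite unshuffle_cat // sx cx nx cy !lcompA.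
Qed.
Lemma box_opE z : box_op (at_star V) (at_eps V) c (at_one V) (at_op V o) z = box_lin z.
Proof.
have E (h : linear (fun a : k^o => a *: at_one V)) : mklin h ∘ at_eps V = etaeps.
  exact: linear_ext.
by rewrite /box_op !E.
Qed.

(** Turns [preserves_op], which is stated elementwise on the augmentation ideal,
    into an equation between linear maps. *)
Lemma preserves_node (Delta' : {linear H -> H ⊗ H}) T0 f T0' f'
    (T := Node T0 f) (T' := Node T0' f') : preserves_op sigma Delta' (at_op V o) ->
  Delta' ∘ at_op V o ∘ decor2 V T T' = box_lin ∘ tmap Delta' Delta' ∘ decor2 V T T'.
Proof.
move=> hD; have E : Delta' ∘ at_op V o ∘ tmap (incl1 V) (incl1 V) =
    box_lin ∘ tmap Delta' Delta' ∘ tmap (incl1 V) (incl1 V).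
  apply: tensE => x y; rewrite !lcompE !tmapE hD box_opE.
  by [].
have {}E : Delta' ∘ at_op V o ∘ tmap (incl1 V) (incl1 V) ∘ tmap (proj1AT V) (proj1AT V)
    ∘ decor2 V T T' = box_lin ∘ tmap Delta' Delta' ∘ tmap (incl1 V) (incl1 V)
    ∘ tmap (proj1AT V) (proj1AT V) ∘ decor2 V T T' by rewrite E.
have E' (W : lmodType k) (g : {linear H ⊗ H -> W}) :
    g ∘ tmap (incl1 V) (incl1 V) ∘ tmap (proj1AT V) (proj1AT V) ∘ decor2 V T T' = g ∘ decor2 V T T'.
  rewrite -lcompA -[LHS]lcompA [tmap _ _ ∘ (_ ∘ _)]lcompA -tmap_comp tmap_dtens.
  by rewrite !incl1_proj1_node.
by rewrite !E' in E.
Qed.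

Lemma Delta_preserves : preserves_op sigma Delta (at_op V o).
Proof.
move=> x y; rewrite box_opE.
have := incl1_2E Delta_op_node => /(lin_app (x \ox y)).
by rewrite !lcompE !tmapE.
Qed.
End BoxOp.

(** By the hexagon identities the four exchanges amount to one exchange of the
    blocks formed by the first and the second pair. *)
Lemma braid_pairs_decor22 T1 T2 T3 T4 :
  braid_pairs c ∘ decor22 V T1 T2 T3 T4 = decor22 V T3 T4 T1 T2 ∘
    block_swap sigma (angles T1 + angles T2) (angles T3 + angles T4).
Proof.
rewrite /braid_pairs.
have B (Z : lmodType k) := @braid_rule k V sigma Z.
have B2 (Z : lmodType k) T T' T'' (F : {linear TV V -> Z}) :
    tmap (lid H) (act2 c Z) ∘ dtens (angles T) (decor V T) (dtens (angles T') (decor V T')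
      (dtens (angles T'') (decor V T'') F)) =
    dtens (angles T) (decor V T) (dtens (angles T'') (decor V T'') (dtens (angles T') (decor V T') F))
    ∘ liftn (angles T) (block_swap sigma (angles T') (angles T'')).
  by rewrite tmap_dtens lcomp1f B dtens_right.
have B3 T T' T'' U : tmap (lid H) (tmap (lid H) c) ∘
      dtens (angles T) (decor V T) (dtens (angles T') (decor V T') (decor2 V T'' U)) =
    dtens (angles T) (decor V T) (dtens (angles T') (decor V T') (decor2 V U T''))
    ∘ liftn (angles T + angles T') (block_swap sigma (angles T'') (angles U)).
  by rewrite !tmap_dtens !lcomp1f braid_decor2 !dtens_right -liftnD.
move: (act2 c (H ⊗ H)) (B (H ⊗ H)) (tmap _ (act2 c H)) (B2 H) (tmap _ (tmap _ c)) B3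
  => s1 B1 s2 {}B2 s3 B3.
rewrite -!lcompA [decor22 _ _ _ _ _]/(dtens _ _ _) dtensA B2.
rewrite [s3 ∘ _]lcompA B3 -lcompA [s1 ∘ _]lcompA B1 -lcompA [s2 ∘ _]lcompA B2 -lcompA.
rewrite [LHS]lcompA dtensAV; congr (_ ∘ _).
rewrite lcompA -block_swap_addr // liftnD -liftn_comp -block_swap_addr //.
exact/esym/block_swap_addl.
Qed.

Hypothesis sigma_braid : is_braiding sigma.

Lemma Delta_braid_pairs : tmap Delta Delta ∘ c = braid_pairs c ∘ tmap Delta Delta.
Proof.
apply: at2E => T T'; rewrite -[LHS]lcompA -[RHS]lcompA braid_decor2 lcompA !Delta2_rule.
rewrite lcomp_suml; under eq_bigr do rewrite lcomp_suml.
rewrite exchange_big /= lcomp_sumr; apply: eq_big_seq => x xT.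
rewrite lcomp_sumr; apply: eq_big_seq => y yT.
rewrite [RHS]lcompA braid_pairs_decor22 -!lcompA; congr (_ ∘ _).
rewrite (cop_angles xT) (cop_angles yT) [RHS]lcompA (block_swap_left sigma_braid _ (strands_cop _ xT)).
rewrite -[RHS]lcompA (block_swap_right sigma_braid _ (strands_cop _ yT)).
by rewrite !lcompA (strands_liftnC _ (strands_cop _ yT)).
Qed.

Definition cherry := Node Leaf (FLast Leaf).
Lemma cop_cherry : cop cherry =
  [:: ([:: true], cherry, Leaf); ([:: false], Leaf, cherry)].
Proof. by []. Qed.
Lemma at_gen_decor v : at_gen v = decor V cherry (tin V 1 (v \ox (1 : k^o))).
Proof. by rewrite -[RHS]lcompE decor_tin. Qed.

Lemma Delta_gen v : Delta (at_gen v) = at_gen v \ox at_one V + at_one V \ox at_gen v.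
Proof.
rewrite at_gen_decor -[LHS]lcompE Delta_decor cop_cherry big_cons big_seq1 /=.
rewrite lift1_id [decor2 _ cherry _](dtens_leaf_r (@homog_decor _ _ cherry)).
by rewrite [decor2 _ _ cherry]dtens_leaf_l.
Qed.

Lemma Delta_AT_coproduct : is_AT_coproduct sigma Delta.
Proof.
split.
- exact: Delta_one.
- exact: Delta_in_box.
- by split; apply: Delta_preserves; [constructor 1|constructor 2|constructor 3].
- by move=> z; apply: (lin_app _ Delta_braid_pairs).
- exact: Delta_gen.
Qed.

(** * Uniqueness of the coproduct *)

Section Unique.
Variables D1 D2 : {linear H -> H ⊗ H}.
Hypotheses (h1 : is_AT_coproduct sigma D1) (h2 : is_AT_coproduct sigma D2).

Let agree T := D1 ∘ decor V T = D2 ∘ decor V T.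

(** The value on a product is determined by the values on the factors. *)
Let agree_op o T0 f T0' f' R (T := Node T0 f) (T' := Node T0' f') :
  [\/ o = tree_prec, o = tree_succ | o = tree_dot] ->
  o T T' = [:: R] -> agree T -> agree T' -> agree R.
Proof.
move=> ho oR aT aT'.
have E D : is_AT_coproduct sigma D ->
    D ∘ decor V R = box_lin o ∘ dtens (angles T) (D ∘ decor V T) (D ∘ decor V T').
  move=> [_ _ [hp hs hd] _ _]; rewrite -tmap_dtens -[dtens _ _ _]/(decor2 V T T') lcompA.
  rewrite -preserves_node; last by case: ho => ->.
  by rewrite -lcompA at_op_decor2 ?oR ?big_seq1 //; apply: op_sized.
by rewrite /agree !E // aT aT'.
Qed.

Let agree_leaf : agree Leaf.
Proof.
case: h1 h2 => e1 _ _ _ _ [e2 _ _ _ _]; rewrite /agree.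
apply: (homogE (p := 0)); try exact/homog_comp/(@homog_decor _ _ Leaf).
apply: linear_ext => a; rewrite !lcompE tin0 !linearZ /= decor_leaf_tone.
by rewrite e1 e2.
Qed.

Let agree_cherry : agree cherry.
Proof.
case: h1 h2 => _ _ _ _ e1 [_ _ _ _ e2]; rewrite /agree.
apply: (homogE (p := 1)); try exact/homog_comp/(@homog_decor _ _ cherry).
apply: tensE => v a; rewrite !lcompE.
have -> : v \ox a = a *: (v \ox (1 : k^o)) :> V ⊗ k^o.
  transitivity (purer k^o v (a *: (1 : k^o))); last by rewrite linearZ.
  by congr (_ \ox _); exact: esym (mulr1 a).
by rewrite !linearZ /= -at_gen_decor e1 e2.
Qed.

Let agree_stem T0 : agree T0 -> agree (Node T0 (FLast Leaf)).
Proof.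
case: T0 => [_|T f aT]; first exact: agree_cherry.
by apply: (@agree_op tree_succ T f Leaf (FLast Leaf)) => //; constructor 2.
Qed.

(** Each tree is a product of smaller trees: with [S] the tree with branches [T0]
    and a trivial one, [T0 ∨ T1] is [S ≺ T1] and [T0 ∨ T1 ∨ ... ∨ Tk] is
    [S · (T1 ∨ ... ∨ Tk)], while [S] is [T0 ≻ cherry]. *)
Lemma AT_coproduct_unique : D1 = D2.
Proof.
apply: at1E; apply: (proj1 (@tree_forest_ind agree
  (fun f => forall T0, agree T0 -> agree (Node T0 f)) _ _ _ _)).
- exact: agree_leaf.
- by move=> T aT f; apply.
- move=> [|T1 f] a1 T0 a0; first exact: agree_stem.
  apply: (@agree_op tree_prec T0 (FLast Leaf) T1 f) => //; first by constructor 1.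
  exact: agree_stem.
- move=> T1 a1 f af T0 a0.
  apply: (@agree_op tree_dot T0 (FLast Leaf) T1 f) => //; first by constructor 3.
    exact: agree_stem.
  exact: af.
Qed.
End Unique.

(** * The antipode *)

Section Antipode.
Notation star := (at_star V).
(** Convolution does not involve the braiding: associativity and coassociativity
    suffice. *)
Definition conv (f g : {linear H -> H}) : {linear H -> H} := star ∘ tmap f g ∘ Delta.

Lemma conv_assoc f g h : conv f (conv g h) = conv (conv f g) h.
Proof.
have L : tmap f (conv g h) = tmap (lid H) star ∘ tmap f (tmap g h) ∘ tmap (lid H) Delta.
  by rewrite -!tmap_comp lcomp1f lcompf1.
have R : tmap (conv f g) h = tmap star (lid H) ∘ tmap (tmap f g) h ∘ tmap Delta (lid H).
  by rewrite -!tmap_comp lcomp1f lcompf1.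
apply: linear_ext => x.
have C : tmap (lid H) Delta (Delta x) = assoc H H H (tmap Delta (lid H) (Delta x)).
  exact/esym/(lin_app x (Delta_coassoc sigma_braid)).
have N z : tmap f (tmap g h) (assoc H H H z) = assoc H H H (tmap (tmap f g) h z).
  exact/esym/(lin_app z (assoc_nat f g h)).
have A z : star (tmap (lid H) star z) = star (tmap star (lid H) (assocV H H H z)).
  exact/esym/(lin_app z (at_star_assoc V)).
have K z : assocV H H H (assoc H H H z) = z by exact: (lin_app z (assocK H H H)).
change (star (tmap f (conv g h) (Delta x)) = star (tmap (conv f g) h (Delta x))).
rewrite L R.
change (star (tmap (lid H) star (tmap f (tmap g h) (tmap (lid H) Delta (Delta x)))) =
  star (tmap star (lid H) (tmap (tmap f g) h (tmap Delta (lid H) (Delta x))))).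
by rewrite C N A K.
Qed.

Lemma convBl f g h : conv (f - g) h = conv f h - conv g h.
Proof. by rewrite /conv tmapBl lcompBr lcompBl. Qed.
Lemma convBr f g h : conv h (f - g) = conv h f - conv h g.
Proof. by rewrite /conv tmapBr lcompBr lcompBl. Qed.
Lemma conv_suml (I : Type) (s : seq I) (F : I -> {linear H -> H}) h :
  conv (\sum_(i <- s) F i) h = \sum_(i <- s) conv (F i) h.
Proof. by rewrite /conv tmap_suml lcomp_sumr lcomp_suml. Qed.
Lemma conv_sumr (I : Type) (s : seq I) (F : I -> {linear H -> H}) h :
  conv h (\sum_(i <- s) F i) = \sum_(i <- s) conv h (F i).
Proof. by rewrite /conv tmap_sumr lcomp_sumr lcomp_suml. Qed.

Lemma conv1l f : conv etaeps f = f.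
Proof.
rewrite /conv -[X in tmap X _](lcomp1f etaeps) -[X in tmap _ X]lcompf1 tmap_comp.
rewrite -!lcompA etaeps_Delta_l; apply: linear_ext => x; rewrite !lcompE tmapE.
by have [] := at_star_unit (f x).
Qed.
Lemma conv1r f : conv f etaeps = f.
Proof.
rewrite /conv -[X in tmap X _](lcompf1 f) -[X in tmap _ X](lcomp1f etaeps) tmap_comp.
rewrite -!lcompA etaeps_Delta_r; apply: linear_ext => x; rewrite !lcompE tmapE.
by have [] := at_star_unit (f x).
Qed.

(** The identity is the unit of convolution minus [negaug], so its inverse is the
    geometric series of [negaug]; the powers of [negaug] vanish on trees with few
    angles, so that the series is finite on each tree. *)
Definition negaug := etaeps - lid H.
Fixpoint negaug_pow j := if j is j'.+1 then conv negaug (negaug_pow j') else etaeps.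

Lemma negaug_powSr j : negaug_pow j.+1 = conv (negaug_pow j) negaug.
Proof.
elim: j => [|j IH]; first by rewrite /= conv1l conv1r.
by rewrite -[LHS]/(conv negaug (negaug_pow j.+1)) [in LHS]IH conv_assoc.
Qed.

Lemma conv_decor f g T : conv f g ∘ decor V T =
  \sum_(x <- cop T) (star ∘ dtens (angles x.1.2) (f ∘ decor V x.1.2) (g ∘ decor V x.2)
    ∘ unshuffle sigma x.1.1).
Proof.
rewrite /conv -lcompA Delta_decor lcomp_sumr; apply: eq_bigr => x _.
by rewrite -lcompA [tmap _ _ ∘ _]lcompA tmap_dtens lcompA.
Qed.

Lemma negaug_leaf : negaug ∘ decor V Leaf = 0.
Proof. by rewrite /negaug lcompBl lcomp1f (e0_leaf etaepsE) subrr. Qed.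

(** [negaug] kills the trivial tree, so each factor uses up an angle. *)
Lemma negaug_pow0 j T : (angles T < j)%N -> negaug_pow j ∘ decor V T = 0.
Proof.
elim: j T => // j IH T Tj; rewrite conv_decor big_seq big1 // => x xT.
case E : x.1.2 => [|T0 f]; first by rewrite negaug_leaf dtens0l lcompf0 lcomp0f.
rewrite IH ?dtens0r ?lcompf0 ?lcomp0f //.
apply: (@leq_trans (angles T)); last by rewrite -ltnS.
by rewrite -(cop_angles xT) E angles_node addnS addSn ltnS leq_addl.
Qed.

Definition antipode_trunc n := \sum_(0 <= j < n.+1) negaug_pow j.
Definition antipode : {linear H -> H} :=
  at_lift (fun n T => antipode_trunc n ∘ dec V T).

Lemma antipode_decor T n : (angles T <= n)%N -> antipode ∘ decor V T = antipode_trunc n ∘ decor V T.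
Proof.
move=> Tn; apply: (homogE (p := angles T)); try exact/homog_comp/homog_decor.
rewrite -!lcompA decor_tin dect_angles.
have -> : antipode ∘ dec V (toD T) = antipode_trunc (angles T) ∘ dec V (toD T).
  by apply: linear_ext => w; rewrite lcompE at_lift_dec.
rewrite -dect_angles -decor_tin !lcompA; congr (_ ∘ _).
rewrite /antipode_trunc (big_cat_nat _ (n := (angles T).+1) (p := n.+1)) //=.
rewrite lcompDl [X in _ = _ + X]lcomp_suml [X in _ = _ + X]big_nat
  [X in _ = _ + X]big1 ?addr0 //.
by move=> j /andP [Tj _]; apply: negaug_pow0.
Qed.

(** The geometric sums telescope. *)
Lemma antipode_trunc_l n : conv (antipode_trunc n) (lid H) = etaeps - negaug_pow n.+1.
Proof.
have -> : lid H = etaeps - negaug by rewrite /negaug opprB addrC subrK.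
rewrite convBr conv1r /antipode_trunc conv_suml.
under [X in _ - X]eq_bigr do rewrite -negaug_powSr.
rewrite [X in X - _]big_nat_recl // [X in _ - X]big_nat_recr //= opprD addrA.
by rewrite addrK.
Qed.
Lemma antipode_trunc_r n : conv (lid H) (antipode_trunc n) = etaeps - negaug_pow n.+1.
Proof.
have -> : lid H = etaeps - negaug by rewrite /negaug opprB addrC subrK.
rewrite convBl conv1l /antipode_trunc conv_sumr.
rewrite [X in X - _]big_nat_recl // [X in _ - X]big_nat_recr //= opprD addrA.
by rewrite addrK.
Qed.

Lemma antipode_l : conv antipode (lid H) = etaeps.
Proof.
apply: at1E => T; transitivity (conv (antipode_trunc (angles T)) (lid H) ∘ decor V T).
  rewrite !conv_decor; apply: eq_big_seq => x xT; rewrite (@antipode_decor _ (angles T)) //.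
  by rewrite -(cop_angles xT) leq_addr.
by rewrite antipode_trunc_l lcompBl negaug_pow0 ?subr0.
Qed.
Lemma antipode_r : conv (lid H) antipode = etaeps.
Proof.
apply: at1E => T; transitivity (conv (lid H) (antipode_trunc (angles T)) ∘ decor V T).
  rewrite !conv_decor; apply: eq_big_seq => x xT; rewrite (@antipode_decor _ (angles T)) //.
  by rewrite -(cop_angles xT) leq_addl.
by rewrite antipode_trunc_r lcompBl negaug_pow0 ?subr0.
Qed.

Lemma Delta_hopf : is_braided_hopf star Delta (at_eps V) c.
Proof.
split; first exact: Delta_bialgebra.
exists (at_one V); split; first exact: at_star_unit.
exists antipode => x; split.
  exact: (lin_app x antipode_l).
exact: (lin_app x antipode_r).
Qed.
End Antipode.
End Coproduct.

(** * Splitting a grafting from left to right *)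

Section LeftRecursion.
Variable t : nat -> ptree.

(** The splittings of [t 0], ..., [t (i-1)] combined from left to right, each
    followed by an angle at the root, colored [false].  The left parts are
    multiplied as they come and the right parts are listed.  This is the order
    in which the formula moves and multiplies, while [cop] works from right to
    left; [sum_copn_vgraft] compares the two. *)
Fixpoint lcop (i : nat) : seq (bitseq * ptree * seq ptree) :=
  if i is i'.+1 then
    flatten [seq flatten [seq [seq (z.1.1 ++ x.1.1 ++ [:: false], M, rcons z.2 x.2)
      | M <- tree_star z.1.2 x.1.2] | x <- cop (t i')] | z <- lcop i']
  else [:: ([::], Leaf, [::])].

Definition stem (T N : ptree) : ptree := if N is Node T1 g then Node T (FCons T1 g) else N.
Fixpoint stems (R : nat -> ptree) i N := if i is i'.+1 then stems R i' (stem (R i') N) else N.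
(** The tree with branches [R 0], ..., [R (n-1)], [U] *)
Definition vgraft (R : nat -> ptree) n U := if n is n'.+1 then stems R n' (Node (R n') (FLast U)) else U.

Fixpoint rdeg (R : nat -> ptree) i := if i is i'.+1 then (rdeg R i' + (angles (R i')).+1)%N else 0%N.

Lemma eq_rdeg R R' i : (forall j, (j < i)%N -> R j = R' j) -> rdeg R i = rdeg R' i.
Proof.
by elim: i => //= i IH h; rewrite h // IH // => j ji; apply: h; apply: ltnW.
Qed.
Lemma eq_stems R R' i N : (forall j, (j < i)%N -> R j = R' j) -> stems R i N = stems R' i N.
Proof.
by elim: i N => //= i IH N h; rewrite h // IH // => j ji; apply: h; apply: ltnW.
Qed.
Lemma nth_rcons_lt (s : seq ptree) x j : (j < size s)%N -> nth Leaf (rcons s x) j = nth Leaf s j.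
Proof. by move=> js; rewrite nth_rcons js. Qed.
Lemma nth_rcons_size (s : seq ptree) x i : size s = i -> nth Leaf (rcons s x) i = x.
Proof. by move=> <-; rewrite nth_rcons ltnn eqxx. Qed.

Lemma lcop_size i z : z \in lcop i ->
  [/\ size z.1.1 = rdeg t i, count id z.1.1 = angles z.1.2,
      count negb z.1.1 = rdeg (nth Leaf z.2) i & size z.2 = i].
Proof.
elim: i z => [|i IH] z /=; first by rewrite inE => /eqP ->.
move=> /flattenP [? /mapP [y /IH [s1 c1 d1 sz] ->]] /flattenP [? /mapP [x]].
move=> /cop_sizeP [s2 c2 d2] -> /mapP [M /angles_star nM ->].
split; rewrite ?size_rcons ?sz //= !(size_cat, count_cat) /=.
- by rewrite s1 s2 addn1.
- by rewrite c1 c2 nM !addn0.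
- rewrite d1 d2 addn1 (nth_rcons_size _ sz); congr (_ + _)%N.
  by apply: eq_rdeg => j ji; rewrite nth_rcons_lt // sz.
Qed.

Section Sums.
Variable W : nmodType.
Lemma sum_lcopS i (F : bitseq * ptree * seq ptree -> W) :
  \sum_(z <- lcop i.+1) F z = \sum_(z <- lcop i) \sum_(x <- cop (t i))
    \sum_(M <- tree_star z.1.2 x.1.2) F (z.1.1 ++ x.1.1 ++ [:: false], M, rcons z.2 x.2).
Proof.
rewrite big_flatten big_map; apply: eq_bigr => z _.
rewrite big_flatten big_map; apply: eq_bigr => y _.
by rewrite big_map.
Qed.

Lemma sum_copn_stem T T1 g (F : bitseq * ptree * ptree -> W) :
  \sum_(z <- copn T (FCons T1 g)) F z =
  \sum_(x <- cop T) \sum_(y <- copn T1 g) \sum_(L <- tree_star x.1.2 y.1.2)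
    F (x.1.1 ++ false :: y.1.1, L, stem x.2 y.2).
Proof.
rewrite sum_cop_join; apply: eq_bigr => x _.
by rewrite copf_cons !sum_cop_join; do 3![apply: eq_bigr => ? _].
Qed.

Definition copnode (N : ptree) := behead (cop N).
Lemma stem_node T N : (exists T1 g, N = Node T1 g) -> exists T1 g, stem T N = Node T1 g.
Proof. by move=> [T1 [g ->]]; exists T, (FCons T1 g). Qed.

(** The first [i] branches are split one at a time, from the last of them to the
    first; associativity of the product moves the parentheses to the left. *)
Lemma sum_copn_stems i N (F : bitseq * ptree * ptree -> W) :
  (exists T1 g, N = Node T1 g) ->
  \sum_(z <- copnode (stems t i N)) F z =
  \sum_(z <- lcop i) \sum_(y <- copnode N) \sum_(M <- tree_star z.1.2 y.1.2)
    F (z.1.1 ++ y.1.1, M, stems (nth Leaf z.2) i y.2).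
Proof.
elim: i N F => [|i IH] N F nN.
  rewrite big_seq1 /=; apply: eq_bigr => y _.
  by rewrite star_leafl big_seq1; case: y => [[]].
rewrite [stems _ _ _]/= (IH _ _ (stem_node _ nN)) sum_lcopS.
rewrite big_seq [RHS]big_seq; apply: eq_bigr => z /lcop_size [_ _ _ sz].
case: nN => T1 [g ->]; rewrite -[copnode (stem _ _)]/(copn (t i) (FCons T1 g)) sum_copn_stem.
apply: eq_bigr => x _; rewrite [RHS]exchange_big /=; apply: eq_bigr => y _.
rewrite star_assoc; apply: eq_bigr => L _; apply: eq_bigr => M _.
rewrite -!catA /= (nth_rcons_size _ sz).
congr (F (_, _, _)); apply: eq_stems => j ji.
by rewrite nth_rcons_lt // sz.
Qed.

Lemma sum_copn_vgraft n (F : bitseq * ptree * ptree -> W) :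
  \sum_(z <- copnode (vgraft t n.+1 (t n.+1))) F z =
  \sum_(z <- lcop n.+1) \sum_(y <- cop (t n.+1)) \sum_(M <- tree_star z.1.2 y.1.2)
    F (z.1.1 ++ y.1.1, M, vgraft (nth Leaf z.2) n.+1 y.2).
Proof.
rewrite [vgraft _ _ _]/= sum_copn_stems; last by exists (t n), (FLast (t n.+1)).
rewrite sum_lcopS big_seq [RHS]big_seq; apply: eq_bigr => z /lcop_size [_ _ _ sz].
rewrite -[copnode _]/(copn (t n) (FLast (t n.+1))) sum_cop_join; apply: eq_bigr => x _.
rewrite copf_last big_map [RHS]exchange_big /=; apply: eq_bigr => y _.
rewrite star_assoc; apply: eq_bigr => L _; apply: eq_bigr => M _.
rewrite -!catA /= (nth_rcons_size _ sz).
congr (F (_, _, _)); apply: eq_stems => j ji.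
by rewrite nth_rcons_lt // sz.
Qed.
End Sums.
End LeftRecursion.

(** * The recursive formula *)

Section Formula.
Variables (k : fieldType) (V : lmodType k) (sigma : {linear V ⊗ V -> V ⊗ V}).
Notation H := (AT V).
Notation c := (at_braid sigma).
Notation Delta := (at_Delta sigma).

Definition tmul : {linear TV V -> {linear TV V -> TV V}} :=
  dlift (fun m => lflip (dlift (fun n => lflip (tcurry (tin V (m + n) ∘ tcat V m n))))).
Lemma tmul_tin m n w w' : tmul (tin V m w) (tin V n w') = tin V (m + n) (tcat V m n (w \ox w')).
Proof. by rewrite [tmul _]dlift_in lflipE [dlift _ _]dlift_in lflipE tcurryE. Qed.

Lemma cut_tmul p w y : cut V p (tmul (tin V p w) y) = tin V p w \ox y.
Proof.
apply: (lin_app y (f := cut V p ∘ tmul (tin V p w)) (g := purer _ (tin V p w))).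
apply: tv_inE => n; apply: linear_ext => w'.
by rewrite !lcompE tmul_tin cut_tcat.
Qed.
Lemma dtens_tmul (X Y : lmodType k) n p (D : {linear TV V -> X}) (E : {linear TV V -> Y}) w y :
  n = p -> dtens p D E (tmul (tin V n w) y) = D (tin V n w) \ox E y.
Proof. by move=> <-; rewrite dtensE lcompE cut_tmul tmapE. Qed.

Lemma tmul_one y : tmul (tone V) y = y.
Proof.
apply: (lin_app y (f := tmul (tone V)) (g := lid _)); apply: tv_inE => n.
by apply: linear_ext => w; rewrite !lcompE tmul_tin tcat0 scale1r.
Qed.
Lemma tmul_cons p v w y :
  tmul (tin V p.+1 (v \ox w)) y = tcons V (v \ox tmul (tin V p w) y).
Proof.
apply: (lin_app y (f := tmul (tin V p.+1 (v \ox w)))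
  (g := tcons V ∘ purer _ v ∘ tmul (tin V p w))).
apply: tv_inE => n; apply: linear_ext => w'; rewrite lcompE [RHS]lcompE tmul_tin.
by rewrite [X in tin _ _ X]tcatS !lcompE tmul_tin purerE tcons_tin.
Qed.
Lemma cutK p n : tuncurry tmul ∘ cut V p ∘ tin V (p + n) = tin V (p + n).
Proof.
rewrite -lcompA cut_tin -[RHS]lcompf1 -tcatK !lcompA; congr (_ ∘ _).
by apply: tensE => w w'; rewrite lcompE tmapE tuncurryE tmul_tin.
Qed.
(** Braids on [p] strands act on the first factor of degree [p], and [liftn_tmul]
    says that shifted operators act on the second one. *)
Lemma strands_tmul f p w y : strands sigma p f -> f (tmul (tin V p w) y) = tmul (f (tin V p w)) y.
Proof.
move=> hf; apply: (lin_app y (f := f ∘ tmul (tin V p w)) (g := tmul (f (tin V p w)))).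
apply: tv_inE => n; apply: linear_ext => w'; rewrite !lcompE tmul_tin.
have [g E] := strands_deg (p + n) hf; set u := tcat _ _ _ _.
have K : tuncurry tmul (cut V p (f (tin V (p + n) u))) = f (tin V (p + n) u).
  by rewrite -[f _]lcompE E; apply: (lin_app (g u) (cutK p n)).
rewrite -K -[cut _ _ _]lcompE (cut_strands hf) lcompE cut_tcat tmapE.
exact: tuncurryE.
Qed.
Lemma liftn_tmul p g w y : liftn p g (tmul (tin V p w) y) = tmul (tin V p w) (g y).
Proof.
elim: p w => [|p IH] w; first by rewrite tin0 !linearZ /= !tmul_one.
pose f1 := lift1 (liftn p g) ∘ lflip tmul y ∘ tin V p.+1.
pose f2 := lflip tmul (g y) ∘ tin V p.+1.
apply: (tens_app (f := f1 : {linear V ⊗ tpow V p -> TV V}) (g := f2)) => v x.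
by rewrite !lcompE !lflipE !tmul_cons lift1_consE IH.
Qed.

(** Reads off a tensor of degree 1, so that a factor [V] between two trees fits
    into the calculus of [dtens]. *)
Definition dV : {linear TV V -> V} := dlift (fun n =>
  match n return {linear tpow V n -> V} with 1 => runit V | _ => 0 end).
Lemma homog_dV : homog 1 dV.
Proof.
by move=> [|[|n]] // _; apply: linear_ext => x; rewrite lcompE [LHS]dlift_in.
Qed.
Lemma dV_tin1 v (a : k^o) : dV (tin V 1 (v \ox a)) = (a : k) *: v.
Proof. by rewrite [LHS]dlift_in lcompE tflipE lunitE. Qed.
Lemma dtens_dV_cons (X : lmodType k) (F : {linear TV V -> X}) v x :
  dtens 1 dV F (tcons V (v \ox x)) = v \ox F x.
Proof.
rewrite dtensE lcompE cutS_cons cut0 sconsE tmapE.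
by rewrite -[tone V]/(tin V 0 _) tcons_tin dV_tin1 scale1r.
Qed.

Lemma homogE_cons (X : lmodType k) p n (f g : {linear TV V -> X}) :
  homog (p + n.+1) f -> homog (p + n.+1) g ->
  (forall w v w', f (tmul (tin V p w) (tcons V (v \ox tin V n w'))) =
     g (tmul (tin V p w) (tcons V (v \ox tin V n w')))) -> f = g.
Proof.
move=> hf hg h; apply: (homogE2 hf hg) => w w'; rewrite -!tmul_tin.
pose F (f : {linear TV V -> X}) := f ∘ tmul (tin V p w) ∘ tin V n.+1.
apply: (tens_app (f := F f : {linear V ⊗ tpow V n -> X}) (g := F g)) => v x.
by rewrite !lcompE -tcons_tin h.
Qed.

Lemma homog_dtens_dV (X : lmodType k) n (F : {linear TV V -> X}) :
  homog n F -> homog n.+1 (dtens 1 dV F).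
Proof. exact: (@homog_dtens _ _ _ _ 1 n). Qed.

Lemma braidV_rule T : at_braidV sigma ∘ dtens 1 dV (decor V T) =
  dtens (angles T) (decor V T) dV ∘ block_swap sigma 1 (angles T).
Proof.
apply: (@homogE_cons _ 0 (angles T)).
- exact/homog_comp/homog_dtens_dV/homog_decor.
- apply: (homog_strands (strands_block_swap _ _ _)); rewrite add0n -addn1.
  exact/homog_dtens/homog_dV.
move=> a v w; rewrite tin0 linearZ [(_ *: tmul _) _]homZE tmul_one !linearZ; congr (_ *: _).
rewrite lcompE dtens_dV_cons decor_tin_angles at_liftV_dec.
rewrite tcons_tin -dect_angles -decor_tin.
have -> : runit V = dV ∘ tin V 1.
  by apply: linear_ext => x; rewrite lcompE [RHS]dlift_in.
rewrite tmap_comp -[tmap _ _ ∘ _ ∘ _]lcompA beta_split_tin.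
by rewrite dtensE !lcompE.
Qed.

Lemma braidV_rule2 (X : lmodType k) T (F : {linear TV V -> X}) :
  act2 (at_braidV sigma) X ∘ dtens 1 dV (dtens (angles T) (decor V T) F) =
  dtens (angles T) (decor V T) (dtens 1 dV F) ∘ block_swap sigma 1 (angles T).
Proof.
rewrite act2_dtens braidV_rule (dtens_left _ _ (strands_block_swap _ _ _)) add1n -addn1.
by rewrite lcompA dtensA.
Qed.

Lemma braid_step_rule (X : lmodType k) R T (F : {linear TV V -> X}) :
  braid_step sigma X ∘ dtens (angles R) (decor V R) (dtens 1 dV (dtens (angles T) (decor V T) F)) =
  dtens (angles T) (decor V T) (dtens (angles R) (decor V R) (dtens 1 dV F))
  ∘ block_swap sigma (angles R).+1 (angles T).
Proof.
rewrite /braid_step -lcompA tmap_dtens lcomp1f braidV_rule2 dtens_right.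
by rewrite lcompA braid_rule -lcompA -block_swap_addl addn1.
Qed.

(** Decorates [R_0], a factor [V], [R_1], a factor [V], ..., [R_{i-1}], a factor
    [V], and leaves the rest of the tensor to [F] *)
Fixpoint dstems (R : nat -> ptree) (i : nat) (X : lmodType k) (F : {linear TV V -> X}) :
    {linear TV V -> AT_V_pow V i X} :=
  match i with
  | 0 => F
  | i'.+1 => dstems R i' (dtens (angles (R i')) (decor V (R i')) (dtens 1 dV F))
  end.

Lemma eq_dstems R R' i (X : lmodType k) (F : {linear TV V -> X}) :
  (forall j, (j < i)%N -> R j = R' j) -> dstems R i F = dstems R' i F.
Proof.
by elim: i X F => //= i IH X F h; rewrite h // IH // => j ji; apply: h; apply: ltnW.
Qed.
Lemma AT_V_map_dstems R i (X Y : lmodType k) (f : {linear X -> Y}) F :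
  AT_V_map V i f ∘ dstems R i F = dstems R i (f ∘ F).
Proof. by elim: i X Y f F => //= i IH X Y f F; rewrite IH !tmap_dtens !lcomp1f. Qed.
Lemma dstems_comp R i (X : lmodType k) (F : {linear TV V -> X}) f :
  dstems R i (F ∘ f) = dstems R i F ∘ liftn (rdeg R i) f.
Proof.
elim: i X F f => [|i IH] X F f //=.
rewrite !dtens_right -liftnD IH -liftnD; congr (_ ∘ liftn _ _); lia.
Qed.

(** [T] passes over all the [R_j] and the factors [V] between them, from right to
    left, as one exchange of blocks. *)
Lemma braid_chain_rule R i (X : lmodType k) T (F : {linear TV V -> X}) :
  braid_chain sigma i X ∘ dstems R i (dtens (angles T) (decor V T) F) =
  dtens (angles T) (decor V T) (dstems R i F) ∘ block_swap sigma (rdeg R i) (angles T).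
Proof.
elim: i X F => [|i IH] X F /=; first by rewrite block_swap0 lcomp1f lcompf1.
rewrite -lcompA AT_V_map_dstems braid_step_rule dstems_comp lcompA IH.
by rewrite -lcompA -block_swap_addl.
Qed.

Lemma graft_last_rule T U :
  graft_last V ∘ dtens (angles T) (decor V T) (dtens 1 dV (decor V U)) = decor V (Node T (FLast U)).
Proof.
apply: (@homogE_cons _ (angles T) (angles U)).
- exact/homog_comp/homog_dtens/homog_dtens_dV/homog_decor.
- by have := @homog_decor _ V (Node T (FLast U)); rewrite angles_node.
move=> w v w'; rewrite lcompE dtens_tmul // dtens_dV_cons !decor_tin_angles at_lift2V_dec.
by rewrite tcons_tin tmul_tin lcompE -decor_tin.
Qed.
Lemma graft_cons_rule T T1 g :
  graft_cons V ∘ dtens (angles T) (decor V T) (dtens 1 dV (decor V (Node T1 g))) =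
  decor V (Node T (FCons T1 g)).
Proof.
apply: (@homogE_cons _ (angles T) (angles (Node T1 g))).
- exact/homog_comp/homog_dtens/homog_dtens_dV/homog_decor.
- by have := @homog_decor _ V (Node T (FCons T1 g)); rewrite angles_node.
move=> w v w'; rewrite lcompE dtens_tmul // dtens_dV_cons !decor_tin_angles at_lift2V_dec.
by rewrite tcons_tin tmul_tin /= -decor_tin.
Qed.

Lemma graft_all_rule R i T1 g :
  graft_all V i ∘ dstems R i (decor V (Node T1 g)) = decor V (stems R i (Node T1 g)).
Proof.
elim: i T1 g => [|i IH] T1 g; first by rewrite lcomp1f.
rewrite /= -lcompA AT_V_map_dstems graft_cons_rule; exact: IH.
Qed.
Lemma graft_rule R n U :
  graft V n.+1 ∘ dstems R n.+1 (decor V U) = decor V (vgraft R n.+1 U).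
Proof. by rewrite /= -lcompA AT_V_map_dstems graft_last_rule graft_all_rule. Qed.

Lemma mul2_nat (X Y : lmodType k) (f : {linear X -> Y}) (m : {linear H ⊗ H -> H}) :
  mul2 m Y ∘ tmap (lid H) (tmap (lid H) f) = tmap (lid H) f ∘ mul2 m X.
Proof.
by rewrite /mul2 -lcompA assocV_nat !lcompA -!tmap_comp tmap_id !(lcomp1f, lcompf1).
Qed.
(** The product of the left parts commutes with what happens to their right, so
    each left part can be multiplied as soon as it has been moved. *)
Lemma star_iter_nat i (X Y : lmodType k) (f : {linear X -> Y}) :
  star_iter V i Y ∘ tmap (lid H) (AT_map V i f) = tmap (lid H) f ∘ star_iter V i X.
Proof.
elim: i X Y f => [|i IH] X Y f /=; first by rewrite lcomp1f lcompf1.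
by rewrite -lcompA IH lcompA mul2_nat lcompA.
Qed.

(** The composite of the iterated braiding and the iterated product *)
Definition gather i X : {linear AT2_V_pow V i (H ⊗ X) -> H ⊗ AT_V_pow V i X} :=
  star_iter V i (AT_V_pow V i X) ∘ Sigma_iter sigma i X.
Lemma gatherS i X : gather i.+1 X =
  mul2 (at_star V) (AT_V_pow V i.+1 X) ∘ tmap (lid H) (braid_chain sigma i.+1 X)
  ∘ gather i (H ⊗ V ⊗ H ⊗ X).
Proof.
apply: linear_ext => x; rewrite /gather [LHS]/=; congr (mul2 _ _ _).
exact: (lin_app _ (star_iter_nat i (braid_chain sigma i.+1 X))).
Qed.

Lemma gather_step R i (X : lmodType k) M L (F : {linear TV V -> X}) :
  mul2 (at_star V) (AT_V_pow V i X) ∘ tmap (lid H) (braid_chain sigma i X)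
    ∘ dtens (angles M) (decor V M) (dstems R i (dtens (angles L) (decor V L) F)) =
  \sum_(N <- tree_star M L) (dtens (angles N) (decor V N) (dstems R i F)
     ∘ liftn (angles M) (block_swap sigma (rdeg R i) (angles L))).
Proof.
rewrite -lcompA tmap_dtens lcomp1f braid_chain_rule dtens_right lcompA.
by rewrite mul2_rule ?lcomp_suml //; apply: star_sized.
Qed.

(** The braid accumulated by one more step: the labels of a new tree are
    unshuffled and those of the next left part cross everything on the right. *)
Lemma unshuffle_gather b b' l (p := (count id b + count id b')%N)
    (q := (count negb b + count negb b')%N) :
  liftn p (block_swap sigma q.+1 l) ∘ (unshuffle sigma (b ++ nseq (count id b') true)
    ∘ liftn (size b) (unshuffle sigma b')) =
  unshuffle sigma ((b ++ b' ++ [:: false]) ++ nseq l true).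
Proof.
have -> : unshuffle sigma (b ++ nseq (count id b') true) ∘ liftn (size b) (unshuffle sigma b') =
    unshuffle sigma (b ++ b').
  by rewrite !unshuffle_cat unshuffle_true liftn_id lcompf1 count_nseq /= mul1n.
have -> : (b ++ b' ++ [:: false]) ++ nseq l true = (b ++ b') ++ (nseq 1 false ++ nseq l true).
  by rewrite /= -!catA.
have cl : count id (nseq 1 false ++ nseq l true) = l by rewrite /= count_nseq mul1n.
rewrite [RHS]unshuffle_cat cl -/(block_swap sigma 1 l) !count_cat -/p -/q.
rewrite -addn1 block_swap_addl liftn_comp -!lcompA; congr (_ ∘ _).
rewrite (strands_liftnC _ (strands_unshuffle _ (leqnn _))) -liftnD; congr (liftn _ _ ∘ _).
by rewrite -(count_predC id) !count_cat addnACA.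
Qed.

Section Words.
Variables (T : nat -> decorated_tree V) (v : nat -> V).
Let t i : ptree := val (tree_shape (T i)).
Let w i : TV V := tin V (tree_angles (T i)) (tpure (tree_angles (T i)) (tree_labels (T i))).

Let at_treeE i : at_tree (T i) = decor V (t i) (w i).
Proof. by rewrite decor_val. Qed.
Let angles_treeE i : tree_angles (T i) = angles (t i).
Proof. by rewrite angles_D. Qed.

(** The labels of the first [i] trees and root angles, followed by [y] *)
Fixpoint label_word i y := if i is i'.+1 then label_word i' (tmul (w i') (tcons V (v i'.+1 \ox y))) else y.

Lemma AT_V_pureE i (X : lmodType k) (F : {linear TV V -> X}) y :
  AT_V_pure (fun j => at_tree (T j)) v i (F y) = dstems t i F (label_word i y).
Proof.
elim: i X F y => //= i IH X F y.
by rewrite -IH (dtens_tmul _ _ _ _ (angles_treeE i)) dtens_dV_cons at_treeE.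
Qed.

Lemma graft_treeE n : graft_tree (fun j => at_tree (T j)) v n.+1 =
  decor V (vgraft t n.+1 (t n.+1)) (label_word n.+1 (w n.+1)).
Proof. by rewrite /graft_tree (at_treeE n.+1) AT_V_pureE -[LHS]lcompE graft_rule. Qed.

Lemma label_word_liftn i (g : {linear TV V -> TV V}) y : label_word i (g y) = liftn (rdeg t i) g (label_word i y).
Proof.
elim: i g y => //= i IH g y.
rewrite liftnD -IH; congr (label_word i _).
by rewrite liftnSr -angles_treeE liftn_tmul lift1_consE.
Qed.

Lemma AT2_V_pure_sum (I : Type) (s : seq I) i (X : lmodType k) u (F : I -> X) :
  AT2_V_pure (V := V) u v i (\sum_(j <- s) F j) = \sum_(j <- s) AT2_V_pure u v i (F j).
Proof.
elim: i X F => //= i IH X F; rewrite -IH; congr (AT2_V_pure _ _ _ _).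
by rewrite !pure_sumr linear_sum.
Qed.

Lemma assoc_decor2 (X : lmodType k) L R (F : {linear TV V -> X}) n x v0 y :
  (angles L + angles R)%N = n ->
  assoc H H (V ⊗ X) (decor2 V L R (tin V n x) \ox v0 \ox F y) =
  dtens (angles L) (decor V L) (dtens (angles R) (decor V R) (dtens 1 dV F))
    (tmul (tin V n x) (tcons V (v0 \ox y))).
Proof.
move=> E; rewrite -dtensA lcompE (dtens_tmul _ _ _ _ (esym E)).
by rewrite dtens_dV_cons.
Qed.

(** The next left part [L] is decorated but not yet moved past the right parts
    when it arrives, whence the block of [true] at the end of the coloring. *)
Lemma gather_label_word i (X : lmodType k) L (F : {linear TV V -> X}) y :
  gather i X (AT2_V_pure (fun j => Delta (at_tree (T j))) v i (dtens (angles L) (decor V L) F y)) =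
  \sum_(z <- lcop t i) \sum_(M <- tree_star z.1.2 L)
    dtens (angles M) (decor V M) (dstems (nth Leaf z.2) i F)
      (unshuffle sigma (z.1.1 ++ nseq (angles L) true) (label_word i y)).
Proof.
elim: i X L F y => [|i IH] X L F y.
  by rewrite /= big_seq1 star_leafl big_seq1 /= unshuffle_true.
set F' := fun x : bitseq * ptree * ptree =>
  dtens (angles x.2) (decor V x.2) (dtens 1 dV (dtens (angles L) (decor V L) F)).
have Dw : Delta (at_tree (T i)) = \sum_(x <- cop (t i)) decor2 V x.1.2 x.2 (unshuffle sigma x.1.1 (w i)).
  by rewrite at_treeE -[LHS]lcompE Delta_decor hom_sumE.
rewrite gatherS [AT2_V_pure _ _ _ _]/= Dw.
have -> : assoc H H (V ⊗ H ⊗ X) ((\sum_(x <- cop (t i)) decor2 V x.1.2 x.2 (unshuffle sigma x.1.1 (w i)))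
     \ox v i.+1 \ox dtens (angles L) (decor V L) F y) =
   \sum_(x <- cop (t i)) dtens (angles x.1.2) (decor V x.1.2) (F' x)
      (unshuffle sigma x.1.1 (tmul (w i) (tcons V (v i.+1 \ox y)))).
  rewrite pure_suml linear_sum; apply: eq_big_seq => x xt.
  have sx : strands sigma (tree_angles (T i)) (unshuffle sigma x.1.1).
    by rewrite angles_treeE; apply: strands_cop.
  rewrite (strands_tmul _ _ sx) /w.
  have [g E] := strands_deg (tree_angles (T i)) sx.
  rewrite -[unshuffle _ _ _]lcompE E lcompE assoc_decor2 //.
  by rewrite angles_treeE (cop_angles xt).
rewrite AT2_V_pure_sum lcompE linear_sum.
under eq_bigr do rewrite IH label_word_liftn.
rewrite exchange_big linear_sum [RHS]sum_lcopS; apply: eq_big_seq => z zt.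
have [sz cz nz rz] := lcop_size zt.
rewrite linear_sum; apply: eq_big_seq => x xt.
have [sx cx nx] := cop_sizeP xt.
rewrite linear_sum; apply: eq_big_seq => M Mzx.
pose R := nth Leaf (rcons z.2 x.2).
have -> : dstems (nth Leaf z.2) i (F' x) = dstems R i.+1 (dtens (angles L) (decor V L) F).
  rewrite /= /R (nth_rcons_size _ rz); apply: eq_dstems => j ji.
  by rewrite nth_rcons_lt // rz.
rewrite -[LHS]lcompE gather_step hom_sumE; apply: eq_bigr => N _.
rewrite lcompE; congr (dtens _ _ _ _).
rewrite -sz -cx -[label_word i.+1 y]/(label_word i (tmul (w i) (tcons V (v i.+1 \ox y)))).
rewrite -!lcompE -lcompA.
have -> : angles M = (count id z.1.1 + count id x.1.1)%N by rewrite cz cx (angles_star Mzx).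
have -> : rdeg R i.+1 = (count negb z.1.1 + count negb x.1.1).+1.
  rewrite nz nx /= {2}/R (nth_rcons_size _ rz) addnS; congr (_ + _).+1.
  by apply: eq_rdeg => j ji; rewrite /R nth_rcons_lt // rz.
by rewrite unshuffle_gather.
Qed.

(** The term with the root on the left is the first summand; the others are the
    splittings of [sum_copn_vgraft], with the braids of [gather_label_word]. *)
Lemma Delta_recursive n :
  Delta (graft_tree (fun j => at_tree (T j)) v n.+1) =
    graft_tree (fun j => at_tree (T j)) v n.+1 \ox at_one V +
    (tmap (lid H) (graft V n.+1) ∘ star_iter V n.+1 (AT_V_pow V n.+1 H)
       ∘ Sigma_iter sigma n.+1 H)
      (AT2_V_pure (fun j => Delta (at_tree (T j))) v n.+1 (Delta (at_tree (T n.+1)))).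
Proof.
rewrite graft_treeE -[LHS]lcompE Delta_decor hom_sumE.
set N := vgraft t n.+1 (t n.+1); set W := label_word n.+1 (w n.+1).
transitivity (decor V N W \ox at_one V +
  \sum_(x <- copnode N) decor2 V x.1.2 x.2 (unshuffle sigma x.1.1 W)).
  have nN : exists T1 g, N = Node T1 g.
    rewrite /N /=; elim: n (t n) (FLast _) {N W} => [|n IH] T0 g; first by exists T0, g.
    exact: IH.
  case: nN => T1 [g ->]; rewrite cop_node big_cons /=; congr (_ + _).
  by rewrite unshuffle_true [decor2 _ _ _](dtens_leaf_r (@homog_decor _ _ _)).
congr (_ + _); rewrite (sum_copn_vgraft t n (fun x => decor2 V x.1.2 x.2 (unshuffle sigma x.1.1 W))).
rewrite -[RHS]/(tmap (lid H) (graft V n.+1) (gather n.+1 H _)).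
rewrite [Delta (at_tree (T n.+1))](_ : _ = \sum_(x <- cop (t n.+1))
  decor2 V x.1.2 x.2 (unshuffle sigma x.1.1 (w n.+1))); last first.
  by rewrite at_treeE -[LHS]lcompE Delta_decor hom_sumE.
rewrite AT2_V_pure_sum 2!linear_sum exchange_big; apply: eq_big_seq => x xt.
have [sx cx nx] := cop_sizeP xt.
rewrite -[decor2 V _ _ in RHS]/(dtens (angles x.1.2) (decor V x.1.2) (decor V x.2)) gather_label_word.
rewrite linear_sum; apply: eq_big_seq => z zt.
have [sz cz nz rz] := lcop_size zt.
rewrite linear_sum; apply: eq_bigr => M _; rewrite [LHS]/=.
rewrite -[RHS]lcompE tmap_dtens lcomp1f graft_rule (label_word_liftn n.+1).
congr (decor2 _ _ _ _).
have <- : unshuffle sigma (z.1.1 ++ nseq (count id x.1.1) true) ∘ liftn (size z.1.1) (unshuffle sigma x.1.1) =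
    unshuffle sigma (z.1.1 ++ x.1.1).
  by rewrite !unshuffle_cat unshuffle_true liftn_id lcompf1 count_nseq /= mul1n.
by rewrite lcompE cx sz.
Qed.
End Words.
End Formula.

Theorem theorem4p10 (k : fieldType) (char0 : [pchar k] =i pred0)
    (V : lmodType k) (sigma : {linear V ⊗ V -> V ⊗ V})
    (sigma_braiding : is_braiding sigma) :
  exists Delta : {linear AT V -> AT V ⊗ AT V},
    [/\ is_AT_coproduct sigma Delta,
        forall Delta' : {linear AT V -> AT V ⊗ AT V},
          is_AT_coproduct sigma Delta' -> Delta' =1 Delta,
        is_braided_hopf (at_star V) Delta (at_eps V) (at_braid sigma),
        Delta (at_one V) = at_one V \ox at_one V
      & forall (n : nat) (T : nat -> decorated_tree V) (v : nat -> V),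
          (1 <= n)%N ->
          let T' i := at_tree (T i) in
          Delta (graft_tree T' v n) =
            graft_tree T' v n \ox at_one V +
            (tmap (lid (AT V)) (graft V n)
               ∘ star_iter V n (AT_V_pow V n (AT V))
               ∘ Sigma_iter sigma n (AT V))
              (AT2_V_pure (fun i => Delta (T' i)) v n (Delta (T' n)))].
Proof.
exists (at_Delta sigma); split.
- exact: Delta_AT_coproduct.
- by move=> D hD x; rewrite (AT_coproduct_unique hD (Delta_AT_coproduct sigma_braiding)).
- exact: Delta_hopf.
- exact: Delta_one.
- by move=> [|n] // T v _; apply: Delta_recursive.
Qed.
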